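(* Let $0<\lambda\le1$. If $-1<\alpha,\beta\le-\tfrac12$, then for every integer $m\ge1$ and every $v$ such that $x\mapsto v(x^{1/\lambda})$ belongs to $B^{m,1}_{\alpha,\beta}(I)$, $$\|v-I^{\alpha,\beta}_{N,\lambda}v\|_\infty\le c\,N^{1/2-m}\,\big\|\partial_x^m\{v(x^{1/\lambda})\}\big\|_{0,\omega^{\alpha+m,\beta+m,1}} .$$
   Context: $I=[0,1]$; $\|\cdot\|_\infty$ is the sup norm on $I$; $c$ denotes a generic positive constant, independent of $N$ and $v$. $\omega^{\alpha,\beta,1}(x)=(1-x)^\alpha x^\beta$; $\|v\|_{0,\omega}=(\int_0^1v^2\omega\,dx)^{1/2}$. $B^{m,1}_{\alpha,\beta}(I)=\{v:\partial_x^kv\in L^2_{\omega^{\alpha+k,\beta+k,1}}(I),\ 0\le k\le m\}$. $J_n^{\alpha,\beta}$ is the classical Jacobi polynomial of degree $n$ on $[-1,1]$, $J_n^{\alpha,\beta,\lambda}(x)=J_n^{\alpha,\beta}(2x^\lambda-1)$ for $x\in I$, and $x_0<\dots<x_N$ are the zeros of $J_{N+1}^{\alpha,\beta,\lambda}$ in $I$. The interpolation operator is $I^{\alpha,\beta}_{N,\lambda}v(x)=\sum_{j=0}^Nv(x_j)h_{j,\lambda}^{\alpha,\beta}(x)$ with $h_{j,\lambda}^{\alpha,\beta}(x)=\prod_{i\ne j}\frac{x^\lambda-x_i^\lambda}{x_j^\lambda-x_i^\lambda}$.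
   Formalization: The estimate is proved for N ≥ 1 with m ≤ N+1 (it fails for N+1 < m, e.g. v(x^{1/λ}) = x^{m-1}, where the right side is 0), and v is taken as its continuous representative on I, whose existence is proved. *)

(* Defs.v *)
From HB Require Import structures.
From mathcomp Require Import all_boot all_order all_algebra.
From mathcomp Require Import all_classical all_reals all_analysis.

Set Implicit Arguments.
Unset Strict Implicit.
Unset Printing Implicit Defensive.

Import Order.TTheory GRing.Theory Num.Theory.
Import numFieldNormedType.Exports.
Local Open Scope classical_set_scope.
Local Open Scope ring_scope.

Definition unitI (R : realType) : set R := `[0, 1]%classic.
Definition unitIo (R : realType) : set R := `]0, 1[%classic.

Definition weight (R : realType) (a b x : R) : R := (1 - x) `^ a * x `^ b.

(* The weighted integrals are taken over the open interval: the endpoints are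
   negligible, and for negative exponents the weight is singular there. *)
Definition in_L2w (R : realType) (a b : R) (f : R -> R) : Prop :=
  measurable_fun (@unitIo R) f /\
  (\int[@lebesgue_measure R]_(x in @unitIo R)
     ((f x) ^+ 2 * weight a b x)%:E < +oo)%E.

Definition norm_L2w (R : realType) (a b : R) (f : R -> R) : R :=
  Num.sqrt (\int[@lebesgue_measure R]_(x in @unitIo R)
              ((f x) ^+ 2 * weight a b x)).

Definition test_function (R : realType) (phi : R -> R) : Prop :=
  (forall (n : nat) (x : R), derivable (derive1n n phi) x 1) /\
  exists a b : R, [/\ 0 < a, b < 1 &
    forall x : R, ~ (a <= x <= b) -> phi x = 0].

Definition weak_derivative (R : realType) (k : nat) (f g : R -> R) : Prop :=
  [/\ locally_integrable (@unitIo R) f,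
      locally_integrable (@unitIo R) g &
      forall phi : R -> R, test_function phi ->
        \int[@lebesgue_measure R]_(x in @unitIo R) (f x * derive1n k phi x) =
        (-1) ^+ k *
        \int[@lebesgue_measure R]_(x in @unitIo R) (g x * phi x)].

(* B^{m,1}_{a,b}(I); the derivatives are distributional. *)
Definition in_B (R : realType) (m : nat) (a b : R) (f : R -> R) : Prop :=
  forall k : nat, (k <= m)%N ->
    exists g : R -> R,
      weak_derivative k f g /\ in_L2w (a + k%:R) (b + k%:R) g.

(* Elements of B^{m,1} are classes modulo almost everywhere equality, whereas
   the interpolant and the sup norm use pointwise values on I: these are the
   values of the continuous representative, which is unique on I. *)
Definition continuous_representative (R : realType) (f g : R -> R) : Prop :=
  {within @unitI R, continuous g} /\
  ae_eq (@lebesgue_measure R) (@unitI R) g f.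

(* Valued in \bar R, so that the norm of an unbounded function is +oo. *)
Definition sup_norm (R : realType) (f : R -> R) : \bar R :=
  ereal_sup [set (`|f x|)%:E | x in @unitI R].

Definition gen_binomial (R : realType) (a : R) (k : nat) : R :=
  (\prod_(i < k) (a - i%:R)) / k`!%:R.

(* J_n^{a,b} on [-1,1] in the standard normalization, i.e.
   \sum_s C(n+a, n-s) C(n+b, s) ((x-1)/2)^s ((x+1)/2)^(n-s)
   (Szego, Orthogonal Polynomials, formula 4.3.2). *)
Definition jacobi (R : realType) (a b : R) (n : nat) : {poly R} :=
  \sum_(s < n.+1)
    (gen_binomial (n%:R + a) (n - s) * gen_binomial (n%:R + b) s) *:
    ((2^-1 *: ('X - 1)) ^+ s * (2^-1 *: ('X + 1)) ^+ (n - s)).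

Definition muntz_jacobi (R : realType) (a b lambda : R) (n : nat) (x : R) : R :=
  (jacobi a b n).[2 * x `^ lambda - 1].

Definition are_zeros (R : realType) (a b lambda : R) (N : nat)
    (x : 'I_N.+1 -> R) : Prop :=
  (forall i j : 'I_N.+1, (i < j)%N -> x i < x j) /\
  range x = [set t | @unitI R t /\ muntz_jacobi a b lambda N.+1 t = 0].

Definition cardinal_fun (R : realType) (lambda : R) (N : nat)
    (x : 'I_N.+1 -> R) (j : 'I_N.+1) (t : R) : R :=
  \prod_(i < N.+1 | i != j)
    ((t `^ lambda - x i `^ lambda) / (x j `^ lambda - x i `^ lambda)).

Definition interp (R : realType) (lambda : R) (N : nat)
    (x : 'I_N.+1 -> R) (v : R -> R) (t : R) : R :=
  \sum_(j < N.+1) v (x j) * cardinal_fun lambda x j t.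

(* Main.v *)
(* The substitution y = x^lambda turns the statement into polynomial interpolation at
   the Gauss-Jacobi nodes z_j of a function u on [0, 1]. For a polynomial u of any
   degree, expand u in Jacobi polynomials and cut the expansion into dyadic blocks of
   degree about M = 2^k N. On a block P, integrating P^2 along the angle variable
   against a Fejer kernel (a large sieve argument of Gallagher type) bounds
   both |P(x)|^2 by a constant times M |P|^2 and the quadrature sum of P^2 at the nodes
   by a constant times (M / N) |P|^2; alpha, beta <= -1/2 is what makes
   the weighted integral of the kernel at x at most (C / n) x^(beta+1/2) (1-x)^(alpha+1/2). As
   the eigenvalue relation gives |P| <= C M^(-m) |P^(m)|, the blocks sum geometrically
   to C N^(1/2-m) |u^(m)|. A general u has weak derivatives that are successive
   primitives of each other (du Bois-Reymond, by Lebesgue points), so approximating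
   u^(m) by polynomials in the weighted L2 norm and integrating m times gives
   polynomials that converge to u locally uniformly on ]0, 1[, which contains all the
   nodes; the continuity of u covers the endpoints. *)
Require Import Defs.
From HB Require Import structures.
From mathcomp Require Import all_boot all_order all_algebra.
From mathcomp Require Import all_classical all_reals all_analysis.
From mathcomp Require Import measurable_realfun ring lra zify.

Import Order.TTheory GRing.Theory Num.Theory.
Import numFieldNormedType.Exports.
Local Open Scope classical_set_scope.
Local Open Scope ring_scope.

Set Implicit Arguments.
Unset Strict Implicit.
Unset Printing Implicit Defensive.

(** No estimate of the node spacing or of the quadrature weights enters. The kernel is a polynomial
    of degree below N in each variable, so its quadrature sum over the nodes equals its integral,
    and this exactness replaces both. What remains is one integral, bounded by a majorant with an
    explicit arctangent primitive.

    The exponents balance as follows. A block P of degree about M has squared sup norm at most C M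
    |P|^2. Its interpolant has degree N, so its squared sup norm is at most C N times its squared
    weighted norm; that norm is the quadrature sum, at most C (M / N) |P|^2, and the product is C M
    |P|^2 again. A block thus contributes a constant times M^(1/2-m) |u^(m)|, which is summable over
    M = 2^k N because m >= 1. Applied to the whole tail at once, the same bounds would grow with the
    degree of u, while the passage to the limit needs a constant independent of it. *)

(** * The fundamental theorem of calculus with singular endpoints *)

Lemma is_derive_continuous (R : realType) (f : R -> R) (x df : R) :
  is_derive x 1 f df -> {for x, continuous f}.
Proof.
by move=> [dfx _]; apply: differentiable_continuous; exact/derivable1_diffP.
Qed.

Lemma FTC2_cc (R : realType) (F f : R -> R) (a b : R) : a < b ->
  (forall x, a <= x <= b -> is_derive x 1 F (f x)) ->
  (forall x, a <= x <= b -> {for x, continuous f}) ->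
  (\int[@lebesgue_measure R]_(x in `[a, b]) (f x)%:E = (F b - F a)%:E)%E.
Proof.
move=> ab dF cf; rewrite EFinB; apply: continuous_FTC2 => //.
- apply: continuous_in_subspaceT => x; rewrite inE/= in_itv/= => xab.
  exact: cf.
- split.
  + by move=> x /[!in_itv]/= /andP[ax xb]; case: (dF x); rewrite ?ltW.
  + apply: cvg_at_right_filter; apply: is_derive_continuous.
    by apply: dF; rewrite lexx ltW.
  + apply: cvg_at_left_filter; apply: is_derive_continuous.
    by apply: dF; rewrite lexx ltW.
- move=> x /[!in_itv]/= /andP[ax xb]; rewrite derive1E.
  by case: (dF x) => [|//]; rewrite !ltW.
Qed.

(** The segments [[a + e n, b - e n]] exhaust the open interval; the closed version holds on each,
    and positivity of [f] allows monotone convergence. Near the ends only the limits of [F] are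
    assumed, which suits singular weights. *)
Lemma ge0_FTC2_oo (R : realType) (F f : R -> R) (a b : R) : a < b ->
  (forall x, a < x < b -> is_derive x 1 F (f x)) ->
  (forall x, a < x < b -> {for x, continuous f}) ->
  (forall x, a < x < b -> 0 <= f x) ->
  F x @[x --> a^'+] --> F a -> F x @[x --> b^'-] --> F b ->
  (\int[@lebesgue_measure R]_(x in `]a, b[) (f x)%:E = (F b - F a)%:E)%E.
Proof.
move=> ab dF cf f0 Fa Fb.
(* At most a third of the length, so that every segment is nondegenerate. *)
pose e (n : nat) : R := (b - a) / n.+3%:R.
have ba0 : 0 < b - a by rewrite subr_gt0.
have e0 n : 0 < e n by rewrite divr_gt0.
have e3 n : e n <= (b - a) / 3.
  by rewrite ler_pM2l// lef_pV2 ?posrE// ler_nat.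
have eD n m : (n <= m)%N -> e m <= e n.
  by move=> nm; rewrite ler_pM2l// lef_pV2 ?posrE// ler_nat.
have ecvg : e n @[n --> \oo] --> 0.
  rewrite -[X in _ --> X](mulr0 (b - a)); apply: cvgM; first exact: cvg_cst.
  have := @cvg_harmonic R; rewrite -(cvg_shiftn 2) /=.
  by under eq_fun do rewrite addn2.
pose J n := `[a + e n, b - e n]%classic.
have JE : \bigcup_n J n = `]a, b[%classic.
  apply/seteqP; split=> x /=.
    move=> [n _]; rewrite /J/= !in_itv/= => /andP[h1 h2].
    by have := e0 n => ?; apply/andP; split; lra.
  rewrite in_itv/= => /andP[ax xb].
  have m0 : 0 < Num.min (x - a) (b - x) by rewrite lt_min !subr_gt0 ax.
  have /cvgrPdist_lt/(_ _ m0)[n _ /(_ n (leqnn n))/=] := ecvg.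
  rewrite sub0r normrN gtr0_norm// lt_min => /andP[h1 h2].
  by exists n => //; rewrite /J/= in_itv/=; apply/andP; split; lra.
have Jsub n x : a + e n <= x <= b - e n -> a < x < b.
  by move=> /andP[h1 h2]; have := e0 n => ?; apply/andP; split; lra.
have h1 : (\int[@lebesgue_measure R]_(x in J n) (f x)%:E @[n --> \oo] -->
    \int[@lebesgue_measure R]_(x in `]a, b[) (f x)%:E)%E.
  rewrite -JE; apply: ge0_nondecreasing_set_cvg_integral.
  - apply/nondecreasing_seqP => n; apply/subsetPset => x.
    rewrite /J/= !in_itv/= => /andP[k1 k2].
    by have := eD _ _ (leqnSn n) => ?; apply/andP; split; lra.
  - by move=> n; exact: measurable_itv.
  - move=> n; apply/measurable_EFinP.
    apply: subspace_continuous_measurable_fun; first exact: measurable_itv.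
    have : {in J n, continuous f}.
      by move=> x; rewrite inE /J/= in_itv/= => /Jsub; exact: cf.
    exact: continuous_in_subspaceT.
  - move=> n x; rewrite /J/= in_itv/= => /Jsub xab; rewrite lee_fin; exact: f0.
have h2 : (\int[@lebesgue_measure R]_(x in J n) (f x)%:E @[n --> \oo] -->
    (F b - F a)%:E)%E.
  have -> : (fun n => \int[@lebesgue_measure R]_(x in J n) (f x)%:E)%E =
      (fun n => (F (b - e n) - F (a + e n))%:E).
    apply/funext => n; apply: (@FTC2_cc R F f).
    - by have := e3 n; have := e0 n => ? ?; lra.
    - by move=> x /Jsub; exact: dF.
    - by move=> x /Jsub; exact: cf.
  apply: cvg_EFin; first exact: nearW.
  apply: cvgB.
    move/cvg_at_leftP : Fb; apply; split=> [n|]; first by rewrite ltrBlDr ltrDl.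
    by rewrite -[X in _ --> X]subr0; apply: cvgB => //; exact: cvg_cst.
  move/cvg_at_rightP : Fa; apply; split=> [n|]; first by rewrite ltrDl.
  by rewrite -[X in _ --> X]addr0; apply: cvgD => //; exact: cvg_cst.
by have := cvg_unique _ h1 h2; apply.
Qed.

Lemma continuous_measurable_oo (R : realType) (f : R -> R) (a b : R) :
  (forall x, a < x < b -> {for x, continuous f}) ->
  measurable_fun (`]a, b[%classic : set R) f.
Proof.
move=> cf; apply: open_continuous_measurable_fun; first exact: interval_open.
by move=> x; rewrite inE/= in_itv/=; exact: cf.
Qed.

(** Adding the majorant restores positivity: [ge0_FTC2_oo] applies to f + g and to g, and the
    difference is the claim for f. *)
Lemma dominated_FTC2_oo (R : realType) (F f G g : R -> R) (a b : R) : a < b ->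
  (forall x, a < x < b -> is_derive x 1 F (f x)) ->
  (forall x, a < x < b -> {for x, continuous f}) ->
  F x @[x --> a^'+] --> F a -> F x @[x --> b^'-] --> F b ->
  (forall x, a < x < b -> is_derive x 1 G (g x)) ->
  (forall x, a < x < b -> {for x, continuous g}) ->
  G x @[x --> a^'+] --> G a -> G x @[x --> b^'-] --> G b ->
  (forall x, a < x < b -> `|f x| <= g x) ->
  (@lebesgue_measure R).-integrable `]a, b[ (EFin \o f) /\
  (\int[@lebesgue_measure R]_(x in `]a, b[) f x = F b - F a)%R.
Proof.
move=> ab dF cf Fa Fb dG cg Ga Gb fg.
have g0 x : a < x < b -> 0 <= g x by move=> /fg; exact: le_trans.
have ig : (@lebesgue_measure R).-integrable `]a, b[ (EFin \o g).
  apply/integrableP; split.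
    by apply/measurable_EFinP; exact: continuous_measurable_oo.
  under eq_integral => x xab.
    rewrite inE/= in_itv/= in xab; rewrite /= ger0_norm ?g0//.
    over.
  by rewrite (@ge0_FTC2_oo R G g a b ab dG cg g0 Ga Gb) ltry.
have if_ : (@lebesgue_measure R).-integrable `]a, b[ (EFin \o f).
  apply: le_integrable ig => //.
    by apply/measurable_EFinP; exact: continuous_measurable_oo.
  move=> x /=; rewrite in_itv/= => xab; rewrite lee_fin.
  by rewrite (le_trans (fg _ xab))// ler_norm.
split => //.
have -> : \int[@lebesgue_measure R]_(x in `]a, b[) f x =
    \int[@lebesgue_measure R]_(x in `]a, b[) ((f x + g x) - g x).
  by apply: eq_Rintegral => x _; rewrite addrK.
rewrite RintegralB//; last first.
  by rewrite (_ : _ \o _ = (EFin \o f) \+ (EFin \o g))%E//; exact: integrableD.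
have h : (\int[@lebesgue_measure R]_(x in `]a, b[) (f x + g x)%:E =
    ((F \+ G) b - (F \+ G) a)%:E)%E.
  apply: (@ge0_FTC2_oo R (F \+ G) (f \+ g)) => //.
  - by move=> x xab; apply: is_deriveD; [exact: dF|exact: dG].
  - by move=> x xab; apply: cvgD; [exact: cf|exact: cg].
  - move=> x xab /=; rewrite -lerBlDr sub0r.
    by have := fg _ xab; rewrite ler_norml => /andP[].
  - exact: cvgD.
  - exact: cvgD.
by rewrite /Rintegral h (@ge0_FTC2_oo R G g a b ab dG cg g0 Ga Gb)/=; ring.
Qed.

Lemma continuous_integrable_cc (R : realType) (f : R -> R) (a b : R) :
  (forall x, a <= x <= b -> {for x, continuous f}) ->
  (@lebesgue_measure R).-integrable `[a, b] (EFin \o f).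
Proof.
move=> cf; apply: continuous_compact_integrable; first exact: segment_compact.
have : {in (`[a, b]%classic : set R), continuous f}.
  by move=> x; rewrite inE/= in_itv/=; exact: cf.
exact: continuous_in_subspaceT.
Qed.

Lemma cvg_at_right_continuous (R : realType) (f : R -> R) (x : R) :
  {for x, continuous f} -> f t @[t --> x^'+] --> f x.
Proof. exact: cvg_at_right_filter. Qed.

Lemma cvg_at_left_continuous (R : realType) (f : R -> R) (x : R) :
  {for x, continuous f} -> f t @[t --> x^'-] --> f x.
Proof. exact: cvg_at_left_filter. Qed.

Lemma is_derive_horner (R : realType) (p : {poly R}) (x : R) :
  is_derive x 1 (horner p) (p^`()).[x].
Proof.
elim/poly_ind: p => [|p c IH].
  rewrite deriv0 horner0; have -> : horner (0 : {poly R}) = cst 0.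
    by apply/funext => y; rewrite horner0.
  exact: is_derive_cst.
have -> : horner (p * 'X + c%:P) = (horner p * id) + cst c.
  by apply/funext => y /=; rewrite hornerMXaddC.
apply: is_derive_eq.
rewrite derivD derivM derivX derivC !addr0 mulr1 hornerD hornerM hornerX.
by rewrite /GRing.scale/= mulr1 addrC mulrC.
Qed.

Lemma continuous_horner_at (R : realType) (p : {poly R}) (x : R) :
  {for x, continuous (horner p)}.
Proof. exact: is_derive_continuous (is_derive_horner p x). Qed.

Lemma poly_unit_bound (R : realType) (p : {poly R}) :
  exists2 K : R, 0 <= K & forall x : R, 0 <= x <= 1 -> `|p.[x]| <= K.
Proof.
have [K HK] := poly_disk_bound p 1; exists K.
  by apply: (le_trans _ (HK 0 _)); rewrite ?normr0.
by move=> x /andP[x0 x1]; apply: HK; rewrite ger0_norm.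
Qed.

(** * The Jacobi weight *)

Lemma is_derive_powR (R : realType) (b x : R) : 0 < x ->
  is_derive x 1 (fun t : R => t `^ b) (b * x `^ (b - 1)).
Proof. exact: is_derive1_powR. Qed.

Lemma is_derive_powR_onem (R : realType) (a x : R) : x < 1 ->
  is_derive x 1 (fun t : R => (1 - t) `^ a) (- (a * (1 - x) `^ (a - 1))).
Proof.
move=> x1; have x10 : 0 < 1 - x by rewrite subr_gt0.
have h1 : is_derive x 1 (fun t : R => 1 - t) (- 1).
  apply: (is_derive_eq (is_deriveB (is_derive_cst (1 : R^o) x 1) (is_derive_id x (1 : R^o)))).
  by rewrite sub0r.
have h2 : is_derive (1 - x) 1 (fun t : R => t `^ a) (a * (1 - x) `^ (a - 1)).
  exact: is_derive_powR.
have := @is_derive1_comp _ (fun t => t `^ a) (fun t => 1 - t) _ _ _ h2 h1.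
by move=> h; apply: is_derive_eq; rewrite mulrN1.
Qed.

Lemma is_derive_weight (R : realType) (a b x : R) : 0 < x < 1 ->
  is_derive x 1 (weight (a + 1) (b + 1))
    (((b + 1) * (1 - x) - (a + 1) * x) * weight a b x).
Proof.
move=> /andP[x0 x1]; have y0 : 0 < 1 - x by rewrite subr_gt0.
have h1 := is_derive_powR (b + 1) x0.
have h2 := is_derive_powR_onem (a + 1) x1.
apply: (is_derive_eq (is_deriveM h2 h1)); rewrite /weight /GRing.scale/= !addrK.
rewrite !powRD ?powRr1 ?(gt_eqF x0) ?(gt_eqF y0) ?implybT ?ltW//; ring.
Qed.

Lemma continuous_weight_at (R : realType) (a b x : R) : 0 < x < 1 ->
  {for x, continuous (weight a b)}.
Proof.
move=> h; apply: is_derive_continuous.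
by have := is_derive_weight (a - 1) (b - 1) h; rewrite !subrK; apply.
Qed.

Lemma weight_ge0 (R : realType) (a b x : R) : 0 <= weight a b x.
Proof. by rewrite mulr_ge0// powR_ge0. Qed.

Lemma weightD1 (R : realType) (a b x : R) : 0 < x < 1 ->
  weight (a + 1) (b + 1) x = x * (1 - x) * weight a b x.
Proof.
move=> /andP[x0 x1]; have y0 : 0 < 1 - x by rewrite subr_gt0.
rewrite /weight !powRD ?powRr1 ?(gt_eqF x0) ?(gt_eqF y0) ?implybT ?ltW//; ring.
Qed.

Lemma powR_le2 (R : realType) (a x : R) : -1 < a -> 2^-1 <= x <= 1 ->
  x `^ a <= 2.
Proof.
move=> a1 /andP[x2 x1].
have x0 : 0 < x by rewrite (lt_le_trans _ x2).
apply: (@le_trans _ _ (x `^ (-1))); first by apply: ger_powR; rewrite ?x0// ltW.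
by rewrite powR_inv1 ?(ltW x0)// -[leRHS]invrK lef_pV2 ?posrE ?invr_gt0.
Qed.

(* A majorant of the weight with an explicit primitive. *)
Definition weight_maj (R : realType) (a b x : R) : R :=
  2 * (x `^ b + (1 - x) `^ a).

Definition weight_maj_prim (R : realType) (a b x : R) : R :=
  2 * (x `^ (b + 1) / (b + 1) - (1 - x) `^ (a + 1) / (a + 1)).

(** Each half of the interval contains only one singularity; on it the other factor is at most 2,
    its base lying in [1/2, 1] and its exponent above -1. *)
Lemma weight_le_maj (R : realType) (a b x : R) : -1 < a -> -1 < b ->
  0 < x < 1 -> weight a b x <= weight_maj a b x.
Proof.
move=> a1 b1 /andP[x0 x1]; rewrite /weight /weight_maj.
have p0 := powR_ge0 x b; have q0 := powR_ge0 (1 - x) a.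
have [xh|xh] := leP x 2^-1.
  have h : (1 - x) `^ a <= 2 by apply: powR_le2 => //; apply/andP; split; lra.
  by have := ler_wpM2r p0 h => ?; lra.
have h : x `^ b <= 2 by apply: powR_le2 => //; apply/andP; split; lra.
by have := ler_wpM2l q0 h => ?; lra.
Qed.

Lemma is_derive_weight_maj_prim (R : realType) (a b x : R) : -1 < a -> -1 < b ->
  0 < x < 1 -> is_derive x 1 (weight_maj_prim a b) (weight_maj a b x).
Proof.
move=> a1 b1 /andP[x0 x1].
have h1 := is_derive_powR (b + 1) x0.
have h2 := is_derive_powR_onem (a + 1) x1.
have b0 : b + 1 != 0 by rewrite gt_eqF//; lra.
have a0 : a + 1 != 0 by rewrite gt_eqF//; lra.
have h := is_deriveZ 2 (is_deriveB (is_deriveZ (b + 1)^-1 h1) (is_deriveZ (a + 1)^-1 h2)).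
have -> : weight_maj_prim a b = 2 \*: (((b + 1)^-1 \*: (fun t : R => t `^ (b + 1)))
   - ((a + 1)^-1 \*: (fun t : R => (1 - t) `^ (a + 1)))).
  apply/funext => t; rewrite /weight_maj_prim !fctE /GRing.scale/=.
  by congr (2 * (_ - _)); rewrite mulrC.
apply: (is_derive_eq h); rewrite /weight_maj /GRing.scale/= !addrK.
by field; rewrite b0 a0.
Qed.

Lemma continuous_weight_maj_at (R : realType) (a b x : R) : 0 < x < 1 ->
  {for x, continuous (weight_maj a b)}.
Proof.
move=> /andP[x0 x1].
have h1 := is_derive_continuous (is_derive_powR b x0).
have h2 := is_derive_continuous (is_derive_powR_onem a x1).
by apply: cvgM; [exact: cvg_cst|exact: cvgD].
Qed.

Lemma powR_cvg_right0 (R : realType) (p : R) : 0 < p ->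
  (t : R) `^ p @[t --> 0^'+] --> (0 : R) `^ p.
Proof. by move=> p0; rewrite powR0 ?gt_eqF//; exact: powR_cvg0. Qed.

Lemma onem_cvg_left1 (R : realType) : (1 - t : R) @[t --> 1^'-] --> (0 : R)^'+.
Proof.
move=> A [e/= e0 eA]; exists e => // t /= te t1; apply: eA => /=.
  by rewrite sub0r normrN.
by rewrite subr_gt0.
Qed.

Lemma powR_onem_cvg_left1 (R : realType) (p : R) : 0 < p ->
  (1 - t : R) `^ p @[t --> 1^'-] --> (1 - 1 : R) `^ p.
Proof.
move=> p0; rewrite subrr.
exact: (cvg_comp _ _ (@onem_cvg_left1 R) (powR_cvg_right0 p0)).
Qed.

Lemma weight_maj_prim_right0 (R : realType) (a b : R) : -1 < a -> -1 < b ->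
  weight_maj_prim a b t @[t --> 0^'+] --> weight_maj_prim a b 0.
Proof.
move=> a1 b1; apply: cvgM; first exact: cvg_cst.
apply: cvgB; apply: cvgM; try exact: cvg_cst.
  by apply: powR_cvg_right0; lra.
apply: cvg_at_right_continuous.
exact: is_derive_continuous (is_derive_powR_onem _ ltr01).
Qed.

Lemma weight_maj_prim_left1 (R : realType) (a b : R) : -1 < a -> -1 < b ->
  weight_maj_prim a b t @[t --> 1^'-] --> weight_maj_prim a b 1.
Proof.
move=> a1 b1; apply: cvgM; first exact: cvg_cst.
apply: cvgB; apply: cvgM; try exact: cvg_cst.
  apply: cvg_at_left_continuous.
  exact: is_derive_continuous (is_derive_powR _ ltr01).
by apply: powR_onem_cvg_left1; lra.
Qed.

Lemma unitIoP (R : realType) (x : R) : @unitIo R x <-> 0 < x < 1.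
Proof. by rewrite /unitIo /= in_itv. Qed.

Lemma measurable_unitIo (R : realType) : (@measurable _ (measurableTypeR R) (@unitIo R)).
Proof. exact: measurable_itv. Qed.

(** The integrand is the derivative of [P] times the weight with both exponents raised by one. This
    product vanishes at 0 and 1 because [a + 1] and [b + 1] are positive, so this is integration by
    parts without boundary terms. *)
Lemma poly_weight_FTC2 (R : realType) (a b : R) (P p : {poly R}) :
  -1 < a -> -1 < b ->
  p = ((b + 1) *: (1 - 'X) - (a + 1) *: 'X) * P + 'X * (1 - 'X) * P^`() ->
  (@lebesgue_measure R).-integrable (@unitIo R)
    (EFin \o (fun x : R => p.[x] * weight a b x)) /\
  (\int[@lebesgue_measure R]_(x in @unitIo R) (p.[x] * weight a b x) = 0)%R.
Proof.
move=> a1 b1 pE; have [K K0 HK] := poly_unit_bound p.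
pose F : R -> R := horner P * weight (a + 1) (b + 1).
have dF (x : R) : 0 < x < 1 -> is_derive x 1 F (p.[x] * weight a b x).
  move=> x01; apply: (is_derive_eq
    (is_deriveM (is_derive_horner P x) (is_derive_weight a b x01))).
  have -> : p.[x] = ((b + 1) * (1 - x) - (a + 1) * x) * P.[x] +
      x * (1 - x) * P^`().[x].
    by rewrite pE !hornerE.
  by rewrite weightD1// /GRing.scale/=; ring.
have F0 : F 0 = 0 by rewrite /F fctE /weight powR0 ?mulr0// gt_eqF//; lra.
have F1 : F 1 = 0.
  by rewrite /F fctE /weight subrr powR0 ?mul0r ?mulr0// gt_eqF//; lra.
have cw0 : weight (a + 1) (b + 1) t @[t --> 0^'+] --> weight (a + 1) (b + 1) 0.
  apply: cvgM; last by apply: powR_cvg_right0; lra.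
  apply: cvg_at_right_continuous.
  exact: is_derive_continuous (is_derive_powR_onem _ ltr01).
have cw1 : weight (a + 1) (b + 1) t @[t --> 1^'-] --> weight (a + 1) (b + 1) 1.
  apply: cvgM; first by apply: powR_onem_cvg_left1; lra.
  apply: cvg_at_left_continuous.
  exact: is_derive_continuous (is_derive_powR _ ltr01).
have h := @dominated_FTC2_oo R F (fun x : R => p.[x] * weight a b x)
  (K \*: weight_maj_prim a b) (K \*: weight_maj a b) 0 1 ltr01 dF.
suff [h1 h2] : (@lebesgue_measure R).-integrable `]0, 1[
    (EFin \o (fun x : R => p.[x] * weight a b x)) /\
  (\int[@lebesgue_measure R]_(x in `]0, 1[) (p.[x] * weight a b x) = F 1 - F 0)%R.
  by split; [exact: h1|rewrite h2 F0 F1 subrr].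
apply: h.
- move=> x x01; apply: cvgM; first exact: continuous_horner_at.
  exact: continuous_weight_at.
- apply: cvgM => //; apply: cvg_at_right_continuous.
  exact: continuous_horner_at.
- apply: cvgM => //; apply: cvg_at_left_continuous.
  exact: continuous_horner_at.
- by move=> x x01; apply: is_deriveZ; exact: is_derive_weight_maj_prim.
- by move=> x x01; apply: cvgM; [exact: cvg_cst|exact: continuous_weight_maj_at].
- by apply: cvgM; [exact: cvg_cst|exact: weight_maj_prim_right0].
- by apply: cvgM; [exact: cvg_cst|exact: weight_maj_prim_left1].
- move=> x x01; rewrite normrM (ger0_norm (weight_ge0 _ _ _)).
  rewrite ler_pM ?weight_ge0//; last exact: weight_le_maj.
  by apply: HK; move/andP: x01 => [x0 x1]; rewrite !ltW.
Qed.

Lemma integrable_weight_maj (R : realType) (a b : R) : -1 < a -> -1 < b ->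
  (@lebesgue_measure R).-integrable (@unitIo R) (EFin \o weight_maj a b).
Proof.
move=> a1 b1.
have h := @dominated_FTC2_oo R _ _ _ _ 0 1 ltr01
  (fun x => @is_derive_weight_maj_prim R a b x a1 b1)
  (@continuous_weight_maj_at R a b)
  (weight_maj_prim_right0 a1 b1) (weight_maj_prim_left1 a1 b1)
  (fun x => @is_derive_weight_maj_prim R a b x a1 b1)
  (@continuous_weight_maj_at R a b)
  (weight_maj_prim_right0 a1 b1) (weight_maj_prim_left1 a1 b1).
apply: (h _).1 => x x01.
rewrite ger0_norm// (le_trans _ (weight_le_maj a1 b1 x01))//.
exact: weight_ge0.
Qed.

Lemma integrable_poly_weight (R : realType) (a b : R) (p : {poly R}) :
  -1 < a -> -1 < b ->
  (@lebesgue_measure R).-integrable (@unitIo R)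
    (EFin \o (fun x : R => p.[x] * weight a b x)).
Proof.
move=> a1 b1; have [K K0 HK] := poly_unit_bound p.
have ig : (@lebesgue_measure R).-integrable (@unitIo R)
    (fun x => K%:E * (weight_maj a b x)%:E)%E.
  apply: integrableZl; first exact: measurable_itv.
  exact: integrable_weight_maj.
apply: (le_integrable _ _ _ ig); first exact: measurable_itv.
  apply/measurable_EFinP; apply: continuous_measurable_oo => x x01.
  apply: cvgM; first exact: continuous_horner_at.
  exact: continuous_weight_at.
move=> x /= /unitIoP x01; rewrite lee_fin normrM (ger0_norm (weight_ge0 _ _ _)).
apply: le_trans (ler_norm _); rewrite ler_pM ?weight_ge0//.
  by apply: HK; move/andP: x01 => [x0 x1]; rewrite !ltW.
exact: weight_le_maj.
Qed.

(** * The weighted integral as a functional on polynomials *)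

Definition Lw (R : realType) (a b : R) (p : {poly R}) : R :=
  \int[@lebesgue_measure R]_(x in @unitIo R) (p.[x] * weight a b x).

Section Lw.
Variables (R : realType) (a b : R).
Hypotheses (a1 : -1 < a) (b1 : -1 < b).
Local Notation L := (Lw a b).

Lemma LwD p q : L (p + q) = L p + L q.
Proof.
rewrite /Lw -RintegralD; [|exact: measurable_unitIo|exact: integrable_poly_weight..].
by apply: eq_Rintegral => x _; rewrite hornerD mulrDl.
Qed.

Lemma LwZ k p : L (k *: p) = k * L p.
Proof.
rewrite /Lw -RintegralZl; [|exact: measurable_unitIo|exact: integrable_poly_weight].
by apply: eq_Rintegral => x _; rewrite hornerZ -mulrA.
Qed.

Lemma LwB p q : L (p - q) = L p - L q.
Proof. by rewrite -scaleN1r LwD LwZ mulN1r. Qed.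

Lemma Lw0 : L 0 = 0.
Proof. by rewrite -(scale0r 0) LwZ mul0r. Qed.

Lemma Lw_sum (I : Type) (r : seq I) (P : pred I) (F : I -> {poly R}) :
  L (\sum_(i <- r | P i) F i) = \sum_(i <- r | P i) L (F i).
Proof. exact: (big_morph L LwD Lw0). Qed.

Lemma Lw_ge0 p : (forall x, 0 < x < 1 -> 0 <= p.[x]) -> 0 <= L p.
Proof.
move=> p0; apply: Rintegral_ge0 => x /unitIoP x01.
by rewrite mulr_ge0 ?weight_ge0// p0.
Qed.

Lemma Lw_le p q : (forall x, 0 < x < 1 -> p.[x] <= q.[x]) -> L p <= L q.
Proof.
by move=> pq; rewrite -subr_ge0 -LwB; apply: Lw_ge0 => x /pq; rewrite hornerD hornerN subr_ge0.
Qed.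

Lemma Lw_sqr_ge0 p : 0 <= L (p ^+ 2).
Proof. by apply: Lw_ge0 => x _; rewrite horner_exp sqr_ge0. Qed.

Lemma Lw_by_parts (P : {poly R}) :
  L (((b + 1) *: (1 - 'X) - (a + 1) *: 'X) * P + 'X * (1 - 'X) * P^`()) = 0.
Proof. by have [_] := @poly_weight_FTC2 R a b P _ a1 b1 (erefl _). Qed.

Lemma LwS (p : {poly R}) : Lw (a + 1) (b + 1) p = L ('X * (1 - 'X) * p).
Proof.
have h (x : R) : 0 < x < 1 -> p.[x] * weight (a + 1) (b + 1) x =
    ('X * (1 - 'X) * p).[x] * weight a b x.
  by move=> x01; rewrite weightD1// !hornerM hornerD hornerN hornerX hornerC mulrA (mulrC p.[x]).
by apply: eq_Rintegral => x; rewrite inE => /unitIoP; exact: h.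
Qed.

End Lw.

(** * Shifted Jacobi polynomials *)

Section gen_binomial.
Variable R : realType.
Implicit Types (x : R) (k : nat).

Lemma gen_binomialS x k :
  gen_binomial x k.+1 * k.+1%:R = gen_binomial x k * (x - k%:R).
Proof.
rewrite /gen_binomial big_ord_recr/= factS natrM.
have h1 : k`!%:R != 0 :> R by rewrite pnatr_eq0 -lt0n fact_gt0.
have h2 : k.+1%:R != 0 :> R by rewrite pnatr_eq0.
move: h1 h2; move: (k`!%:R : R) (k.+1%:R : R) => u v u0 v0.
by field; rewrite u0 v0.
Qed.

Lemma gen_binomial_gt0 x k n : (k <= n)%N -> -1 < x ->
  0 < gen_binomial (n%:R + x) k.
Proof.
move=> kn x1; rewrite /gen_binomial divr_gt0 ?ltr0n ?fact_gt0//.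
apply: prodr_gt0 => i _.
have : (i.+1%:R <= n%:R :> R) by rewrite ler_nat (leq_trans (ltn_ord i)).
by rewrite -natr1; lra.
Qed.

End gen_binomial.

Section shifted_jacobi.
Variable R : realType.
Implicit Types (a b : R) (n s : nat) (f g p u : {poly R}).

Definition jacobi_coef a b n s : R :=
  gen_binomial (n%:R + a) (n - s) * gen_binomial (n%:R + b) s.

Definition shifted_jacobi a b n : {poly R} :=
  jacobi a b n \Po (2 *: 'X - 1).

Lemma shifted_jacobiE a b n : shifted_jacobi a b n =
  \sum_(s < n.+1) jacobi_coef a b n s *: (('X - 1) ^+ s * 'X ^+ (n - s)).
Proof.
rewrite /shifted_jacobi /jacobi raddf_sum/=; apply: eq_bigr => s _.
rewrite comp_polyZ comp_polyM !rmorphXn/= !comp_polyZ.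
rewrite comp_polyB comp_polyD comp_polyX comp_polyC.
congr (_ *: (_ ^+ _ * _ ^+ _)).
  have -> : 2 *: 'X - 1 - 1%:P = 2 *: ('X - 1) :> {poly R}.
    by rewrite scalerBr polyC1 -addrA -opprD; congr (_ - _); rewrite scaler_nat mulr2n.
  by rewrite scalerA mulVf ?scale1r// pnatr_eq0.
by rewrite polyC1 subrK scalerA mulVf ?scale1r// pnatr_eq0.
Qed.

(** The ratio of consecutive coefficients, cleared of denominators; it makes the sum in
    [jop_shifted_jacobi] telescope. *)
Lemma jacobi_coefS a b n s : (s < n)%N ->
  jacobi_coef a b n s.+1 * (s.+1%:R * (s.+1%:R + a)) =
  jacobi_coef a b n s * ((n - s)%:R * ((n - s)%:R + b)).
Proof.
move=> sn; rewrite /jacobi_coef.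
have -> : (n - s)%N = (n - s.+1).+1 by rewrite -subSn.
have h1 := gen_binomialS (n%:R + a) (n - s.+1).
have h2 := gen_binomialS (n%:R + b) s.
have e : (n - s.+1)%:R = n%:R - s.+1%:R :> R by rewrite natrB.
set A := gen_binomial _ (n - s.+1).+1 in h1 *.
set B := gen_binomial _ s.+1 in h2 *.
set A' := gen_binomial _ (n - s.+1) in h1 *.
set B' := gen_binomial _ s in h2 *.
transitivity (A' * (B * s.+1%:R) * (s.+1%:R + a)); first by ring.
transitivity ((A * (n - s.+1).+1%:R) * B' * ((n - s.+1).+1%:R + b)); last by ring.
by rewrite h1 h2 -[(n - s.+1).+1%:R]natr1 e -natr1; ring.
Qed.

(** The Jacobi operator on [0, 1], the expanded form of p -> (x (1 - x) w p')' / w with w =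
    [weight a b]. *)
Definition jop a b p : {poly R} :=
  'X * (1 - 'X) * p^`()^`() + ((b + 1) *: (1 - 'X) - (a + 1) *: 'X) * p^`().

Lemma jopD a b f g : jop a b (f + g) = jop a b f + jop a b g.
Proof. by rewrite /jop !derivD; ring. Qed.

Lemma jopZ a b k f : jop a b (k *: f) = k *: jop a b f.
Proof. by rewrite /jop !derivZ -!mul_polyC; ring. Qed.

Lemma jop0 a b : jop a b 0 = 0.
Proof. by rewrite -[X in jop a b X](scale0r 0) jopZ scale0r. Qed.

(** Multiplication by [Z] turns the truncated exponent [s.-1] back into [s], so that [s = 0] needs
    no separate treatment in [jop_monomial]. *)
Lemma deriv_monic_exp (Z : {poly R}) s : Z^`() = 1 ->
  (Z ^+ s)^`() = s%:R *: Z ^+ s.-1 /\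
  Z * (Z ^+ s)^`() = s%:R *: Z ^+ s /\
  Z * (Z ^+ s)^`()^`() = (s%:R - 1) *: (Z ^+ s)^`().
Proof.
move=> Z1.
have e t : (Z ^+ t)^`() = t%:R *: Z ^+ t.-1.
  by rewrite deriv_exp Z1 mul1r scaler_nat.
have f t : Z * (Z ^+ t)^`() = t%:R *: Z ^+ t.
  by rewrite e -scalerAr; case: t => [|t]; rewrite ?scale0r// -exprS.
split; [exact: e|split; [exact: f|]].
rewrite e derivZ -scalerAr f !scalerA; case: s => [|s]; first by rewrite mul0r mulr0.
by rewrite /= -natr1 addrK mulrC.
Qed.

Lemma jop_monomial a b s k :
  jop a b (('X - 1) ^+ s * 'X ^+ k) =
  - ((s%:R * (s%:R + a)) *: (('X - 1) ^+ s.-1 * 'X ^+ k.+1) +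
     (k%:R * (k%:R + b)) *: (('X - 1) ^+ s.+1 * 'X ^+ k.-1) +
     (2 * s%:R * k%:R + (b + 1) * s%:R + (a + 1) * k%:R) *:
       (('X - 1) ^+ s * 'X ^+ k)).
Proof.
have dZ : ('X - 1 : {poly R})^`() = 1 by rewrite derivB derivX derivC subr0.
have [a1 [a2 a3]] := deriv_monic_exp s dZ.
have [b1 [b2 b3]] := deriv_monic_exp k (derivX R).
have -> : (s%:R * (s%:R + a)) *: (('X - 1) ^+ s.-1 * 'X ^+ k.+1) =
    (s%:R + a) *: ((('X - 1) ^+ s)^`() * ('X * 'X ^+ k)).
  by rewrite a1 -scalerAl scalerA mulrC -exprS.
have -> : (k%:R * (k%:R + b)) *: (('X - 1) ^+ s.+1 * 'X ^+ k.-1) =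
    (k%:R + b) *: (('X - 1) * ('X - 1) ^+ s * ('X ^+ k)^`()).
  by rewrite b1 -scalerAr scalerA mulrC -exprS.
move: a2 a3 b2 b3 {a1 b1 dZ}.
rewrite /jop; set A0 := ('X - 1) ^+ s; set B0 := 'X^k.
rewrite !derivM !derivD !derivM; move: (A0^`()) (B0^`()) => A1 B1.
move: (A1^`()) (B1^`()) => A2 B2; move: A0 B0 => A0 B0 a2 a3 b2 b3.
transitivity (- ('X * B0 * (('X - 1) * A2) + 2 * (('X - 1) * A1) * ('X * B1)
  + ('X - 1) * A0 * ('X * B2)) - (b + 1) *: ((('X - 1) * A1) * B0 + ('X - 1) * A0 * B1)
  - (a + 1) *: ('X * A1 * B0 + A0 * ('X * B1))).
  by rewrite -!mul_polyC; ring.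
rewrite a2 a3 b2 b3 -!mul_polyC !(polyCD, polyCM, polyCN, polyC1); ring.
Qed.

Lemma jop_shifted_jacobi a b n :
  jop a b (shifted_jacobi a b n) =
  - (n%:R * (n%:R + a + b + 1)) *: shifted_jacobi a b n.
Proof.
rewrite shifted_jacobiE (big_morph _ (jopD a b) (jop0 a b)) scaler_sumr.
apply/eqP; rewrite -subr_eq0 -sumrB; apply/eqP.
(* Each summand is [V s.+1 - V s]: by [jacobi_coefS] the part with a lowered power of ['X] is
   [V s.+1], and the part with a lowered power of ['X - 1] is [V s]. The guard makes [V n.+1]
   vanish, which the truncated exponent [n - s] would not do. *)
pose V s : {poly R} :=
  (if (s <= n)%N then jacobi_coef a b n s * (s%:R * (s%:R + a)) else 0) *:
  (('X - 1) ^+ s.-1 * 'X ^+ (n - s)).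
transitivity (\sum_(0 <= s < n.+1) (V s.+1 - V s)); last first.
  by rewrite telescope_sumr// /V ltnn mul0r mulr0 !scale0r subr0.
rewrite big_mkord; apply: eq_bigr => -[s /= sn] _.
rewrite ltnS in sn.
have -> : V s.+1 = (jacobi_coef a b n s * ((n - s)%:R * ((n - s)%:R + b))) *:
    (('X - 1) ^+ s * 'X ^+ (n - s).-1).
  rewrite /V; move: sn; rewrite leq_eqVlt => /predU1P[->|sn].
    by rewrite ltnn subnn mul0r mulr0 !scale0r.
  by rewrite sn jacobi_coefS// subnS.
rewrite /V sn jopZ jop_monomial.
set A := jacobi_coef a b n s.
have nE : n%:R = s%:R + (n - s)%:R :> R by rewrite -natrD subnKC.
rewrite nE; move: (n - s)%N => k; move: A => A {V sn nE}.
(* Writing one ['X] as [('X - 1) + 1] splits off the monomial of [V s]; for [s = 0] the factor [s]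
   makes both sides zero. *)
have h1 : (s%:R * (s%:R + a)) *: (('X - 1) ^+ s.-1 * 'X^(k.+1)) =
    (s%:R * (s%:R + a)) *: (('X - 1) ^+ s.-1 * 'X^k) +
    (s%:R * (s%:R + a)) *: (('X - 1) ^+ s * 'X^k) :> {poly R}.
  case: s => [|s]; first by rewrite mul0r !scale0r addr0.
  by rewrite -scalerDr /= !exprS; congr (_ *: _); ring.
have h2 : (k%:R * (k%:R + b)) *: (('X - 1) ^+ s.+1 * 'X^(k.-1)) =
    (k%:R * (k%:R + b)) *: (('X - 1) ^+ s * 'X^k) -
    (k%:R * (k%:R + b)) *: (('X - 1) ^+ s * 'X^(k.-1)) :> {poly R}.
  case: k {h1} => [|k]; first by rewrite mul0r !scale0r subr0.
  by rewrite -scalerBr /= !exprS; congr (_ *: _); ring.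
rewrite h1 h2 -!mul_polyC !(polyCD, polyCM, polyCN, polyC1); ring.
Qed.

(** All the products are monic of degree n and all the coefficients are positive, so the leading
    terms cannot cancel. *)
Lemma size_shifted_jacobi a b n : -1 < a -> -1 < b ->
  size (shifted_jacobi a b n) = n.+1.
Proof.
move=> a1 b1; rewrite shifted_jacobiE.
have mon s : (s <= n)%N -> (('X - 1) ^+ s * 'X ^+ (n - s) : {poly R}) \is monic /\
    size (('X - 1) ^+ s * 'X ^+ (n - s) : {poly R}) = n.+1.
  move=> sn; have h1 : (('X - 1) ^+ s : {poly R}) \is monic.
    by rewrite monic_exp// -polyC1 monicXsubC.
  split; first by rewrite monicMl// monicXn.
  rewrite size_monicM ?monic_neq0 ?monicXn// size_polyXn.
  by rewrite -polyC1 size_exp_XsubC addnS /= addSn subnKC.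
apply/anti_leq/andP; split.
  apply: (leq_trans (size_sum _ _ _)); apply/bigmax_leqP => -[s /= sn] _.
  by rewrite (leq_trans (size_scale_leq _ _))// (mon s _).2.
rewrite ltnNge; apply/negP => /leq_sizeP /(_ n (leqnn n))/eqP; apply/negP.
rewrite coef_sum gt_eqF//.
have pos s : (s <= n)%N ->
    0 < (jacobi_coef a b n s *: (('X - 1) ^+ s * 'X ^+ (n - s)))`_n.
  move=> sn; have [/monicP + sz] := mon _ sn.
  rewrite /lead_coef sz/= coefZ => ->; rewrite mulr1.
  by rewrite mulr_gt0// gen_binomial_gt0// leq_subr.
rewrite big_ord_recl ltr_wpDr//; last exact: pos.
by apply: sumr_ge0 => -[s /= sn] _; rewrite ltW// pos.
Qed.

Lemma shifted_jacobi_basis a b n u : -1 < a -> -1 < b -> (size u <= n)%N ->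
  exists c : nat -> R, u = \sum_(k < n) c k *: shifted_jacobi a b k.
Proof.
move=> a1 b1; elim: n u => [|n IH] u.
  by rewrite leqn0 size_poly_eq0 => /eqP->; exists (fun=> 0); rewrite big_ord0.
move=> un; set y := shifted_jacobi a b n.
have ysz : size y = n.+1 by exact: size_shifted_jacobi.
have y0 : lead_coef y != 0 by rewrite lead_coef_eq0 -size_poly_eq0 ysz.
pose d := u`_n / lead_coef y.
have [|c cE] := IH (u - d *: y).
  apply/leq_sizeP => i; rewrite leq_eqVlt => /predU1P[<-|ni].
    by rewrite coefB coefZ /d /lead_coef ysz/= divfK ?subrr// -[n]/(n.+1.-1) -ysz.
  rewrite coefB coefZ !nth_default ?ysz ?mulr0 ?subr0//.
  exact: leq_trans un _.
exists (fun k => if k == n then d else c k).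
rewrite big_ord_recr/= eqxx -[LHS](subrK (d *: y)) cE; congr (_ + _).
by apply: eq_bigr => -[k /= kn] _; rewrite ltn_eqF.
Qed.

(** * Eigenvalue relations, orthogonality and Parseval's identity *)

Definition jeig a b mu f := jop a b f = - mu *: f.

(** Differentiating the eigenvalue equation gives the equation with both parameters raised by one.
    Derivatives of Jacobi polynomials are thus eigenfunctions without being identified as Jacobi
    polynomials. *)
Lemma jeig_deriv a b mu f :
  jeig a b mu f -> jeig (a + 1) (b + 1) (mu - (a + b + 2)) f^`().
Proof.
move=> h; have := congr1 (@deriv R) h.
rewrite /jeig /jop !derivZ !derivD !derivM !derivB !derivZ !derivB !derivX derivC.
move=> e; transitivity ((a + b + 2) *: f^`() - mu *: f^`()).
  rewrite -[- (mu *: _)]scaleNr -e -!mul_polyC !(polyCD, polyCM, polyCN, polyC1); ring.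
by rewrite -scalerBl; congr (_ *: _); ring.
Qed.

(** [jop] is in divergence form, so integration by parts moves one derivative onto [g] without
    boundary terms; the raised weight absorbs the factor x (1 - x). *)
Lemma jeig_energy a b mu f g : -1 < a -> -1 < b -> jeig a b mu f ->
  Lw (a + 1) (b + 1) (f^`() * g^`()) = mu * Lw a b (f * g).
Proof.
move=> a1 b1 h; rewrite LwS//.
have := Lw_by_parts a1 b1 (f^`() * g); rewrite derivM.
have -> : ((b + 1) *: (1 - 'X) - (a + 1) *: 'X) * (f^`() * g) +
  'X * (1 - 'X) * (f^`()^`() * g + f^`() * g^`()) =
  jop a b f * g + 'X * (1 - 'X) * (f^`() * g^`()) by rewrite /jop; ring.
rewrite LwD// h -scalerAl LwZ// mulNr => /eqP.
by rewrite addrC subr_eq0 => /eqP.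
Qed.

Lemma jeig_orth a b mu nu f g : -1 < a -> -1 < b ->
  jeig a b mu f -> jeig a b nu g -> mu != nu -> Lw a b (f * g) = 0.
Proof.
move=> a1 b1 hf hg mn; have h1 := jeig_energy g a1 b1 hf.
have := jeig_energy f a1 b1 hg; rewrite (mulrC g^`()) h1 (mulrC g) => /eqP.
by rewrite -subr_eq0 -mulrBl mulf_eq0 subr_eq0 (negbTE mn) => /eqP.
Qed.

(** The eigenvalue of the i-th derivative of the polynomial of degree n, for parameters raised by i.
    It vanishes at i = n, where that derivative is constant. *)
Definition jeval a b i n : R := (n%:R - i%:R) * (n%:R + i%:R + a + b + 1).

Lemma jeig_shifted_jacobi a b n i :
  jeig (a + i%:R) (b + i%:R) (jeval a b i n) (shifted_jacobi a b n)^`(i).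
Proof.
elim: i => [|i IH].
  by rewrite !addr0 derivn0 /jeval subr0 addr0; exact: jop_shifted_jacobi.
have e c : c + i.+1%:R = c + i%:R + 1 :> R by rewrite -natr1 addrA.
rewrite !e derivnS; have -> : jeval a b i.+1 n = jeval a b i n - (a + i%:R + (b + i%:R) + 2).
  by rewrite /jeval -natr1; ring.
exact: jeig_deriv.
Qed.

Lemma Lw_derivn_shifted_jacobi a b n k m : -1 < a -> -1 < b ->
  Lw (a + m%:R) (b + m%:R)
    ((shifted_jacobi a b n)^`(m) * (shifted_jacobi a b k)^`(m)) =
  (\prod_(i < m) jeval a b i n) * Lw a b (shifted_jacobi a b n * shifted_jacobi a b k).
Proof.
move=> a1 b1; elim: m => [|m IH]; first by rewrite big_ord0 !addr0 mul1r.
have m0 : 0 <= m%:R :> R by [].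
have := jeig_energy (shifted_jacobi a b k)^`(m) _ _ (jeig_shifted_jacobi a b n m).
have e c : c + m.+1%:R = c + m%:R + 1 :> R by rewrite -natr1 addrA.
rewrite !e !derivnS IH big_ord_recr/= => ->; [by ring|lra|lra].
Qed.

(** The eigenvalues of degrees k < n differ by (n - k) (n + k + a + b + 1), which is positive
    because n >= k + 1 and a + b > -2. *)
Lemma shifted_jacobi_orth a b n k : -1 < a -> -1 < b -> n != k ->
  Lw a b (shifted_jacobi a b n * shifted_jacobi a b k) = 0.
Proof.
move=> a1 b1 nk; apply: (jeig_orth a1 b1 (jop_shifted_jacobi a b n)
  (jop_shifted_jacobi a b k)).
wlog kn : n k nk / (k < n)%N.
  move=> h; case: (ltngtP n k) nk => // kn _; last by rewrite h// gt_eqF.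
  by rewrite eq_sym h// gt_eqF.
rewrite -subr_eq0.
have -> : n%:R * (n%:R + a + b + 1) - k%:R * (k%:R + a + b + 1) =
  (n%:R - k%:R) * (n%:R + k%:R + a + b + 1) :> R by ring.
have h1 : (k.+1%:R <= n%:R :> R) by rewrite ler_nat.
have h2 : 0 <= k%:R :> R by [].
rewrite -natr1 in h1.
by rewrite mulf_neq0// gt_eqF//; lra.
Qed.

(** Parseval's identity for derivatives: the m-th derivatives of the basis stay orthogonal for the
    raised weight, so differentiation acts as a multiplier, the product of the eigenvalues. *)
Lemma Lw_derivn_sqr a b (r : seq nat) (c : nat -> R) m :
  -1 < a -> -1 < b -> uniq r ->
  Lw (a + m%:R) (b + m%:R)
    ((\sum_(n <- r) c n *: shifted_jacobi a b n)^`(m) ^+ 2) =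
  \sum_(n <- r) c n ^+ 2 * (\prod_(i < m) jeval a b i n) *
    Lw a b (shifted_jacobi a b n ^+ 2).
Proof.
move=> a1 b1 ur; have m0 : 0 <= m%:R :> R by [].
rewrite expr2 raddf_sum/= mulr_suml Lw_sum; [|lra|lra].
rewrite big_seq [RHS]big_seq; apply: eq_bigr => n nr.
rewrite mulr_sumr Lw_sum; [|lra|lra].
rewrite (bigD1_seq n)//= big1 => [|k kn]; last first.
  rewrite !derivnZ -scalerAl -scalerAr !LwZ; [|lra..].
  by rewrite Lw_derivn_shifted_jacobi// shifted_jacobi_orth 1?eq_sym// !mulr0.
rewrite !derivnZ -scalerAl -scalerAr !LwZ; [|lra..].
by rewrite Lw_derivn_shifted_jacobi// addr0 expr2; ring.
Qed.

End shifted_jacobi.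

(** * Lagrange interpolation and Gauss quadrature *)

Section lagrange.
Variables (R : realType) (N : nat) (z : 'I_N.+1 -> R).
Hypothesis z_inj : injective z.

Definition nodal : {poly R} := \prod_i ('X - (z i)%:P).

Definition lag (j : 'I_N.+1) : {poly R} :=
  \prod_(i | i != j) ((z j - z i)^-1 *: ('X - (z i)%:P)).

Definition lagi (f : 'I_N.+1 -> R) : {poly R} := \sum_j f j *: lag j.

Lemma lag_node j k : (lag j).[z k] = (j == k)%:R.
Proof.
rewrite /lag horner_prod; have [<-|jk] := eqVneq j k.
  rewrite big1// => i ij; rewrite hornerZ hornerXsubC mulVf// subr_eq0.
  by rewrite (inj_eq z_inj) eq_sym.
by rewrite (bigD1 k) 1?eq_sym//= hornerZ hornerXsubC subrr mulr0 mul0r.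
Qed.

Lemma size_lag j : (size (lag j) <= N.+1)%N.
Proof.
rewrite /lag scaler_prod (leq_trans (size_scale_leq _ _))//.
rewrite -big_filter size_prod_XsubC size_filter -sum1_count.
by rewrite (eq_bigl (mem (predC1 j)))// sum1_card cardC1 card_ord.
Qed.

Lemma size_lagi f : (size (lagi f) <= N.+1)%N.
Proof.
apply: (leq_trans (size_sum _ _ _)); apply/bigmax_leqP => i _.
exact: leq_trans (size_scale_leq _ _) (size_lag _).
Qed.

Lemma lagi_node f k : (lagi f).[z k] = f k.
Proof.
rewrite horner_sum (bigD1 k)//= hornerZ lag_node eqxx mulr1 big1 ?addr0// => i ik.
by rewrite hornerZ lag_node (negbTE ik) mulr0.
Qed.

Lemma lagi_id (p : {poly R}) : (size p <= N.+1)%N -> lagi (fun j => p.[z j]) = p.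
Proof.
move=> sp; apply/eqP; rewrite -subr_eq0; apply/eqP.
apply: (@roots_geq_poly_eq0 _ _ [seq z i | i <- enum 'I_N.+1]).
- apply/allP => x /mapP[i _ ->].
  by rewrite rootE hornerD hornerN lagi_node subrr.
- by rewrite map_inj_uniq// enum_uniq.
- rewrite size_map -cardE card_ord (leq_trans (size_polyD _ _))//.
  by rewrite geq_max size_lagi size_polyN.
Qed.

Lemma size_nodal : size nodal = N.+2.
Proof. by rewrite /nodal size_prod_XsubC -sum1_size sum_nat_const card_ord muln1. Qed.

Lemma nodal_monic : nodal \is monic.
Proof. exact: monic_prod_XsubC. Qed.

Lemma nodal_node k : nodal.[z k] = 0.
Proof. by rewrite horner_prod (bigD1 k)//= hornerXsubC subrr mul0r. Qed.

Variables (a b : R).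
Hypotheses (a1 : -1 < a) (b1 : -1 < b).
Hypothesis nodal_orth : forall q : {poly R}, (size q <= N.+1)%N ->
  Lw a b (nodal * q) = 0.

(** Divide by the nodal polynomial: the quotient has degree at most N and is killed by
    orthogonality, the remainder is its own interpolant and agrees with [p] at the nodes. *)
Lemma gauss_exact (p : {poly R}) : (size p <= N.+1 + N.+1)%N ->
  Lw a b p = \sum_j p.[z j] * Lw a b (lag j).
Proof.
move=> sp; have n0 : nodal != 0 by exact/monic_neq0/nodal_monic.
rewrite {1}(divp_eq p nodal) LwD// mulrC nodal_orth ?add0r; last first.
  by rewrite size_divp// size_nodal /= leq_subLR.
have sm : (size (p %% nodal)%R <= N.+1)%N.
  by rewrite -ltnS -size_nodal ltn_modp.
rewrite -(lagi_id sm) Lw_sum//; apply: eq_bigr => j _; rewrite LwZ//; congr (_ * _).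
by rewrite [in RHS](divp_eq p nodal) hornerD hornerM nodal_node mulr0 add0r.
Qed.

(** The square of [lag j] has degree at most 2 N, so the quadrature is exact for it and reduces to
    the single weight of index j. *)
Lemma gauss_weight_ge0 j : 0 <= Lw a b (lag j).
Proof.
have -> : Lw a b (lag j) = Lw a b (lag j ^+ 2); last exact: Lw_sqr_ge0.
rewrite (@gauss_exact (lag j ^+ 2)); last first.
  rewrite (leq_trans (size_polyMleq _ _))//.
  by rewrite (leq_trans (leq_pred _))// leq_add// size_lag.
rewrite (bigD1 j)//= horner_exp lag_node eqxx expr1n mul1r big1 ?addr0// => i ij.
by rewrite horner_exp lag_node eq_sym (negbTE ij) expr0n mul0r.
Qed.

Lemma Lw_lagi_sqr f : Lw a b (lagi f ^+ 2) = \sum_j f j ^+ 2 * Lw a b (lag j).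
Proof.
rewrite gauss_exact; last first.
  rewrite (leq_trans (size_polyMleq _ _))//.
  by rewrite (leq_trans (leq_pred _))// leq_add// size_lagi.
by apply: eq_bigr => j _; rewrite horner_exp lagi_node.
Qed.

End lagrange.

Section zeros.
Variables (R : realType) (a b lambda : R) (N : nat) (x : 'I_N.+1 -> R).
Hypotheses (a1 : -1 < a) (b1 : -1 < b) (l0 : 0 < lambda).
Hypothesis xz : are_zeros a b lambda x.
Let z i : R := x i `^ lambda.

Lemma zeros_unitI i : 0 <= x i <= 1.
Proof.
have [_ h] := xz; have : range x (x i) by exists i.
by rewrite h => -[]; rewrite /unitI/= in_itv.
Qed.

Lemma zeros_inj : injective z.
Proof.
have [mono _] := xz.
move=> i j /(powR_injective l0).
rewrite !nnegrE; move/(_ (andP (zeros_unitI i)).1 (andP (zeros_unitI j)).1) => xij.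
case: (ltngtP i j) => [/mono|/mono|/ord_inj//]; by rewrite xij ltxx.
Qed.

(** In the variable y = x^lambda the nodes are N + 1 distinct roots of a polynomial of degree N + 1,
    so [nodal z] is the Jacobi polynomial up to its leading coefficient. *)
Lemma zeros_nodal_orth (q : {poly R}) : (size q <= N.+1)%N ->
  Lw a b (nodal z * q) = 0.
Proof.
move=> sq; set y := shifted_jacobi a b N.+1.
have ysz : size y = N.+2 by exact: size_shifted_jacobi.
have y0 : y != 0 by rewrite -size_poly_eq0 ysz.
have root_y : all (root y) [seq z i | i <- enum 'I_N.+1].
  apply/allP => _ /mapP[i _ ->]; have [_ h] := xz.
  have : range x (x i) by exists i.
  rewrite h => -[_]; rewrite /muntz_jacobi rootE /y /shifted_jacobi horner_comp.
  by rewrite !hornerE -/(z i) => ->.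
have uz : uniq_roots [seq z i | i <- enum 'I_N.+1].
  by rewrite uniq_rootsE map_inj_uniq ?enum_uniq//; exact: zeros_inj.
have yE : y = lead_coef y *: nodal z.
  rewrite [LHS](all_roots_prod_XsubC _ root_y uz); last first.
    by rewrite ysz size_map -cardE card_ord.
  by rewrite big_map big_enum.
have c0 : lead_coef y != 0 by rewrite lead_coef_eq0.
have -> : nodal z = (lead_coef y)^-1 *: y.
  by rewrite [X in _ *: X]yE scalerA mulVf// scale1r.
have [c ->] := shifted_jacobi_basis a1 b1 sq.
rewrite -scalerAl LwZ// mulr_sumr Lw_sum// big1 ?mulr0// => k _.
rewrite -scalerAr LwZ// shifted_jacobi_orth ?mulr0//.
by rewrite neq_ltn ltn_ord orbT.
Qed.

End zeros.

(** * Fejer kernels *)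

Section chebyshev.
Variable R : realType.
Implicit Types (n k : nat) (s t : R).

(* The Chebyshev polynomials in the variable x = (1 - cos t) / 2 of [0, 1]. *)
Fixpoint cheb k : {poly R} :=
  match k with
  | 0%N => 1
  | k'.+1 => match k' with
             | 0%N => 1 - 2 *: 'X
             | k''.+1 => 2 *: ((1 - 2 *: 'X) * cheb k') - cheb k''
             end
  end.

Lemma chebSS k : cheb k.+2 = 2 *: ((1 - 2 *: 'X) * cheb k.+1) - cheb k.
Proof. by []. Qed.

Lemma nat_ind2 (P : nat -> Prop) :
  P 0%N -> P 1%N -> (forall k, P k -> P k.+1 -> P k.+2) -> forall k, P k.
Proof.
move=> P0 P1 H k; suff: P k /\ P k.+1 by case.
by elim: k => [//|k [h1 h2]]; split => //; exact: H.
Qed.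

Lemma size_cheb k : (size (cheb k) <= k.+1)%N.
Proof.
have s1 : (size (1 - 2 *: 'X : {poly R})%R <= 2)%N.
  rewrite (leq_trans (size_polyD _ _))// geq_max size_poly1 size_polyN.
  by rewrite (leq_trans (size_scale_leq _ _))// size_polyX.
elim/nat_ind2: k => [||k IH0 IH1]; rewrite ?size_poly1//.
rewrite chebSS (leq_trans (size_polyD _ _))// geq_max size_polyN.
rewrite (leq_trans IH0 (leqW (leqnSn _))) andbT.
rewrite (leq_trans (size_scale_leq _ _))// (leq_trans (size_polyMleq _ _))//.
by rewrite -subn1 leq_subLR (leq_trans (leq_add s1 IH1)).
Qed.

Lemma cheb_cos k t : (cheb k).[(1 - cos t) / 2] = cos (k%:R * t).
Proof.
have e : (1 - 2 *: 'X : {poly R}).[(1 - cos t) / 2] = cos t.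
  rewrite hornerD hornerN hornerZ hornerX hornerC mulrC divfK ?pnatr_eq0//; ring.
elim/nat_ind2: k => [||k IH0 IH1].
- by rewrite hornerC mul0r cos0.
- by rewrite /= e mul1r.
rewrite chebSS hornerD hornerN hornerZ hornerM e IH0 IH1.
have -> : k.+2%:R * t = k.+1%:R * t + t by rewrite -(natr1 k.+1); ring.
have -> : k%:R * t = k.+1%:R * t - t by rewrite -(natr1 k); ring.
by rewrite !cosD cosN sinN; ring.
Qed.

(* The Fejer kernel sin^2(n s / 2) / sin^2(s / 2), including its value at s = 0. *)
Definition fejer n s : R :=
  \sum_(k < n) 2 * (n%:R - k%:R) * cos (k%:R * s) - n%:R.

Lemma cos_double t : cos t = 1 - 2 * sin (t / 2) ^+ 2.
Proof.
have -> : cos t = cos ((t / 2) *+ 2) by congr cos; rewrite mulr2n; field.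
by rewrite cos_mulr2n cos2sin2 mulr2n; ring.
Qed.

Lemma cosMS k t : 2 * cos t * cos (k.+1%:R * t) =
  cos (k%:R * t) + cos (k.+2%:R * t).
Proof.
have -> : k.+2%:R * t = k.+1%:R * t + t by rewrite -(natr1 k.+1); ring.
have -> : k%:R * t = k.+1%:R * t - t by rewrite -(natr1 k); ring.
by rewrite !cosD cosN sinN; ring.
Qed.

(** The closed form of the Dirichlet kernel. [fejerS] writes the Fejer kernel as a sum of such
    kernels, and the right-hand sides telescope in [fejerE]. *)
Lemma dirichlet_cos n s :
  (1 - cos s) * (\sum_(k < n.+1) 2 * cos (k%:R * s) - 1) =
  cos (n%:R * s) - cos (n.+1%:R * s).
Proof.
elim: n => [|n IH]; first by rewrite big_ord1 mul0r mul1r cos0; ring.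
rewrite big_ord_recr/= addrAC mulrDr IH mulrBl mul1r.
have := cosMS n s; set A := cos (n%:R * s); set B := cos (n.+1%:R * s).
set C := cos (n.+2%:R * s) => h.
have -> : cos s * (2 * B) = A + C by rewrite -h; ring.
by ring.
Qed.

Lemma fejerS n s :
  fejer n.+1 s = fejer n s + (\sum_(k < n.+1) 2 * cos (k%:R * s) - 1).
Proof.
rewrite /fejer big_ord_recr/= [in RHS]big_ord_recr/= -(natr1 n).
have -> : \sum_(k < n) 2 * (n%:R + 1 - k%:R) * cos (k%:R * s) =
  \sum_(k < n) 2 * (n%:R - k%:R) * cos (k%:R * s) +
  \sum_(k < n) 2 * cos (k%:R * s).
  by rewrite -big_split; apply: eq_bigr => k _ /=; ring.
by ring.
Qed.

Lemma fejerE n s : fejer n s * sin (s / 2) ^+ 2 = sin (n%:R * s / 2) ^+ 2.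
Proof.
suff : (1 - cos s) * fejer n s = 1 - cos (n%:R * s).
  rewrite (cos_double s) (cos_double (n%:R * s)) => h.
  by have h2 : (2 : R) != 0 by []; apply: (mulfI h2); move: h; lra.
elim: n => [|n IH]; first by rewrite /fejer big_ord0 mul0r cos0; ring.
by rewrite fejerS mulrDr IH dirichlet_cos; ring.
Qed.

Lemma fejer_coef_sum n : \sum_(k < n) 2 * (n%:R - k%:R) = n%:R ^+ 2 + n%:R :> R.
Proof.
elim: n => [|n IH]; first by rewrite big_ord0 expr0n addr0.
rewrite big_ord_recr/= -(natr1 n).
have -> : \sum_(k < n) 2 * (n%:R + 1 - k%:R) =
   \sum_(k < n) 2 * (n%:R - k%:R) + \sum_(k < n) 2 :> R.
  by rewrite -big_split; apply: eq_bigr => k _ /=; ring.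
by rewrite IH sumr_const card_ord -[2 *+ n]mulr_natr; ring.
Qed.

Lemma fejer_le n s : fejer n s <= n%:R ^+ 2.
Proof.
rewrite /fejer lerBlDr -fejer_coef_sum; apply: ler_sum => k _.
rewrite ler_piMr ?cos_le1//.
by rewrite mulr_ge0// subr_ge0 ler_nat ltnW.
Qed.

Lemma fejer_ge0 n s : 0 <= fejer n s.
Proof.
have [s0|s0] := eqVneq (sin (s / 2)) 0; last first.
  have p : 0 < sin (s / 2) ^+ 2 by rewrite exprn_even_gt0.
  by rewrite -(pmulr_lge0 _ p) fejerE sqr_ge0.
have c1 : cos s = 1 by rewrite cos_double s0; ring.
(* When [cos s = 1], [cos (k s)] is the k-th Chebyshev polynomial at 0, and its value follows from
   the recurrence. *)
have ck k : cos (k%:R * s) = 1.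
  rewrite -cheb_cos c1 subrr mul0r.
  have e : (1 - 2 *: 'X : {poly R}).[0] = 1.
    by rewrite hornerD hornerN hornerZ hornerX hornerC mulr0 subr0.
  elim/nat_ind2: k => [||k IH0 IH1]; [by rewrite hornerC|exact: e|].
  by rewrite chebSS hornerD hornerN hornerZ hornerM e IH0 IH1; ring.
elim: n => [|n IH]; first by rewrite /fejer big_ord0 subr0.
rewrite fejerS addr_ge0// big_ord_recl ck /=.
have : 0 <= \sum_(i < n) 2 * cos ((lift ord0 i)%:R * s) :> R.
  by apply: sumr_ge0 => i _; rewrite ck mulr1.
by lra.
Qed.

Lemma sin_le_id t : 0 <= t -> sin t <= t.
Proof.
move=> t0.
have ds (x : R) : x \in `]0, t[%R -> is_derive x 1 (@sin R) (cos x).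
  by move=> _; exact: is_derive_sin.
have cs : {within `[0, t], continuous (@sin R)}.
  by apply: continuous_subspaceT => x; exact: continuous_sin.
have [c _] := MVT_segment t0 ds cs.
by rewrite sin0 !subr0 => ->; rewrite ler_piMl// cos_le1.
Qed.

Lemma ler_sqr_norm (x y : R) : `|x| <= `|y| -> x ^+ 2 <= y ^+ 2.
Proof.
by move=> xy; rewrite -(real_normK (num_real x)) -(real_normK (num_real y)) ler_sqr.
Qed.

Lemma sin_sqr_le t : sin t ^+ 2 <= t ^+ 2.
Proof.
wlog t0 : t / 0 <= t.
  move=> h; have [/h//|t0] := leP 0 t.
  by have := h (- t); rewrite sinN !sqrrN; apply; rewrite oppr_ge0 ltW.
apply: ler_sqr_norm; have [s0|s0] := leP 0 (sin t).
  by rewrite !ger0_norm// sin_le_id.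
have [t1|t1] := leP 1 t.
  by rewrite (ger0_norm t0) (le_trans (sin_max _)).
have := @sin_gt0_pi R t; have := @pi_ge2 R => p2.
have [->|tn] := eqVneq t 0; first by rewrite sin0 normr0.
have -> : 0 < t < pi by rewrite lt_neqAle eq_sym tn t0/=; lra.
by move=> /(_ isT)/(lt_trans s0); rewrite ltxx.
Qed.

Lemma cos_ge t : 1 - t ^+ 2 / 2 <= cos t.
Proof. by rewrite cos_double; have := sin_sqr_le (t / 2); rewrite expr_div_n; lra. Qed.

(** All the angles k s are at most 1/2 in absolute value, so their cosines exceed 3/4 and the kernel
    is at least (3/4) (n^2 + n) - n, which is at least n^2 / 2 for n >= 1. *)
Lemma fejer_lower n s : (1 <= n)%N -> `|s| * n%:R <= 2^-1 ->
  n%:R ^+ 2 / 2 <= fejer n s.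
Proof.
move=> n1 sn.
have cge (k : 'I_n) : 3 / 4 <= cos (k%:R * s).
  have h : `|k%:R * s| <= 2^-1.
    rewrite normrM normr_nat mulrC (le_trans _ sn)// ler_wpM2l// ler_nat ltnW//.
  have h2 : (k%:R * s) ^+ 2 <= 2^-1 ^+ 2 by apply: ler_sqr_norm; rewrite [leRHS]ger0_norm.
  by apply: le_trans (cos_ge _); lra.
have h : \sum_(k < n) 2 * (n%:R - k%:R) * (3 / 4) <=
    \sum_(k < n) 2 * (n%:R - k%:R) * cos (k%:R * s).
  apply: ler_sum => k _; rewrite ler_wpM2l//.
  by rewrite mulr_ge0// subr_ge0 ler_nat ltnW.
rewrite -mulr_suml fejer_coef_sum in h.
have n1' : 1 <= n%:R :> R by rewrite ler1n.
have nn : n%:R <= n%:R ^+ 2 :> R by rewrite expr2 ler_peMr.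
by rewrite /fejer; lra.
Qed.

(* The symmetrized kernel is a polynomial in x = (1 - cos t) / 2. *)
Definition fejer_poly n (p : R) : {poly R} :=
  \sum_(k < n) (4 * (n%:R - k%:R) * cos (k%:R * p)) *: cheb k - (2 * n%:R)%:P.

Lemma fejer_polyE n p t :
  (fejer_poly n p).[(1 - cos t) / 2] = fejer n (t - p) + fejer n (t + p).
Proof.
rewrite /fejer_poly /fejer hornerD hornerN hornerC horner_sum.
rewrite addrACA -opprD -big_split/=; congr (_ - _); last by ring.
apply: eq_bigr => k _; rewrite hornerZ cheb_cos.
by rewrite !(mulrDr k%:R) mulrN !cosD cosN sinN; ring.
Qed.

Lemma size_fejer_poly n p : (1 <= n)%N -> (size (fejer_poly n p) <= n)%N.
Proof.
move=> n1; rewrite (leq_trans (size_polyD _ _))// geq_max size_polyN.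
rewrite (leq_trans (size_polyC_leq1 _))// andbT.
apply: (leq_trans (size_sum _ _ _)); apply/bigmax_leqP => k _.
by rewrite (leq_trans (size_scale_leq _ _))// (leq_trans (size_cheb _)).
Qed.

End chebyshev.

Ltac nonneg := solve [repeat first
  [ done | assumption | apply: ltW; assumption | apply: sqr_ge0 | apply: exprn_ge0
  | apply: mulr_ge0 | apply: powR_ge0 | apply: sqrtr_ge0 | rewrite invr_ge0
  | apply: addr_ge0 ]].

(** * Decay of the Fejer kernel and its weighted integral *)

Section fejer_bound.
Variable R : realType.
Implicit Types (a b c d x y p q r s t u w z : R) (n : nat).

(** For angles A, B in the first quadrant with sines p, q and cosines c, d this reads |sin A - sin
    B| <= |sin (A - B)|. It follows from sin^2 A - sin^2 B = sin (A - B) sin (A + B) and sin (A + B)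
    <= sin A + sin B. *)
Lemma sqr_sub_le_cross p q c d : 0 <= p -> 0 <= q -> 0 <= c -> 0 <= d ->
  p ^+ 2 + c ^+ 2 = 1 -> q ^+ 2 + d ^+ 2 = 1 ->
  (p - q) ^+ 2 <= (p * d - c * q) ^+ 2.
Proof.
move=> p0 q0 c0 d0 pc qd.
have [pq0|pq0] := eqVneq (p + q) 0.
  have -> : p = 0 by lra.
  have -> : q = 0 by lra.
  by rewrite subrr !(mul0r, mulr0) subrr.
have pq : 0 < p + q by rewrite lt_neqAle eq_sym pq0 addr_ge0.
have c1 : c <= 1 by nra.
have d1 : d <= 1 by nra.
have e : (p - q) * (p + q) = (p * d - c * q) * (p * d + c * q).
  have -> : (p - q) * (p + q) = p ^+ 2 * (q ^+ 2 + d ^+ 2) - q ^+ 2 * (p ^+ 2 + c ^+ 2).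
    by rewrite pc qd; ring.
  by ring.
have h : (p * d + c * q) ^+ 2 <= (p + q) ^+ 2.
  have h0 : 0 <= p * d + c * q by rewrite addr_ge0// mulr_ge0.
  have h1 : p * d + c * q <= p + q.
    by rewrite lerD// ?ler_piMr// ler_piMl.
  by rewrite ler_sqr ?nnegrE// ltW.
have p2 : 0 < (p + q) ^+ 2 by rewrite exprn_gt0.
by rewrite -(ler_pM2r p2) -exprMn e exprMn ler_wpM2l// sqr_ge0.
Qed.

(** The sum of the bound n^2 on the kernel and of n^2 times the bound 1 on the kernel times sin^2 (s
    / 2). The resulting Lorentzian profile can be integrated by an arctangent. *)
Lemma fejer_decay n s u : u ^+ 2 <= sin (s / 2) ^+ 2 ->
  fejer n s <= 2 * n%:R ^+ 2 * (1 + (n%:R * u) ^+ 2)^-1.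
Proof.
move=> us; have n0 : 0 <= n%:R ^+ 2 :> R by rewrite sqr_ge0.
have p0 : 0 < 1 + (n%:R * u) ^+ 2 by rewrite ltr_wpDr ?sqr_ge0.
rewrite ler_pdivlMr// mulrDr mulr1.
have -> : 2 * n%:R ^+ 2 = n%:R ^+ 2 + n%:R ^+ 2 :> R by ring.
apply: lerD; first exact: fejer_le.
rewrite exprMn mulrCA -[leRHS]mulr1 ler_wpM2l//.
apply: (@le_trans _ _ (fejer n s * sin (s / 2) ^+ 2)).
  by rewrite ler_wpM2l// fejer_ge0.
by rewrite fejerE sin2cos2 gerBl sqr_ge0.
Qed.

Definition angle x : R := acos (1 - 2 * x).

Lemma angleP x : 0 < x < 1 -> let t := angle x in [/\ 0 < t < pi,
  x = (1 - cos t) / 2, sin (t / 2) = Num.sqrt x & cos (t / 2) = Num.sqrt (1 - x)].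
Proof.
move=> /andP[x0 x1] t.
have cE : cos t = 1 - 2 * x.
  by rewrite acosK// in_itv/=; apply/andP; split; lra.
have t0 : 0 < t by apply: acos_gt0; apply/andP; split; lra.
have tpi : t < pi by apply: acos_ltpi; apply/andP; split; lra.
have s2 : sin (t / 2) ^+ 2 = x by have := cos_double t; rewrite cE; lra.
have sg : 0 <= sin (t / 2) by apply: sin_ge0_pi; apply/andP; split; lra.
have cg : 0 <= cos (t / 2) by apply: cos_ge0_pihalf; apply/andP; split; lra.
split.
- by rewrite t0.
- by rewrite cE; field.
- by rewrite -s2 sqrtr_sqr ger0_norm.
- by rewrite -s2 -cos2sin2 sqrtr_sqr ger0_norm.
Qed.

(** The symmetrized kernel has two terms, in t - p and t + p. For half-angles in the first quadrant
    the sum has the larger squared sine, so the difference controls both terms, and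
    [sqr_sub_le_cross] turns it into a difference of square roots. The second bound is the same seen
    from the endpoint 1. *)
Lemma fejer_poly_decay n y x : 0 < y < 1 -> 0 < x < 1 ->
  (fejer_poly n (angle y)).[x] <=
    4 * n%:R ^+ 2 * (1 + (n%:R * (Num.sqrt x - Num.sqrt y)) ^+ 2)^-1 /\
  (fejer_poly n (angle y)).[x] <=
    4 * n%:R ^+ 2 * (1 + (n%:R * (Num.sqrt (1 - x) - Num.sqrt (1 - y))) ^+ 2)^-1.
Proof.
move=> /angleP[/andP[]]; set p := angle y => p0 ppi _ <- <-.
move=> /angleP[/andP[]]; set t := angle x => t0 tpi -> <- <-.
rewrite fejer_polyE.
have A0 : 0 <= sin (t / 2) by apply: sin_ge0_pi; apply/andP; split; lra.
have A1 : 0 <= cos (t / 2) by apply: cos_ge0_pihalf; apply/andP; split; lra.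
have B0 : 0 <= sin (p / 2) by apply: sin_ge0_pi; apply/andP; split; lra.
have B1 : 0 <= cos (p / 2) by apply: cos_ge0_pihalf; apply/andP; split; lra.
have eA : sin (t / 2) ^+ 2 + cos (t / 2) ^+ 2 = 1 by rewrite addrC cos2Dsin2.
have eB : sin (p / 2) ^+ 2 + cos (p / 2) ^+ 2 = 1 by rewrite addrC cos2Dsin2.
have e1 : sin ((t - p) / 2) = sin (t / 2) * cos (p / 2) - cos (t / 2) * sin (p / 2).
  by rewrite mulrBl sinB.
have e2 : sin ((t + p) / 2) = sin (t / 2) * cos (p / 2) + cos (t / 2) * sin (p / 2).
  by rewrite mulrDl sinD.
move: A0 A1 B0 B1 eA eB e1 e2.
move: (sin (t / 2)) (cos (t / 2)) (sin (p / 2)) (cos (p / 2)) => A c B d.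
move=> A0 c0 B0 d0 eA eB e1 e2.
have h1 := sqr_sub_le_cross A0 B0 c0 d0 eA eB.
have h2 : (c - d) ^+ 2 <= (A * d - c * B) ^+ 2.
  have := @sqr_sub_le_cross c d A B c0 d0 A0 B0.
  rewrite addrC eA addrC eB => /(_ erefl erefl)/le_trans; apply.
  by rewrite -sqrrN opprB.
have h3 : (A * d - c * B) ^+ 2 <= (A * d + c * B) ^+ 2.
  have : 0 <= A * d * (c * B) by rewrite !mulr_ge0.
  by rewrite sqrrB sqrrD; lra.
have split4 (w : R) : 2 * n%:R ^+ 2 * w + 2 * n%:R ^+ 2 * w = 4 * n%:R ^+ 2 * w by ring.
by split; rewrite -split4; apply: lerD; apply: fejer_decay; rewrite ?e1 ?e2//;
  apply: le_trans h3.
Qed.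

(** A primitive of the majorant [dpsi]. The arctangent serves where x >= y / 4, the other term where
    x < y / 4; the latter is a multiple of a power of x / (x + y), so its increment on [0, 1] is
    bounded uniformly in y up to the common prefactor. *)
Definition psi b n y x : R :=
  y `^ (b + 2^-1) / n%:R * (4 * atan (n%:R * (Num.sqrt x - Num.sqrt y)) +
    2 / (b + 1) * (x `^ (b + 1) * (x + y) `^ (- (b + 1)))).

Definition dpsi b n y x : R :=
  y `^ (b + 2^-1) / n%:R * (4 * (n%:R * (2 * Num.sqrt x)^-1 *
    (1 + (n%:R * (Num.sqrt x - Num.sqrt y)) ^+ 2)^-1) +
    2 * (x `^ b * (x + y) `^ (- (b + 2)) * y)).

Lemma is_derive_psi b n y x : -1 < b -> 0 < y -> 0 < x ->
  is_derive x 1 (psi b n y) (dpsi b n y x).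
Proof.
move=> b1 y0 x0.
have h1 : is_derive x 1 (fun z : R => n%:R * (Num.sqrt z - Num.sqrt y))
    (n%:R * (2 * Num.sqrt x)^-1).
  apply: (is_derive_eq (is_deriveZ n%:R (is_deriveB (is_derive1_sqrt x0)
    (is_derive_cst (Num.sqrt y : R^o) x 1)))).
  by rewrite subr0.
have h2 := @is_derive1_comp _ (@atan R) (fun z : R => n%:R * (Num.sqrt z - Num.sqrt y))
  _ _ _ (is_derive1_atan (n%:R * (Num.sqrt x - Num.sqrt y))) h1.
have h3 := is_derive_powR (b + 1) x0.
have xy0 : 0 < x + y by rewrite addr_gt0.
have h4 : is_derive x 1 (fun z : R => z + y) 1.
  apply: (is_derive_eq (is_deriveD (is_derive_id x 1) (is_derive_cst (y : R^o) x 1))).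
  by rewrite addr0.
have h5 := @is_derive1_comp _ (fun z : R => z `^ (- (b + 1)))
  (fun z : R => z + y) _ _ _ (is_derive_powR (- (b + 1)) xy0) h4.
have h := is_deriveZ (y `^ (b + 2^-1) / n%:R) (is_deriveD (is_deriveZ 4 h2)
  (is_deriveZ (2 / (b + 1)) (is_deriveM h3 h5))).
apply: (is_derive_eq h); rewrite /dpsi /GRing.scale/=; congr (_ * (_ + _)).
  by ring.
rewrite mulr1 addrK.
have -> : x `^ (b + 1) = x `^ b * x.
  by rewrite powRD ?powRr1 ?(gt_eqF x0) ?implybT ?ltW.
have -> : (x + y) `^ (- (b + 1) - 1) = (x + y) `^ (- (b + 2)) by congr (_ `^ _); ring.
have -> : (x + y) `^ (- (b + 1)) = (x + y) `^ (- (b + 2)) * (x + y).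
  rewrite -{3}(powRr1 (ltW xy0)) -powRD ?(gt_eqF xy0) ?implybT//; congr (_ `^ _); ring.
have b0 : b + 1 != 0 by rewrite gt_eqF//; lra.
by field.
Qed.

Lemma continuous_dpsi b n y x : 0 < y -> 0 < x -> {for x, continuous (dpsi b n y)}.
Proof.
move=> y0 x0; have q0 : 0 < Num.sqrt x by rewrite sqrtr_gt0.
have cs : {for x, continuous (@Num.sqrt R)} by exact: sqrt_continuous.
have c1 : {for x, continuous (fun z : R => n%:R * (Num.sqrt z - Num.sqrt y))}.
  by apply: cvgM; [exact: cvg_cst|apply: cvgB => //; exact: cvg_cst].
have xy0 : 0 < x + y by rewrite addr_gt0.
apply: cvgM; first exact: cvg_cst.
apply: cvgD; (apply: cvgM; first exact: cvg_cst).
  apply: cvgM.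
    apply: cvgM; first exact: cvg_cst.
    apply: cvgV; first by rewrite mulf_neq0// gt_eqF.
    by apply: cvgM => //; exact: cvg_cst.
  apply: cvgV; first by rewrite gt_eqF// ltr_wpDr// sqr_ge0.
  apply: cvgD; first exact: cvg_cst.
  by apply: cvgM; exact: c1.
apply: cvgM; last exact: cvg_cst.
apply: cvgM; first exact: is_derive_continuous (is_derive_powR _ x0).
apply: (@continuous_comp _ _ _ (fun z : R => z + y) (fun z : R => z `^ (- (b + 2)))).
  by apply: cvgD; [exact: cvg_id|exact: cvg_cst].
exact: is_derive_continuous (is_derive_powR _ xy0).
Qed.

Lemma psi_cvg_right0 b n y : -1 < b -> 0 < y ->
  psi b n y x @[x --> 0^'+] --> psi b n y 0.
Proof.
move=> b1 y0; apply: cvgM; first exact: cvg_cst.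
apply: cvgD; (apply: cvgM; first exact: cvg_cst).
  apply: cvg_at_right_continuous.
  apply: (@continuous_comp _ _ _ (fun z : R => n%:R * (Num.sqrt z - Num.sqrt y)) (@atan R)).
    apply: cvgM; first exact: cvg_cst.
    by apply: cvgB; [exact: sqrt_continuous|exact: cvg_cst].
  exact: continuous_atan.
apply: cvgM; first by apply: powR_cvg_right0; lra.
apply: cvg_at_right_continuous.
apply: (@continuous_comp _ _ _ (fun z : R => z + y) (fun z : R => z `^ (- (b + 1)))).
  by apply: cvgD; [exact: cvg_id|exact: cvg_cst].
rewrite add0r; exact: is_derive_continuous (is_derive_powR _ y0).
Qed.

Lemma psi_osc b n y : -1 < b -> 0 < y ->
  psi b n y 1 - psi b n y 0 <= y `^ (b + 2^-1) / n%:R * (4 * pi + 2 / (b + 1)).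
Proof.
move=> b1 y0; have b0 : 0 < b + 1 by lra.
rewrite /psi -mulrBr ler_wpM2l ?divr_ge0 ?powR_ge0//.
rewrite (@powR0 _ (b + 1)) ?gt_eqF// mul0r mulr0 addr0 powR1 mul1r addrAC -mulrBr.
apply: lerD.
  rewrite ler_wpM2l//.
  have := atan_ltpi2 (n%:R * (Num.sqrt 1 - Num.sqrt y)).
  have := atan_gtNpi2 (n%:R * (Num.sqrt 0 - Num.sqrt y)); lra.
rewrite -[leRHS]mulr1; apply: ler_wpM2l; first by nonneg.
rewrite powRN invf_le1 ?powR_gt0 ?addr_gt0//.
rewrite -[leLHS](powRr0 (1 + y)); apply: ler_powR; last by apply: ltW.
by rewrite lerDl ltW.
Qed.

(** For y <= 4 x, x^(b+1/2) is at most 2 y^(b+1/2) and the arctangent term suffices. For y > 4 x the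
    Lorentzian factor is at most 1 / (n sqrt y), and the power term suffices because x + y is
    comparable to y. *)
Lemma dpsi_maj b n y x : (1 <= n)%N -> -1 < b -> b <= - 2^-1 -> 0 < y -> 0 < x ->
  x `^ b * (1 + (n%:R * (Num.sqrt x - Num.sqrt y)) ^+ 2)^-1 <= dpsi b n y x.
Proof.
move=> n1 b1 b2 y0 x0.
have n0 : 0 < n%:R :> R by rewrite ltr0n.
have q0 : 0 < Num.sqrt x by rewrite sqrtr_gt0.
have r0 : 0 < Num.sqrt y by rewrite sqrtr_gt0.
have qq : Num.sqrt x ^+ 2 = x by rewrite sqr_sqrtr// ltW.
have rr : Num.sqrt y ^+ 2 = y by rewrite sqr_sqrtr// ltW.
have halfE z : 0 < z -> z `^ (b + 2^-1) = z `^ b * Num.sqrt z.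
  by move=> z0; rewrite powRD ?(gt_eqF z0) ?implybT// powR12_sqrt// ltW.
have xb0 : 0 < x `^ b by rewrite powR_gt0.
have yb0 : 0 < y `^ b by rewrite powR_gt0.
have xyb0 : 0 < (x + y) `^ (- (b + 2)) by rewrite powR_gt0 ?addr_gt0.
rewrite /dpsi halfE//.
set q := Num.sqrt x in q0 qq *; set r := Num.sqrt y in r0 rr *.
set D := (1 + (n%:R * (q - r)) ^+ 2).
have D0 : 0 < D by rewrite ltr_wpDr// sqr_ge0.
have [yx|xy] := leP y (4 * x).
  (* x^(b+1/2) <= 2 y^(b+1/2) since the exponent is in (-1/2, 0] *)
  have h : x `^ b * q <= 2 * (y `^ b * r).
    rewrite -!halfE//; have [e eE] : exists e, e = - (b + 2^-1) by exists (- (b + 2^-1)).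
    have -> : b + 2^-1 = - e by rewrite eE opprK.
    rewrite !powRN ler_pdivlMr ?powR_gt0// mulrC ler_pdivrMr ?powR_gt0//.
    apply: (@le_trans _ _ ((4 * x) `^ e)).
      by apply: ge0_ler_powR => //; rewrite ?nnegrE ?eE; first lra; nonneg.
    rewrite powRM//; last exact: ltW.
    apply: ler_wpM2r; first exact: powR_ge0.
    have -> : (2 : R) = 4 `^ 2^-1.
      rewrite powR12_sqrt// (_ : 4 = 2 ^+ 2) ?sqrtr_sqr ?ger0_norm//.
      by rewrite expr2; ring.
    by apply: ler_powR; rewrite ?eE; lra.
  apply: (@le_trans _ _ (y `^ b * r / n%:R * (4 * (n%:R * (2 * q)^-1 * D^-1)))).
    have -> : y `^ b * r / n%:R * (4 * (n%:R * (2 * q)^-1 * D^-1)) =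
        2 * (y `^ b * r) / q * D^-1.
      by field; rewrite !gt_eqF.
    by apply: ler_wpM2r; [nonneg|rewrite ler_pdivlMr].
  by apply: ler_wpM2l; [nonneg|rewrite lerDl; nonneg].
have rq : 2 * q <= r.
  have -> : 2 * q = Num.sqrt (4 * x).
    rewrite sqrtrM//; congr (_ * _); rewrite (_ : 4 = 2 ^+ 2) ?sqrtr_sqr ?ger0_norm//.
    by rewrite expr2; ring.
  by rewrite ler_wsqrtr// ltW.
(* 1 + s^2 >= 2 s with s = n (r - q), and r - q >= r / 2. *)
have DnR : n%:R * r <= D.
  have : 0 <= (1 - n%:R * (r - q)) ^+ 2 by rewrite sqr_ge0.
  have : n%:R * r <= n%:R * (2 * (r - q)) by apply: ler_wpM2l; [nonneg|lra].
  by rewrite /D; lra.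
have xy2 : (x + y) `^ (- (b + 2)) = ((x + y) `^ b * (x + y) ^+ 2)^-1.
  have xy0 : 0 < x + y by rewrite addr_gt0.
  rewrite powRN -(powR_mulrn 2 (ltW xy0)) -powRD ?(gt_eqF xy0) ?implybT//.
have le1 : (x + y) `^ b * (x + y) ^+ 2 <= 2 * y `^ b * y ^+ 2.
  rewrite (mulrC 2) -mulrA; apply: ler_pM; [nonneg|nonneg| |nra].
  have [e eE] : exists e, e = - b by exists (- b).
  have -> : b = - e by rewrite eE opprK.
  rewrite [leLHS]powRN [leRHS]powRN lef_pV2 ?posrE ?powR_gt0 ?addr_gt0//.
  by apply: ge0_ler_powR; rewrite ?nnegrE ?eE; try nonneg; lra.
apply: (@le_trans _ _ (y `^ b * r / n%:R * (2 * (x `^ b * (x + y) `^ (- (b + 2)) * y)))).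
  apply: (@le_trans _ _ (x `^ b * (n%:R * r)^-1)).
    by apply: ler_wpM2l; [nonneg|rewrite lef_pV2 ?posrE ?mulr_gt0].
  have -> : y `^ b * r / n%:R * (2 * (x `^ b * (x + y) `^ (- (b + 2)) * y)) =
      x `^ b * (n%:R * r)^-1 * (2 * y `^ b * y ^+ 2 * (x + y) `^ (- (b + 2))).
    by rewrite -[in RHS]rr -[in LHS]rr; field; rewrite !gt_eqF.
  rewrite -[leLHS]mulr1; apply: ler_wpM2l; first by nonneg.
  by rewrite xy2 -ler_pdivrMr ?invr_gt0 ?mulr_gt0 ?powR_gt0 ?exprn_gt0 ?addr_gt0// invrK mul1r.
by apply: ler_wpM2l; [nonneg|rewrite lerDr; nonneg].
Qed.

(** On each half of the interval one factor of the weight is at most 2 and the other is treated from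
    its own endpoint, by [dpsi b n y] at x or by [dpsi a n (1 - y)] at 1 - x. The integral of the
    majorant is then the increment of the primitives. *)
Lemma Lw_fejer_poly a b : -1 < a -> a <= - 2^-1 -> -1 < b -> b <= - 2^-1 ->
  exists2 C : R, 0 < C & forall n y, (1 <= n)%N -> 0 < y < 1 ->
    Lw a b (fejer_poly n (angle y)) <=
      C * n%:R * weight (a + 2^-1) (b + 2^-1) y.
Proof.
move=> a1 a2 b1 b2.
have Ka : 0 < 4 * pi + 2 / (a + 1) :> R.
  by rewrite addr_gt0// ?mulr_gt0 ?pi_gt0 ?invr_gt0//; lra.
have Kb : 0 < 4 * pi + 2 / (b + 1) :> R.
  by rewrite addr_gt0// ?mulr_gt0 ?pi_gt0 ?invr_gt0//; lra.
exists (8 * ((4 * pi + 2 / (b + 1)) + (4 * pi + 2 / (a + 1)))).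
  by rewrite mulr_gt0// addr_gt0.
move=> n y n1 y01; have /andP[y0 y1] := y01.
have z0 : 0 < 1 - y by rewrite subr_gt0.
have n0 : 0 < n%:R :> R by rewrite ltr0n.
(* The 4 of [fejer_poly_decay] times the bound 2 on the nonsingular factor of the weight. *)
pose c : R := 8 * n%:R ^+ 2.
have c0 : 0 < c by rewrite mulr_gt0// exprn_gt0.
pose g x := c * (dpsi b n y x + dpsi a n (1 - y) (1 - x)).
pose G x := c * (psi b n y x - psi a n (1 - y) (1 - x)).
have dom x : 0 < x -> 0 < y -> 0 <= dpsi b n y x.
  move=> x0 _; rewrite /dpsi; apply: mulr_ge0; first by rewrite divr_ge0// powR_ge0.
  rewrite addr_ge0// !mulr_ge0 ?powR_ge0 ?invr_ge0 ?sqrtr_ge0 ?(ltW y0)//.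
  by rewrite addr_ge0// sqr_ge0.
have dom2 x : 0 < x -> 0 <= dpsi a n (1 - y) x.
  move=> x0; rewrite /dpsi; apply: mulr_ge0; first by rewrite divr_ge0// powR_ge0.
  rewrite addr_ge0// !mulr_ge0 ?powR_ge0 ?invr_ge0 ?sqrtr_ge0 ?(ltW z0)//.
  by rewrite addr_ge0// sqr_ge0.
have g0 x : 0 < x < 1 -> 0 <= g x.
  move=> /andP[x0 x1]; rewrite /g mulr_ge0 ?(ltW c0)// addr_ge0// ?dom// dom2// subr_gt0//.
have le_g x : 0 < x < 1 -> (fejer_poly n (angle y)).[x] * weight a b x <= g x.
  move=> x01; have /andP[x0 x1] := x01.
  have u0 : 0 < 1 - x by rewrite subr_gt0.
  have [d1 d2] := fejer_poly_decay n y01 x01.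
  have m1 := dpsi_maj n1 b1 b2 y0 x0.
  have m2 := dpsi_maj n1 a1 a2 z0 u0.
  have := dom x x0 y0; have := dom2 _ u0; move: d1 d2 m1 m2; rewrite /weight /g.
  set k1 := (1 + (n%:R * (Num.sqrt x - Num.sqrt y)) ^+ 2)^-1.
  set k2 := (1 + (n%:R * (Num.sqrt (1 - x) - Num.sqrt (1 - y))) ^+ 2)^-1.
  have k10 : 0 <= k1 by rewrite invr_ge0 addr_ge0// sqr_ge0.
  have k20 : 0 <= k2 by rewrite invr_ge0 addr_ge0// sqr_ge0.
  have p0 : 0 <= x `^ b by rewrite powR_ge0.
  have q0 : 0 <= (1 - x) `^ a by rewrite powR_ge0.
  have nn0 : 0 <= n%:R ^+ 2 :> R by rewrite sqr_ge0.
  move=> d1 d2 m1 m2 dm2 dm1.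
  have [xh|xh] := leP x 2^-1.
    have h : (1 - x) `^ a <= 2 by apply: powR_le2 => //; apply/andP; split; lra.
    apply: (@le_trans _ _ (4 * n%:R ^+ 2 * k1 * (2 * x `^ b))).
      apply: (@le_trans _ _ (4 * n%:R ^+ 2 * k1 * ((1 - x) `^ a * x `^ b))).
        by apply: ler_wpM2r => //; nonneg.
      by apply: ler_wpM2l; [nonneg|exact: ler_wpM2r].
    have -> : 4 * n%:R ^+ 2 * k1 * (2 * x `^ b) = c * (x `^ b * k1) by rewrite /c; ring.
    by apply: ler_wpM2l; [nonneg|lra].
  have h : x `^ b <= 2 by apply: powR_le2 => //; apply/andP; split; lra.
  apply: (@le_trans _ _ (4 * n%:R ^+ 2 * k2 * ((1 - x) `^ a * 2))).
    apply: (@le_trans _ _ (4 * n%:R ^+ 2 * k2 * ((1 - x) `^ a * x `^ b))).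
      by apply: ler_wpM2r => //; nonneg.
    by apply: ler_wpM2l; [nonneg|exact: ler_wpM2l].
  have -> : 4 * n%:R ^+ 2 * k2 * ((1 - x) `^ a * 2) = c * ((1 - x) `^ a * k2).
    by rewrite /c; ring.
  by apply: ler_wpM2l; [nonneg|lra].
have onem_d x : is_derive x 1 (fun t : R => 1 - t) (- 1).
  apply: (is_derive_eq (is_deriveB (is_derive_cst (1 : R^o) x 1) (is_derive_id x (1 : R^o)))).
  by rewrite sub0r.
have dG x : 0 < x < 1 -> is_derive x 1 G (g x).
  move=> /andP[x0 x1]; have u0 : 0 < 1 - x by rewrite subr_gt0.
  have h1 := is_derive_psi n b1 y0 x0.
  have h2 := @is_derive1_comp _ (psi a n (1 - y)) (fun t : R => 1 - t) _ _ _
    (is_derive_psi n a1 z0 u0) (onem_d x).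
  apply: (is_derive_eq (is_deriveZ c (is_deriveB h1 h2))).
  by rewrite /g /GRing.scale/= mulrN1 opprK.
have cg x : 0 < x < 1 -> {for x, continuous g}.
  move=> /andP[x0 x1]; have u0 : 0 < 1 - x by rewrite subr_gt0.
  apply: cvgM; first exact: cvg_cst.
  apply: cvgD; first exact: continuous_dpsi.
  apply: (@continuous_comp _ _ _ (fun t : R => 1 - t) (dpsi a n (1 - y))).
    exact: is_derive_continuous (onem_d x).
  exact: continuous_dpsi.
have G0 : G x @[x --> 0^'+] --> G 0.
  apply: cvgM; first exact: cvg_cst.
  apply: cvgB; first exact: psi_cvg_right0.
  apply: cvg_at_right_continuous.
  apply: (@continuous_comp _ _ _ (fun t : R => 1 - t) (psi a n (1 - y))).
    exact: is_derive_continuous (onem_d 0).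
  by apply: is_derive_continuous (is_derive_psi n a1 z0 _); rewrite subr0.
have G1 : G x @[x --> 1^'-] --> G 1.
  apply: cvgM; first exact: cvg_cst.
  apply: cvgB.
    by apply: cvg_at_left_continuous; apply: is_derive_continuous (is_derive_psi n b1 y0 _).
  rewrite subrr; apply: (@cvg_comp _ _ _ (fun t : R => 1 - t) (psi a n (1 - y))).
    exact: onem_cvg_left1.
  exact: psi_cvg_right0.
have [ig Eg] := dominated_FTC2_oo ltr01 dG cg G0 G1 dG cg G0 G1
  (fun x x01 => eq_ind_r (fun u => u <= g x) (lexx (g x)) (ger0_norm (g0 x x01))).
apply: (@le_trans _ _ (G 1 - G 0)).
  rewrite -Eg; apply: le_Rintegral => //.
    exact: measurable_itv.
  exact: integrable_poly_weight.
have -> : G 1 - G 0 = c * ((psi b n y 1 - psi b n y 0) +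
    (psi a n (1 - y) 1 - psi a n (1 - y) 0)).
  by rewrite /G subrr subr0; ring.
have o1 := psi_osc n b1 y0; have o2 := psi_osc n a1 z0.
(* [a + 2^-1] is at most 0, so the missing factor is at least 1. *)
have w1 : y `^ (b + 2^-1) <= weight (a + 2^-1) (b + 2^-1) y.
  rewrite /weight -[leLHS]mul1r; apply: ler_wpM2r; first exact: powR_ge0.
  by rewrite -[leLHS](powRr0 (1 - y)); apply: ger_powR; [apply/andP; split; lra|lra].
have w2 : (1 - y) `^ (a + 2^-1) <= weight (a + 2^-1) (b + 2^-1) y.
  rewrite /weight -[leLHS]mulr1; apply: ler_wpM2l; first exact: powR_ge0.
  by rewrite -[leLHS](powRr0 y); apply: ger_powR; [apply/andP; split; lra|lra].
set W := weight _ _ y in w1 w2 *.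
have nV : 0 <= n%:R^-1 :> R by rewrite invr_ge0.
have o1' : psi b n y 1 - psi b n y 0 <= W / n%:R * (4 * pi + 2 / (b + 1)).
  apply: (le_trans o1); apply: ler_wpM2r; first exact: ltW.
  by apply: ler_wpM2r.
have o2' : psi a n (1 - y) 1 - psi a n (1 - y) 0 <= W / n%:R * (4 * pi + 2 / (a + 1)).
  apply: (le_trans o2); apply: ler_wpM2r; first exact: ltW.
  by apply: ler_wpM2r.
apply: (@le_trans _ _ (c * (W / n%:R * (4 * pi + 2 / (b + 1)) +
   W / n%:R * (4 * pi + 2 / (a + 1))))).
  by apply: ler_wpM2l; [exact: ltW|exact: lerD].
rewrite /c le_eqVlt; apply/orP; left; apply/eqP.
by field; rewrite !gt_eqF//; lra.
Qed.

End fejer_bound.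

(** * A sieve inequality of Gallagher type *)

Section kernel.
Variable R : realType.
Implicit Types (a b c d p q t x y : R) (n N : nat) (Q : {poly R}).

(** The symmetrized kernel with [cos (k p)] written as a Chebyshev polynomial: it is now symmetric,
    polynomial in both variables, and meaningful at the endpoints. *)
Definition fker n x : {poly R} :=
  \sum_(k < n) (4 * (n%:R - k%:R) * (cheb R k).[x]) *: cheb R k - (2 * n%:R)%:P.

Lemma fkerE n x : 0 < x < 1 -> fker n x = fejer_poly n (angle x).
Proof.
move=> /angleP[_ xE _ _]; rewrite /fker /fejer_poly; congr (_ - _).
by apply: eq_bigr => k _; rewrite -cheb_cos -xE.
Qed.

Lemma fker_sym n x y : (fker n x).[y] = (fker n y).[x].
Proof.
rewrite /fker !hornerD !hornerN !hornerC !horner_sum; congr (_ - _).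
by apply: eq_bigr => k _; rewrite !hornerZ; ring.
Qed.

Lemma fker_bounds n x y : 0 < x < 1 -> 0 < y < 1 ->
  0 <= (fker n x).[y] <= 2 * n%:R ^+ 2.
Proof.
move=> x01 /angleP[_ -> _ _]; rewrite fkerE// fejer_polyE.
rewrite addr_ge0 ?fejer_ge0//=.
have := fejer_le n (angle y - angle x); have := fejer_le n (angle y + angle x).
by move=> h1 h2; rewrite [2]/(1 + 1) mulrDl mul1r; apply: lerD.
Qed.

Lemma fker_lower n x y : (1 <= n)%N -> 0 < x < 1 -> 0 < y < 1 ->
  `|angle y - angle x| * n%:R <= 2^-1 -> n%:R ^+ 2 / 2 <= (fker n x).[y].
Proof.
move=> n1 x01 y01 h; rewrite fkerE//.
have [_ yE _ _] := angleP y01; rewrite [X in _.[X]]yE fejer_polyE.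
apply: (le_trans (fejer_lower n1 h)).
by rewrite lerDl fejer_ge0.
Qed.

Lemma is_derive_angle y : 0 < y < 1 ->
  is_derive y 1 (@angle R) (weight (- 2^-1) (- 2^-1) y).
Proof.
move=> /andP[y0 y1].
have h1 : is_derive y 1 (fun t : R => 1 - 2 * t) (- 2).
  apply: (is_derive_eq (is_deriveB (is_derive_cst (1 : R^o) y 1)
    (is_deriveZ 2 (is_derive_id y (1 : R))))).
  by rewrite sub0r /GRing.scale/= mulr1.
have y11 : -1 < 1 - 2 * y < 1 by apply/andP; split; lra.
have h := @is_derive1_comp _ (@acos R) (fun t : R => 1 - 2 * t) _ _ _
  (is_derive1_acos y11) h1.
apply: (is_derive_eq h); rewrite mulrNN.
have -> : 1 - (1 - 2 * y) ^+ 2 = 2 ^+ 2 * ((1 - y) * y) by ring.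
rewrite sqrtrM ?sqr_ge0// sqrtr_sqr ger0_norm// sqrtrM; last by lra.
rewrite /weight !powRN !powR12_sqrt; [|lra..].
have A0 : 0 < Num.sqrt (1 - y) by rewrite sqrtr_gt0; lra.
have B0 : 0 < Num.sqrt y by rewrite sqrtr_gt0.
by field; rewrite !gt_eqF.
Qed.

Lemma angle_lt x y : 0 < x < 1 -> 0 < y < 1 -> angle x < angle y -> x < y.
Proof.
move=> x01 y01; have [/andP[a0 a1] xE _ _] := angleP x01.
have [/andP[b0 b1] yE _ _] := angleP y01 => ab.
have : cos (angle y) < cos (angle x).
  by rewrite ltr_cos// in_itv/= ?(ltW a0) ?(ltW a1) ?(ltW b0) ?(ltW b1).
lra.
Qed.

Lemma angle_le x y : 0 < x < 1 -> 0 < y < 1 -> x <= y -> angle x <= angle y.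
Proof.
by move=> x01 y01 xy; rewrite leNgt; apply/negP => /(angle_lt y01 x01); rewrite ltNge xy.
Qed.

Lemma angle_surj t : 0 < t < pi -> exists2 x : R, 0 < x < 1 & angle x = t.
Proof.
move=> /andP[t0 tpi]; exists ((1 - cos t) / 2); last first.
  rewrite /angle (_ : 1 - 2 * _ = cos t); last by field.
  by rewrite cosK// in_itv/= !ltW.
have p0 : (0 : R) <= pi by exact: pi_ge0.
have : cos t < 1 by rewrite -cos0 ltr_cos// in_itv/= ?lexx ?p0 ?ltW.
have : -1 < cos t by rewrite -cospi ltr_cos// in_itv/= ?lexx ?p0 ?ltW.
by move=> h1 h2; apply/andP; split; lra.
Qed.

(** The derivative of Q with respect to the angle is sqrt (y (1 - y)) Q'. Twice its product with Q
    is at most [d] Q^2 plus [d^-1] times its square; the remaining 2 [d] Q^2 pays for the term Q^2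
    in [gallagher_arc]. *)
Definition gal_poly d Q : {poly R} :=
  (3 * d) *: Q ^+ 2 + d^-1 *: ('X * (1 - 'X) * Q^`() ^+ 2).

Lemma gal_polyE d Q y : (gal_poly d Q).[y] =
  3 * d * Q.[y] ^+ 2 + d^-1 * (y * (1 - y) * Q^`().[y] ^+ 2).
Proof.
by rewrite /gal_poly hornerD !hornerZ horner_exp hornerM horner_exp hornerM hornerX
  hornerD hornerN hornerX hornerC.
Qed.

Lemma gal_poly_ge0 d Q y : 0 < d -> 0 < y < 1 -> 0 <= (gal_poly d Q).[y].
Proof.
move=> d0 /andP[y0 y1]; rewrite gal_polyE.
have y1' : 0 <= 1 - y by rewrite subr_ge0 ltW.
by nonneg.
Qed.

(* The derivative of [Q^2 (angle - c)], integrated over an arc with one end at x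
   on which [angle - c] is at most [1 / (2 n)]. *)
Lemma gallagher_arc n d Q x p q c : (1 <= n)%N -> n%:R <= d ->
  0 < p -> p < q -> q < 1 -> 0 < x < 1 ->
  Q.[q] ^+ 2 * (angle q - c) - Q.[p] ^+ 2 * (angle p - c) =
    Q.[x] ^+ 2 * (2 * n%:R)^-1 ->
  (forall y, p <= y <= q -> `|angle y - c| <= (2 * n%:R)^-1) ->
  (forall y, p <= y <= q -> `|angle y - angle x| <= (2 * n%:R)^-1) ->
  Q.[x] ^+ 2 <= 2 / n%:R ^+ 2 *
    Lw (- 2^-1) (- 2^-1) (gal_poly d Q * fker n x).
Proof.
move=> n1 nd p0 pq q1 x01 Feq hc hx.
have n0 : 0 < n%:R :> R by rewrite ltr0n.
have d0 : 0 < d by exact: lt_le_trans nd.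
set e := (2 * n%:R)^-1 in Feq hc hx *.
have e0 : 0 < e by rewrite invr_gt0 mulr_gt0.
have en : e * n%:R = 2^-1 by rewrite /e; field; rewrite gt_eqF.
have pq01 y : p <= y <= q -> 0 < y < 1.
  by move=> /andP[h1 h2]; apply/andP; split; lra.
pose w := @weight R (- 2^-1) (- 2^-1).
pose F y := Q.[y] ^+ 2 * (angle y - c).
pose h y := 2 * Q.[y] * Q^`().[y] * (angle y - c) + Q.[y] ^+ 2 * w y.
(* [2 / n%:R ^+ 2] compensates the lower bound of the kernel on the arc, and [e] is the length that
   multiplies Q(x)^2 and is cancelled at the end. *)
pose K : {poly R} := (e * (2 / n%:R ^+ 2)) *: (gal_poly d Q * fker n x).
have dF y : p <= y <= q -> is_derive y 1 F (h y).
  move=> /pq01 y01; have h1 := is_deriveM (is_derive_horner Q y) (is_derive_horner Q y).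
  have h2 := is_deriveB (is_derive_angle y01) (is_derive_cst (c : R^o) y 1).
  have -> : F = (horner Q * horner Q) * (@angle R - cst c).
    by apply/funext => z; rewrite /F expr2.
  by apply: (is_derive_eq (is_deriveM h1 h2)); rewrite /h /w /GRing.scale/= !fctE; ring.
have ch y : p <= y <= q -> {for y, continuous h}.
  move=> /pq01 y01; have cQ := @continuous_horner_at R Q y.
  have ca := is_derive_continuous (is_derive_angle y01).
  apply: cvgD.
    apply: cvgM; last by apply: cvgB => //; exact: cvg_cst.
    apply: cvgM; last exact: continuous_horner_at.
    by apply: cvgM => //; exact: cvg_cst.
  apply: cvgM; last exact: continuous_weight_at.
  exact: cvgM.
have ck y : p <= y <= q -> {for y, continuous (fun z => K.[z] * w z)}.
  move=> /pq01 y01; apply: cvgM; first exact: continuous_horner_at.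
  exact: continuous_weight_at.
have w0 y : 0 <= w y by exact: weight_ge0.
have K0 y : 0 < y < 1 -> 0 <= K.[y] * w y.
  move=> y01; rewrite mulr_ge0// hornerZ hornerM mulr_ge0//.
    by rewrite mulr_ge0 ?(ltW e0)// divr_ge0// sqr_ge0.
  by rewrite mulr_ge0 ?gal_poly_ge0//; have /andP[] := fker_bounds n x01 y01.
have hk y : p <= y <= q -> h y <= K.[y] * w y.
  move=> ypq; have y01 := pq01 _ ypq; have /andP[y0 y1] := y01.
  have low : n%:R ^+ 2 / 2 <= (fker n x).[y].
    by apply: fker_lower => //; rewrite -en ler_wpM2r// hx.
  apply: (@le_trans _ _ (e * (gal_poly d Q).[y] * w y)); last first.
    rewrite ler_wpM2r// hornerZ hornerM -mulrA ler_wpM2l ?(ltW e0)//.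
    have G0 := gal_poly_ge0 Q d0 y01; rewrite mulrCA -[leLHS]mulr1 ler_wpM2l//.
    rewrite -ler_pdivrMl ?divr_gt0 ?exprn_gt0// mulr1.
    by rewrite invf_div.
  (* The density [w] of the angle is the inverse of sqrt (y (1 - y)). *)
  have wE : w y * Num.sqrt (y * (1 - y)) = 1.
    rewrite /w /weight !powRN !powR12_sqrt; [|lra..].
    have A0 : 0 < Num.sqrt (1 - y) by rewrite sqrtr_gt0; lra.
    have B0 : 0 < Num.sqrt y by rewrite sqrtr_gt0.
    rewrite sqrtrM ?(ltW y0)//; by field; rewrite !gt_eqF.
  set r := Num.sqrt (y * (1 - y)) in wE.
  have rr : y * (1 - y) = r ^+ 2.
    by rewrite /r sqr_sqrtr// mulr_ge0 ?(ltW y0)//; lra.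
  rewrite /h gal_polyE rr.
  move: (Q.[y]) (Q^`().[y]) (angle y - c) (hc y ypq) (w0 y) wE => u v s sc.
  move: (w y) => W W0 wr.
  have h1 : 2 * u * v * s <= e * (W * (d * u ^+ 2 + d^-1 * (r ^+ 2 * v ^+ 2))).
    apply: (@le_trans _ _ (`|2 * u * v| * e)).
      by apply: (le_trans (ler_norm _)); rewrite normrM ler_wpM2l.
    rewrite mulrC ler_wpM2l ?(ltW e0)//.
    have -> : `|2 * u * v| = W * (2 * `|u| * (r * `|v|)).
      by rewrite !normrM ger0_norm// -[LHS]mul1r -wr; ring.
    rewrite ler_wpM2l// -subr_ge0.
    have -> : d * u ^+ 2 + d^-1 * (r ^+ 2 * v ^+ 2) - 2 * `|u| * (r * `|v|) =
        d^-1 * (d * `|u| - r * `|v|) ^+ 2.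
      rewrite -(real_normK (num_real u)) -(real_normK (num_real v)).
      by field; rewrite gt_eqF.
    by rewrite mulr_ge0 ?invr_ge0 ?(ltW d0)// sqr_ge0.
  (* [e * d] is at least [e * n], which is 1/2. *)
  have h2 : u ^+ 2 * W <= e * (W * (2 * d * u ^+ 2)).
    have -> : e * (W * (2 * d * u ^+ 2)) = u ^+ 2 * W * (2 * (e * d)) by ring.
    rewrite -[leLHS]mulr1; apply: ler_wpM2l; first by nonneg.
    have : e * n%:R <= e * d by rewrite ler_wpM2l ?(ltW e0).
    by rewrite en; lra.
  have -> : e * (3 * d * u ^+ 2 + d^-1 * (r ^+ 2 * v ^+ 2)) * W =
    e * (W * (d * u ^+ 2 + d^-1 * (r ^+ 2 * v ^+ 2))) + e * (W * (2 * d * u ^+ 2)) by ring.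
  exact: lerD.
have iK : (@lebesgue_measure R).-integrable (@unitIo R)
    (EFin \o (fun y => K.[y] * w y)).
  by apply: integrable_poly_weight; lra.
(* The kernel and [gal_poly] are nonnegative, so the arc may be enlarged to the whole interval. *)
have main : ((F q - F p)%:E <= (Lw (- 2^-1) (- 2^-1) K)%:E)%E.
  rewrite -(FTC2_cc pq dF ch) /Lw /Rintegral fineK; last first.
    by apply: integrable_fin_num iK; exact: measurable_itv.
  apply: (@le_trans _ _ (\int[@lebesgue_measure R]_(y in `[p, q]) (K.[y] * w y)%:E)%E).
    apply: le_integral => //.
    - exact: continuous_integrable_cc.
    - exact: continuous_integrable_cc.
    - by move=> y; rewrite inE/= in_itv/= => ypq; rewrite lee_fin hk.
  apply: ge0_subset_integral.
  - exact: measurable_itv.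
  - exact: measurable_itv.
  - by have /integrableP[] := iK.
  - by move=> y /unitIoP y01; rewrite lee_fin K0.
  - by move=> y; rewrite /= in_itv/= => /pq01 y01; apply/unitIoP.
move: main; rewrite lee_fin /F Feq /K LwZ; [|lra|lra].
by rewrite -[X in _ <= X -> _]mulrA [X in X <= _ -> _]mulrC ler_pM2l.
Qed.

(** The arc leaves x towards the middle, so that its length, at most 1/2, keeps it inside ]0, pi[.
    Taking c to be the angle of its other end kills the boundary term there. *)
Lemma gallagher n d Q x : (1 <= n)%N -> n%:R <= d -> 0 < x < 1 ->
  Q.[x] ^+ 2 <= 2 / n%:R ^+ 2 *
    Lw (- 2^-1) (- 2^-1) (gal_poly d Q * fker n x).
Proof.
move=> n1 nd x01; have [/andP[t0 tpi] _ _ _] := angleP x01.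
have n1' : 1 <= n%:R :> R by rewrite ler1n.
have n0 : 0 < n%:R :> R by rewrite ltr0n.
have p2 := @pi_ge2 R.
have e0 : 0 < (2 * n%:R)^-1 :> R by rewrite invr_gt0 mulr_gt0.
have e2 : (2 * n%:R)^-1 <= 2^-1 :> R.
  by rewrite lef_pV2 ?posrE ?mulr_gt0// ler_peMr.
set e := (2 * n%:R)^-1 in e0 e2.
have /andP[x0 x1] := x01.
have [tl|tr] := leP (angle x) (pi / 2).
  have [q q01 qE] : exists2 q : R, 0 < q < 1 & angle q = angle x + e.
    by apply: angle_surj; apply/andP; split; lra.
  have xq : x < q by apply: angle_lt => //; rewrite qE; lra.
  have /andP[q0 q1] := q01.
  have mono y : x <= y <= q -> angle x <= angle y <= angle q.
    move=> /andP[h1 h2]; have y01 : 0 < y < 1 by apply/andP; split; lra.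
    by rewrite !angle_le.
  apply: (@gallagher_arc n d Q x x q (angle q)) => //.
  - by rewrite qE -/e; ring.
  - by move=> y /mono; rewrite qE -/e => /andP[h1 h2]; rewrite ler_norml; apply/andP; split; lra.
  - by move=> y /mono; rewrite qE -/e => /andP[h1 h2]; rewrite ler_norml; apply/andP; split; lra.
have [p p01 pE] : exists2 p : R, 0 < p < 1 & angle p = angle x - e.
  by apply: angle_surj; apply/andP; split; lra.
have px : p < x by apply: angle_lt => //; rewrite pE; lra.
have /andP[p0 p1] := p01.
have mono y : p <= y <= x -> angle p <= angle y <= angle x.
  move=> /andP[h1 h2]; have y01 : 0 < y < 1 by apply/andP; split; lra.
  by rewrite !angle_le.
apply: (@gallagher_arc n d Q x p x (angle p)) => //.
- by rewrite pE -/e; ring.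
- by move=> y /mono; rewrite pE -/e => /andP[h1 h2]; rewrite ler_norml; apply/andP; split; lra.
- by move=> y /mono; rewrite pE -/e => /andP[h1 h2]; rewrite ler_norml; apply/andP; split; lra.
Qed.

End kernel.

Lemma poly_ge0_closure (R : realType) (p : {poly R}) :
  (forall x, 0 < x < 1 -> 0 <= p.[x]) -> forall x, 0 <= x <= 1 -> 0 <= p.[x].
Proof.
move=> p0 x /andP[x0 x1]; move: x0; rewrite le_eqVlt => /predU1P[<-|x0].
  have h := cvg_at_right_continuous (@continuous_horner_at R p 0).
  apply: (cvgr_to_ge h); near=> t; apply: p0; apply/andP; split.
    by near: t; exact: nbhs_right_gt.
  by near: t; exact: nbhs_right_lt.
move: x1; rewrite le_eqVlt => /predU1P[->|x1]; last by apply: p0; rewrite x0.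
have h := cvg_at_left_continuous (@continuous_horner_at R p 1).
apply: (cvgr_to_ge h); near=> t; apply: p0; apply/andP; split.
  by near: t; exact: nbhs_left_gt.
by near: t; exact: nbhs_left_lt.
Unshelve. all: by end_near. Qed.

(** * Interpolation error for polynomials *)

Section sampling.
Variables (R : realType) (a b : R).
Hypotheses (a1 : -1 < a) (a2 : a <= - 2^-1) (b1 : -1 < b) (b2 : b <= - 2^-1).
Implicit Types (n m N : nat) (Q u : {poly R}) (d x y : R).

Let h1 : -1 < - 2^-1 :> R. Proof. by lra. Qed.

Lemma Lw_half_le (p : {poly R}) : (forall x, 0 < x < 1 -> 0 <= p.[x]) ->
  Lw (- 2^-1) (- 2^-1) p <= Lw a b p.
Proof.
move=> p0; apply: le_Rintegral; [exact: measurable_itv|exact: integrable_poly_weight..|].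
move=> x /unitIoP x01; rewrite ler_wpM2l ?p0//; move/andP: x01 => [x0 x1].
by apply: ler_pM; rewrite ?powR_ge0//; apply: ger_powR => //; apply/andP; split; lra.
Qed.

(** The integrals along the angle carry the weight with exponents -1/2; the factor gained from the
    kernel integral is exactly what turns it into [weight a b]. *)
Lemma Lw_fker_half_le (S G : {poly R}) (c : R) :
  (forall y, 0 < y < 1 -> 0 <= G.[y]) ->
  (forall y, 0 < y < 1 -> S.[y] <= c * weight (a + 2^-1) (b + 2^-1) y) ->
  Lw (- 2^-1) (- 2^-1) (G * S) <= c * Lw a b G.
Proof.
move=> G0 Sc; rewrite -LwZ//.
apply: le_Rintegral; [exact: measurable_itv|exact: integrable_poly_weight..|].
move=> y /unitIoP y01; rewrite hornerM hornerZ.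
have wE : weight a b y = weight (a + 2^-1) (b + 2^-1) y * weight (- 2^-1) (- 2^-1) y.
  move/andP: y01 => [y0 y1]; have z0 : 0 < 1 - y by rewrite subr_gt0.
  have e (t : R) : t = t + 2^-1 - 2^-1 by rewrite addrK.
  rewrite /weight {1}(e a) {1}(e b) !powRD ?(gt_eqF y0) ?(gt_eqF z0) ?implybT//; ring.
rewrite wE [leRHS]mulrA ler_wpM2r ?weight_ge0//.
by rewrite (mulrC c) -[leRHS]mulrA ler_wpM2l ?G0 ?Sc.
Qed.

(** The trivial bound 2 n^2 on the kernel cancels the n^2 of [gallagher]. It is applied with n = 1:
    the dependence on the degree comes from [gal_poly]. *)
Lemma nikolskii n d Q x : (1 <= n)%N -> n%:R <= d -> 0 <= x <= 1 ->
  Q.[x] ^+ 2 <= 4 * Lw a b (gal_poly d Q).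
Proof.
move=> n1 nd x01; have n0 : 0 < n%:R :> R by rewrite ltr0n.
have d0 : 0 < d by exact: lt_le_trans nd.
suff : 0 <= ((4 * Lw a b (gal_poly d Q))%:P - Q ^+ 2).[x].
  by rewrite hornerD hornerN hornerC horner_exp subr_ge0.
apply: poly_ge0_closure => // {x01}x x01.
rewrite hornerD hornerN hornerC horner_exp subr_ge0.
apply: (le_trans (gallagher Q n1 nd x01)).
have h : Lw (- 2^-1) (- 2^-1) (gal_poly d Q * fker n x) <=
    2 * n%:R ^+ 2 * Lw a b (gal_poly d Q).
  apply: (@le_trans _ _ (Lw (- 2^-1) (- 2^-1) ((2 * n%:R ^+ 2) *: gal_poly d Q))).
    apply: Lw_le => // y y01; rewrite hornerM hornerZ mulrC.
    rewrite ler_wpM2r ?gal_poly_ge0//.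
    by have /andP[] := fker_bounds n x01 y01.
  rewrite LwZ//; apply: ler_wpM2l; first by nonneg.
  by apply: Lw_half_le => y y01; exact: gal_poly_ge0.
apply: (@le_trans _ _ (2 / n%:R ^+ 2 * (2 * n%:R ^+ 2 * Lw a b (gal_poly d Q)))).
  by apply: ler_wpM2l => //; rewrite divr_ge0// sqr_ge0.
rewrite le_eqVlt; apply/orP; left; apply/eqP.
by field; rewrite gt_eqF.
Qed.

Lemma gallagher_cc n d Q x : (1 <= n)%N -> n%:R <= d -> 0 <= x <= 1 ->
  Q.[x] ^+ 2 <= 2 / n%:R ^+ 2 *
    Lw (- 2^-1) (- 2^-1) (gal_poly d Q * fker n x).
Proof.
move=> n1 nd x01; set G := gal_poly d Q.
(* The right-hand side as a polynomial in x, obtained by integrating the kernel coefficientwise; the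
   inequality then extends to the endpoints by continuity. *)
pose P : {poly R} := (2 / n%:R ^+ 2) *:
  (\sum_(k < n) (4 * (n%:R - k%:R) * Lw (- 2^-1) (- 2^-1) (G * cheb R k)) *: cheb R k -
   (2 * n%:R * Lw (- 2^-1) (- 2^-1) G)%:P).
have PE z : P.[z] = 2 / n%:R ^+ 2 * Lw (- 2^-1) (- 2^-1) (G * fker n z).
  rewrite /P hornerZ; congr (_ * _).
  rewrite hornerD hornerN hornerC horner_sum /fker mulrBr LwB//.
  rewrite mulr_sumr Lw_sum// (mulrC G _%:P) mul_polyC LwZ//; congr (_ - _).
  by apply: eq_bigr => k _; rewrite hornerZ -scalerAr LwZ//; ring.
suff : 0 <= (P - Q ^+ 2).[x] by rewrite hornerD hornerN PE horner_exp subr_ge0.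
apply: poly_ge0_closure => // {x01}x x01.
by rewrite hornerD hornerN PE horner_exp subr_ge0; exact: gallagher.
Qed.

(** Sum [gallagher_cc] over the nodes with the quadrature weights. The weighted sum of the kernels
    is a quadrature of a polynomial of degree below N, hence equals the integral bounded in
    [Lw_fejer_poly]. *)
Lemma gauss_sampling : exists2 C : R, 0 < C &
  forall N (z : 'I_N.+1 -> R), injective z -> (forall i, 0 <= z i <= 1) ->
    (forall q : {poly R}, (size q <= N.+1)%N -> Lw a b (nodal z * q) = 0) ->
    (1 <= N)%N -> forall d Q, N%:R <= d ->
    \sum_j Q.[z j] ^+ 2 * Lw a b (lag z j) <= C / N%:R * Lw a b (gal_poly d Q).
Proof.
have [C C0 HC] := Lw_fejer_poly a1 a2 b1 b2.
exists (2 * C); first by rewrite mulr_gt0.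
move=> N z zi z01 orth N1 d Q Nd.
have n0 : 0 < N%:R :> R by rewrite ltr0n.
have d0 : 0 < d by exact: lt_le_trans Nd.
have w0 := gauss_weight_ge0 zi a1 b1 orth.
set G := gal_poly d Q.
pose S : {poly R} := \sum_j Lw a b (lag z j) *: fker N (z j).
apply: (@le_trans _ _ (2 / N%:R ^+ 2 * Lw (- 2^-1) (- 2^-1) (G * S))).
  rewrite /S mulr_sumr Lw_sum// mulr_sumr; apply: ler_sum => j _.
  rewrite -scalerAr LwZ// mulrCA [leLHS]mulrC ler_wpM2l//.
  exact: gallagher_cc.
have h : Lw (- 2^-1) (- 2^-1) (G * S) <= C * N%:R * Lw a b G.
  apply: Lw_fker_half_le => [y y01|y y01]; first exact: gal_poly_ge0.
  (* By symmetry of the kernel the sum over centres [z j] is the quadrature sum of the kernel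
     centred at y. *)
  have -> : S.[y] = Lw a b (fejer_poly N (angle y)).
    rewrite (gauss_exact zi a1 b1 orth); last first.
      by rewrite (leq_trans (size_fejer_poly _ N1))// (leq_trans (leqnSn N))// leq_addr.
    rewrite /S horner_sum; apply: eq_bigr => j _.
    by rewrite hornerZ fker_sym fkerE// mulrC.
  exact: HC.
apply: (@le_trans _ _ (2 / N%:R ^+ 2 * (C * N%:R * Lw a b G))).
  by apply: ler_wpM2l => //; rewrite divr_ge0// sqr_ge0.
rewrite le_eqVlt; apply/orP; left; apply/eqP.
by field; rewrite gt_eqF.
Qed.

(** * Blocks of the Jacobi expansion *)

Local Notation y_ := (shifted_jacobi a b).
Local Notation nrm Q := (Lw a b (Q ^+ 2)).

(** A Bernstein inequality: the eigenvalues n (n + a + b + 1) are at most D^2 because a + b + 1 <=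
    0, so the derivative part adds at most D to the 3 D of the first part. *)
Lemma Lw_gal_poly (r : seq nat) (c : nat -> R) (D : nat) : uniq r ->
  {in r, forall n, (n <= D)%N} -> (1 <= D)%N ->
  forall Q, Q = \sum_(n <- r) c n *: y_ n ->
  Lw a b (gal_poly D%:R Q) <= 4 * D%:R * nrm Q.
Proof.
move=> ur rD D1 Q QE; have D0 : 0 < D%:R :> R by rewrite ltr0n.
have hm (i : nat) := Lw_derivn_sqr c i a1 b1 ur.
have E0 := hm 0%N; rewrite derivn0 !addr0 -QE in E0.
have E1 := hm 1%N; rewrite derivn1 -QE LwS// in E1.
rewrite /gal_poly LwD// !LwZ// E1.
have h : \sum_(n <- r) c n ^+ 2 * (\prod_(i < 1) jeval a b i n) * nrm (y_ n) <=
    D%:R ^+ 2 * nrm Q.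
  rewrite E0 mulr_sumr big_seq [leRHS]big_seq; apply: ler_sum => n /rD nD.
  rewrite big_ord1 big_ord0 mulr1 /jeval subr0 addr0.
  have cn : 0 <= c n ^+ 2 * nrm (y_ n) by rewrite mulr_ge0 ?sqr_ge0 ?Lw_sqr_ge0.
  have -> : c n ^+ 2 * (n%:R * (n%:R + a + b + 1)) * nrm (y_ n) =
    n%:R * (n%:R + a + b + 1) * (c n ^+ 2 * nrm (y_ n)) by ring.
  apply: ler_wpM2r => //.
  have nD' : n%:R <= D%:R :> R by rewrite ler_nat.
  have n0 : 0 <= n%:R :> R by [].
  apply: (@le_trans _ _ (n%:R * n%:R)); first by apply: ler_wpM2l => //; move: (a2) (b2) => ? ?; lra.
  by rewrite expr2; apply: ler_pM.
have : D%:R^-1 * \sum_(n <- r) c n ^+ 2 * (\prod_(i < 1) jeval a b i n) * nrm (y_ n) <=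
   D%:R^-1 * (D%:R ^+ 2 * nrm Q) by apply: ler_wpM2l => //; rewrite invr_ge0 ltW.
have -> : D%:R^-1 * (D%:R ^+ 2 * nrm Q) = D%:R * nrm Q by field; rewrite gt_eqF.
lra.
Qed.

(* For m <= n every factor of the product is at least n^2 / (2 m). *)
Lemma prod_jeval_ge m n : (1 <= m)%N -> (m <= n)%N -> (2 <= n)%N ->
  (n%:R ^+ 2 / (2 * m%:R)) ^+ m <= \prod_(i < m) jeval a b i n.
Proof.
move=> m1 mn n2; have m0 : 0 < m%:R :> R by rewrite ltr0n.
rewrite -[X in _ ^+ X]card_ord -prodr_const; apply: ler_prod => i _.
apply/andP; split; first by rewrite divr_ge0 ?sqr_ge0// mulr_ge0.
have im : i%:R <= m%:R - 1 :> R.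
  by have := ltn_ord i; rewrite -(ler_nat R) -natr1; lra.
have mn' : m%:R <= n%:R :> R by rewrite ler_nat.
have n2' : 2 <= n%:R :> R by rewrite (ler_nat R 2).
have i0 : 0 <= i%:R :> R by [].
have m1' : 1 <= m%:R :> R by rewrite ler1n.
(* n / m bounds n - i from below, since i <= m - 1 and m <= n; n / 2 bounds the other factor, since
   a + b + 1 > -1 and n >= 2. *)
have e : n%:R ^+ 2 / (2 * m%:R) = (n%:R / m%:R) * (n%:R / 2) :> R.
  by field; rewrite gt_eqF.
have h2 : n%:R / 2 <= n%:R + i%:R + a + b + 1 by move: (a1) (b1) => ? ?; lra.
rewrite e /jeval; apply: ler_pM => //; rewrite ?divr_ge0//.
rewrite ler_pdivrMr//.
have : 0 <= (m%:R - 1) * (n%:R - m%:R) :> R by rewrite mulr_ge0//; lra.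
have : i%:R * m%:R <= (m%:R - 1) * m%:R :> R by apply: ler_wpM2r => //; exact: ltW.
lra.
Qed.

(** The two Parseval sums are compared term by term, each product of eigenvalues being at least (M^2
    / (2 m))^m. *)
Lemma block_norm (r : seq nat) (c : nat -> R) (M m : nat) : uniq r ->
  (1 <= m)%N -> (m <= M.+1)%N -> (1 <= M)%N -> {in r, forall n, (M < n)%N} ->
  forall Q, Q = \sum_(n <- r) c n *: y_ n ->
  nrm Q <= (2 * m%:R) ^+ m / (M%:R ^+ m) ^+ 2 *
    Lw (a + m%:R) (b + m%:R) (Q^`(m) ^+ 2).
Proof.
move=> ur m1 mM M1 rM Q QE.
have m0 : 0 < m%:R :> R by rewrite ltr0n.
have M0 : 0 < M%:R :> R by rewrite ltr0n.
have E0 := Lw_derivn_sqr c 0 a1 b1 ur; rewrite derivn0 !addr0 -QE in E0.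
rewrite E0 QE (Lw_derivn_sqr c m a1 b1 ur) mulr_sumr.
rewrite big_seq [leRHS]big_seq; apply: ler_sum => n /rM Mn.
rewrite big_ord0 mulr1.
have cn : 0 <= c n ^+ 2 * nrm (y_ n) by rewrite mulr_ge0 ?sqr_ge0 ?Lw_sqr_ge0.
have -> : (2 * m%:R) ^+ m / (M%:R ^+ m) ^+ 2 *
   (c n ^+ 2 * (\prod_(i < m) jeval a b i n) * nrm (y_ n)) =
   (2 * m%:R) ^+ m / (M%:R ^+ m) ^+ 2 * (\prod_(i < m) jeval a b i n) *
   (c n ^+ 2 * nrm (y_ n)) by ring.
rewrite -[leLHS]mul1r; apply: ler_wpM2r => //.
have p1 : 0 < (2 * m%:R) ^+ m :> R by rewrite exprn_gt0// mulr_gt0.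
have p2 : 0 < (M%:R ^+ m) ^+ 2 :> R by rewrite !exprn_gt0.
have h := prod_jeval_ge m1 (leq_trans mM Mn) (leq_ltn_trans M1 Mn).
rewrite mulrAC ler_pdivlMr// mul1r.
apply: (@le_trans _ _ ((2 * m%:R) ^+ m * (n%:R ^+ 2 / (2 * m%:R)) ^+ m)); last first.
  by apply: ler_wpM2l => //; exact: ltW.
rewrite -exprMn mulrCA divff ?mulr1; last by rewrite gt_eqF// mulr_gt0.
rewrite -!exprM mulnC; apply: lerXn2r; rewrite ?nnegrE ?exprn_ge0//.
by rewrite ler_nat ltnW.
Qed.

(** 3/4 is a rational upper bound of the ratio 2^(-1/2), and 4 is the sum of its geometric
    series. *)
Lemma geometric_34 (E : nat -> R) (A : R) (K : nat) : 0 <= A -> `|E 0%N| <= 0 ->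
  (forall k, (E k.+1 - E k) ^+ 2 <= A ^+ 2 * 2 ^- k) -> `|E K| <= 4 * A.
Proof.
move=> A0 E0 hE.
suff : `|E K| <= 4 * A * (1 - (3 / 4) ^+ K).
  move=> h; apply: (le_trans h); rewrite -[leRHS]mulr1; apply: ler_wpM2l.
    by rewrite mulr_ge0.
  by rewrite lerBlDr lerDl exprn_ge0// divr_ge0.
elim: K => [|k IH]; first by rewrite expr0 subrr mulr0.
have h : `|E k.+1 - E k| <= A * (3 / 4) ^+ k.
  rewrite -ler_sqr ?nnegrE ?mulr_ge0 ?exprn_ge0 ?divr_ge0//.
  rewrite (real_normK (num_real _)) (le_trans (hE k))// exprMn ler_wpM2l ?sqr_ge0//.
  rewrite -exprM mulnC exprM -exprVn; apply: lerXn2r; rewrite ?nnegrE ?exprn_ge0 ?divr_ge0//.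
  by lra.
have -> : E k.+1 = (E k.+1 - E k) + E k by rewrite subrK.
apply: (le_trans (ler_normD _ _)).
have -> : 4 * A * (1 - (3 / 4) ^+ k.+1) = A * (3 / 4) ^+ k + 4 * A * (1 - (3 / 4) ^+ k).
  by rewrite exprS; field.
exact: lerD.
Qed.

(** The error is linear in [u] and vanishes in degree at most N, so only the dyadic increments of
    the expansion contribute. [m <= N.+1] ensures that no degree above N is annihilated by m
    derivatives. *)
Lemma poly_interp_error m : (1 <= m)%N -> exists2 C : R, 0 < C &
  forall N (z : 'I_N.+1 -> R), injective z -> (forall i, 0 <= z i <= 1) ->
    (forall q : {poly R}, (size q <= N.+1)%N -> Lw a b (nodal z * q) = 0) ->
    (1 <= N)%N -> (m <= N.+1)%N -> forall u x, 0 <= x <= 1 ->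
    `|u.[x] - (lagi z (fun j => u.[z j])).[x]| <=
      C * N%:R `^ (2^-1 - m%:R) *
      Num.sqrt (Lw (a + m%:R) (b + m%:R) (u^`(m) ^+ 2)).
Proof.
move=> m1; have [C C0 HC] := gauss_sampling.
(* 16 comes from a block and 64 [C] from its interpolant, the 2 before them from the square of a
   difference; 2 (2 m)^m comes from the degree 2 M of a block and from [block_norm]. *)
pose K1 : R := 2 * (2 * m%:R) ^+ m * (2 * (16 + 64 * C)).
have m0 : 0 < m%:R :> R by rewrite ltr0n.
have K10 : 0 < K1.
  by rewrite /K1 !mulr_gt0 ?exprn_gt0 ?mulr_gt0// addr_gt0// mulr_gt0.
exists (4 * Num.sqrt K1); first by rewrite mulr_gt0// sqrtr_gt0.
move=> N z zi z01 orth N1 mN u x x01.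
have N0 : 0 < N%:R :> R by rewrite ltr0n.
have w0 := gauss_weight_ge0 zi a1 b1 orth.
have am1 : -1 < a + m%:R by move: (a1) => ?; lra.
have bm1 : -1 < b + m%:R by move: (b1) => ?; lra.
pose err (Q : {poly R}) := Q.[x] - (lagi z (fun j => Q.[z j])).[x].
have errD P Q : err (P + Q) = err P + err Q.
  rewrite /err hornerD.
  have -> : lagi z (fun j => (P + Q).[z j]) =
      lagi z (fun j => P.[z j]) + lagi z (fun j => Q.[z j]).
    by rewrite /lagi -big_split/=; apply: eq_bigr => j _; rewrite hornerD scalerDl.
  by rewrite hornerD; ring.
have errlow Q : (size Q <= N.+1)%N -> err Q = 0.
  by move=> sQ; rewrite /err lagi_id// subrr.
pose S := size u.
(* [size u] doublings of N certainly exceed the degree of [u]. *)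
have Sle : (size u <= (2 ^ S * N).+1)%N.
  rewrite ltnW// ltnS; apply: (@leq_trans (2 ^ S)); first by rewrite ltnW// ltn_expl.
  by rewrite leq_pmulr.
have [c uE] := shifted_jacobi_basis a1 b1 Sle.
pose W2 := Lw (a + m%:R) (b + m%:R) (u^`(m) ^+ 2).
have W20 : 0 <= W2 by exact: Lw_sqr_ge0.
pose blk p q : {poly R} := \sum_(n <- index_iota p q) c n *: y_ n.
have uE' : u = blk 0%N (2 ^ S * N).+1 by rewrite uE /blk big_mkord.
have jge n : (m <= n)%N -> 0 <= \prod_(i < m) jeval a b i n.
  move=> mn; apply: prodr_ge0 => i _; rewrite /jeval; apply: mulr_ge0.
    by rewrite subr_ge0 ler_nat (leq_trans _ mn)// ltnW.
  have i0 : 0 <= (i : nat)%:R :> R by [].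
  have n1 : 1 <= n%:R :> R by rewrite ler1n (leq_trans m1).
  by move: (a1) (b1) => ? ?; lra.
(* For n < m the factor of index i = n is zero. With nonnegative multipliers, discarding degrees
   cannot increase the norm of the m-th derivative. *)
have jge2 n : 0 <= \prod_(i < m) jeval a b i n.
  have [mn|nm] := leqP m n; first exact: jge.
  by rewrite (bigD1 (Ordinal nm))//= /jeval subrr !mul0r.
have sub_norm p q : (p <= q)%N -> (q <= (2 ^ S * N).+1)%N ->
    Lw (a + m%:R) (b + m%:R) ((blk p q)^`(m) ^+ 2) <= W2.
  move=> pq qS; rewrite /W2 uE' !Lw_derivn_sqr ?iota_uniq//.
  rewrite (@big_cat_nat _ _ _ p 0%N)//=; last exact: leq_trans qS.
  rewrite (@big_cat_nat _ _ _ q p (2 ^ S * N).+1)//=.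
  have nn r : 0 <= \sum_(n <- r) c n ^+ 2 * (\prod_(i < m) jeval a b i n) * nrm (y_ n).
    apply: sumr_ge0 => n _; rewrite mulr_ge0 ?Lw_sqr_ge0// mulr_ge0// sqr_ge0//.
  by rewrite addrCA lerDl addr_ge0.
pose E k := err (blk 0%N (2 ^ k * N).+1).
(* Frozen once the expansion is exhausted, so that the bound on increments holds for every k. *)
pose Ek k := if (k <= S)%N then E k else E S.
pose A := Num.sqrt (K1 * (N%:R / (N%:R ^+ m) ^+ 2) * W2).
have A2 : A ^+ 2 = K1 * (N%:R / (N%:R ^+ m) ^+ 2) * W2.
  rewrite sqr_sqrtr// mulr_ge0// mulr_ge0 ?(ltW K10)// divr_ge0// sqr_ge0//.
have step k : (k < S)%N -> (E k.+1 - E k) ^+ 2 <= A ^+ 2 * 2 ^- k.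
  move=> kS; pose M := (2 ^ k * N)%N.
  have M1 : (1 <= M)%N by rewrite muln_gt0 expn_gt0.
  have NM : (N <= M)%N by rewrite leq_pmull// expn_gt0.
  have D2 : (2 ^ k.+1 * N)%N = (2 * M)%N by rewrite expnS -mulnA.
  pose Q := blk M.+1 (2 * M).+1.
  have MD : (M.+1 <= (2 * M).+1)%N by rewrite ltnS leq_pmull.
  have -> : E k.+1 - E k = err Q.
    rewrite /E D2 -/M.
    have -> : blk 0%N (2 * M).+1 = blk 0%N M.+1 + Q.
      by rewrite /blk (@big_cat_nat _ _ _ M.+1).
    by rewrite errD addrAC subrr add0r.
  have M0 : 0 < M%:R :> R by rewrite ltr0n.
  have uq : uniq (index_iota M.+1 (2 * M).+1) by exact: iota_uniq.
  have rM : {in index_iota M.+1 (2 * M).+1, forall n, (M < n)%N}.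
    by move=> n; rewrite mem_index_iota => /andP[].
  have rD : {in index_iota M.+1 (2 * M).+1, forall n, (n <= 2 * M)%N}.
    by move=> n; rewrite mem_index_iota => /andP[].
  have D1 : (1 <= 2 * M)%N by rewrite muln_gt0.
  have mM : (m <= M.+1)%N by rewrite (leq_trans mN).
  have n2 := @block_norm _ c M m uq m1 mM M1 rM Q erefl.
  have n3 := sub_norm M.+1 (2 * M).+1 MD.
  have {}n3 : Lw (a + m%:R) (b + m%:R) (Q^`(m) ^+ 2) <= W2.
    apply: n3; rewrite ltnS -D2 leq_mul2r leq_exp2l// kS orbT//.
  have g1 := @Lw_gal_poly _ c (2 * M)%N uq rD D1 Q erefl.
  have ND : N%:R <= (2 * M)%:R :> R by rewrite ler_nat (leq_trans NM)// leq_pmull.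
  have D1' : 1%:R <= (2 * M)%:R :> R by rewrite ler_nat.
  have Q0 : 0 <= nrm Q by exact: Lw_sqr_ge0.
  have D0 : 0 < (2 * M)%:R :> R by rewrite ltr0n.
  have s1 : Q.[x] ^+ 2 <= 16 * (2 * M)%:R * nrm Q.
    by apply: (le_trans (nikolskii Q (leqnn 1) D1' x01)); move: g1; lra.
  pose I := lagi z (fun j => Q.[z j]).
  have s2 : nrm I <= C / N%:R * (4 * (2 * M)%:R * nrm Q).
    rewrite /I Lw_lagi_sqr//; apply: (le_trans (HC N z zi z01 orth N1 _ Q ND)).
    by rewrite ler_wpM2l// divr_ge0// ltW.
  (* The interpolant has degree at most N: its sup norm costs N instead of M, which cancels the 1 /
     N of [s2]. *)
  have s3 : I.[x] ^+ 2 <= 16 * N%:R * nrm I.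
    have [ci IE] := shifted_jacobi_basis a1 b1 (size_lagi z (fun j => Q.[z j])).
    have uI : uniq (index_iota 0 N.+1) by exact: iota_uniq.
    have rI : {in index_iota 0 N.+1, forall n, (n <= N)%N}.
      by move=> n; rewrite mem_index_iota => /andP[].
    have IE' : I = \sum_(n <- index_iota 0 N.+1) ci n *: y_ n by rewrite big_mkord.
    have gI := @Lw_gal_poly _ ci N uI rI N1 I IE'.
    have N1' : 1%:R <= N%:R :> R by rewrite ler_nat.
    by apply: (le_trans (nikolskii I (leqnn 1) N1' x01)); move: gI; lra.
  have s4 : I.[x] ^+ 2 <= 64 * C * (2 * M)%:R * nrm Q.
    apply: (le_trans s3).
    apply: (@le_trans _ _ (16 * N%:R * (C / N%:R * (4 * (2 * M)%:R * nrm Q)))).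
      by rewrite ler_wpM2l// mulr_ge0.
    by rewrite le_eqVlt; apply/orP; left; apply/eqP; field; rewrite gt_eqF.
  have s5 : err Q ^+ 2 <= 2 * (16 + 64 * C) * ((2 * M)%:R * nrm Q).
    have : 0 <= (Q.[x] + I.[x]) ^+ 2 by rewrite sqr_ge0.
    by rewrite /err -/I; lra.
  have s6 : (2 * M)%:R * nrm Q <= 2 * (2 * m%:R) ^+ m * (M%:R / (M%:R ^+ m) ^+ 2) * W2.
    rewrite natrM; apply: (@le_trans _ _ (2 * M%:R * ((2 * m%:R) ^+ m / (M%:R ^+ m) ^+ 2 * W2))).
      apply: ler_wpM2l; first by rewrite mulr_ge0.
      by apply: (le_trans n2); apply: ler_wpM2l; [nonneg|exact: n3].
    rewrite le_eqVlt; apply/orP; left; apply/eqP; field.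
    by rewrite gt_eqF// exprn_gt0.
  (* Here m >= 1 yields the decay: 2^k / 4^(k m) is at most 2^(-k). *)
  have s7 : M%:R / (M%:R ^+ m) ^+ 2 <= N%:R / (N%:R ^+ m) ^+ 2 * 2 ^- k :> R.
    have k2 : 0 < 2 ^+ k :> R by rewrite exprn_gt0.
    have ME : M%:R = 2 ^+ k * N%:R :> R by rewrite /M natrM natrX.
    have -> : M%:R / (M%:R ^+ m) ^+ 2 = N%:R / (N%:R ^+ m) ^+ 2 * (2 ^+ k / (2 ^+ k ^+ m) ^+ 2) :> R.
      by rewrite ME !exprMn; field; rewrite !gt_eqF// !exprn_gt0.
    apply: ler_wpM2l; first by rewrite divr_ge0// exprn_ge0// exprn_ge0.
    rewrite ler_pdivrMr ?exprn_gt0// ler_pdivlMl//.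
    rewrite -expr2; apply: lerXn2r; rewrite ?nnegrE ?exprn_ge0//.
    by rewrite -{1}(expr1 (2 ^+ k)); apply: ler_weXn2l => //; rewrite exprn_ege1// ler1n.
  apply: (le_trans s5).
  apply: (@le_trans _ _ (2 * (16 + 64 * C) * (2 * (2 * m%:R) ^+ m * (N%:R / (N%:R ^+ m) ^+ 2 * 2 ^- k) * W2))).
    apply: ler_wpM2l; first by rewrite mulr_ge0// addr_ge0// mulr_ge0// ltW.
    apply: (le_trans s6); apply: ler_wpM2r; first exact: W20.
    by apply: ler_wpM2l; [nonneg|exact: s7].
  by rewrite A2 /K1 le_eqVlt; apply/orP; left; apply/eqP; ring.
(* [2 ^ 0 * N] is N, so the first partial sum is reproduced exactly. *)
have E0 : E 0%N = 0.
  apply: errlow; rewrite expn0 mul1n /blk (leq_trans (size_sum _ _ _))//.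
  rewrite big_seq; apply/bigmax_leqP_seq => n; rewrite mem_index_iota => /andP[_ nN] _.
  by rewrite (leq_trans (size_scale_leq _ _))// size_shifted_jacobi.
have -> : u.[x] - (lagi z (fun j => u.[z j])).[x] = Ek S by rewrite /Ek leqnn /E -uE'.
have A0 : 0 <= A by exact: sqrtr_ge0.
apply: (@le_trans _ _ (4 * A)).
  apply: geometric_34 => //; first by rewrite /Ek leq0n E0 normr0.
  move=> k; rewrite /Ek; have [kS|Sk] := ltnP k S; first by rewrite (ltnW kS) step.
  have -> : (if (k <= S)%N then E k else E S) = E S.
    by case: ifPn => // kS; congr E; apply/eqP; rewrite eqn_leq kS.
  by rewrite subrr expr0n /= mulr_ge0 ?sqr_ge0// invr_ge0 exprn_ge0.
rewrite -!mulrA ler_pM2l// le_eqVlt; apply/orP; left; apply/eqP.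
rewrite /A -mulrA sqrtrM ?(ltW K10)//; congr (_ * _).
rewrite sqrtrM; last by rewrite divr_ge0// sqr_ge0.
congr (_ * _); rewrite powRB ?(gt_eqF N0) ?implybT// powR12_sqrt// powR_mulrn//.
by rewrite sqrtrM// sqrtrV ?sqr_ge0// sqrtr_sqr ger0_norm// exprn_ge0.
Qed.

End sampling.

(** * Density of polynomials *)

Section bernstein.
Variable R : realType.
Implicit Types (p q : nat -> R) (x y c : R) (n k : nat).

(* The Bernstein operator, by the recursion on n that comes from Pascal's rule:
   evaluated at x it is the mean of [p] over a binomial(n, x) law. *)
Fixpoint bern n p : {poly R} :=
  match n with
  | 0%N => (p 0%N)%:P
  | n'.+1 => 'X * bern n' (fun k => p k.+1) + (1 - 'X) * bern n' p
  end.

Lemma bernSE n p x : (bern n.+1 p).[x] =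
  x * (bern n (fun k => p k.+1)).[x] + (1 - x) * (bern n p).[x].
Proof. by rewrite /= hornerD !hornerM hornerD hornerN hornerX hornerC. Qed.

Lemma bern_le n p q x : 0 <= x <= 1 -> (forall k, (k <= n)%N -> p k <= q k) ->
  (bern n p).[x] <= (bern n q).[x].
Proof.
move=> /andP[x0 x1]; elim: n p q => [|n IH] p q pq; first by rewrite !hornerC pq.
rewrite !bernSE; apply: lerD; apply: ler_wpM2l; rewrite ?subr_ge0//; apply: IH => k kn.
  exact: pq.
by apply: pq; rewrite leqW.
Qed.

Lemma bernD n p q x : (bern n (fun k => p k + q k)).[x] = (bern n p).[x] + (bern n q).[x].
Proof.
elim: n p q => [|n IH] p q; first by rewrite !hornerC.
by rewrite !bernSE (IH (fun k => p k.+1) (fun k => q k.+1)) IH; ring.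
Qed.

Lemma bernZ n c p x : (bern n (fun k => c * p k)).[x] = c * (bern n p).[x].
Proof.
elim: n p => [|n IH] p; first by rewrite !hornerC.
by rewrite !bernSE (IH (fun k => p k.+1)) IH; ring.
Qed.

Lemma bern_cst n c x : (bern n (fun=> c)).[x] = c.
Proof. by elim: n => [|n IH]; rewrite ?hornerC// bernSE IH; ring. Qed.

(** The centre is arbitrary because the recursion shifts it from c to c - 1. *)
Lemma bern_variance n c x : (bern n (fun k => (k%:R - c) ^+ 2)).[x] =
  n%:R * (x * (1 - x)) + (n%:R * x - c) ^+ 2.
Proof.
elim: n c => [|n IH] c; first by rewrite hornerC; ring.
rewrite bernSE IH.
have -> : (fun k => (k.+1%:R - c) ^+ 2) = (fun k => (k%:R - (c - 1)) ^+ 2 : R).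
  by apply/funext => k; rewrite -natr1; congr (_ ^+ 2); ring.
by rewrite IH -natr1; ring.
Qed.

Lemma bern_bounded n p x (K : R) : 0 <= x <= 1 -> (forall k, (k <= n)%N -> `|p k| <= K) ->
  `|(bern n p).[x]| <= K.
Proof.
move=> x01 pK; rewrite ler_norml -{1}(bern_cst n (- K) x) -{2}(bern_cst n K x).
by apply/andP; split; apply: bern_le => // k /pK; rewrite ler_norml => /andP[].
Qed.

(** Chebyshev's argument: |f y - f x| is at most e / 2 + c (y - x)^2, by continuity near x and by
    boundedness elsewhere, and the variance x (1 - x) / n tends to 0. *)
Lemma bern_cvg (f : R -> R) (K x : R) : 0 < x < 1 -> {for x, continuous f} ->
  (forall y, `|f y| <= K) ->
  (bern n (fun k => f (k%:R / n%:R))).[x] @[n --> \oo] --> f x.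
Proof.
move=> x01 cf fK; have /andP[x0 x1] := x01.
have K0 : 0 <= K by apply: le_trans (fK 0).
have x01' : 0 <= x <= 1 by rewrite !ltW.
apply/cvgrPdist_le => e e0.
have e20 : 0 < e / 2 by rewrite divr_gt0.
have /cvgrPdist_le/(_ _ e20) := cf.
move=> /nbhs_ballP[/= d d0 hd].
pose c := 2 * K / d ^+ 2.
have c0 : 0 <= c by rewrite /c; nonneg.
have bnd y : `|f y - f x| <= e / 2 + c * (y - x) ^+ 2.
  have [yx|yx] := ltP `|x - y| d.
    by rewrite distrC (le_trans (hd y yx))// lerDl mulr_ge0// sqr_ge0.
  rewrite (@le_trans _ _ (2 * K))//.
    by rewrite (le_trans (ler_normB _ _))// mulr_natl mulr2n lerD.
  apply: (@le_trans _ _ (c * d ^+ 2)); first by rewrite /c divfK// expf_neq0// gt_eqF.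
  apply: (@le_trans _ _ (c * (y - x) ^+ 2)); last by rewrite lerDr ltW.
  apply: ler_wpM2l => //; rewrite -(real_normK (num_real (y - x))).
  by apply: lerXn2r; rewrite ?nnegrE ?(ltW d0)// distrC.
near=> n.
have n0 : 0 < n%:R :> R by rewrite ltr0n; near: n; exact: nbhs_infty_gt.
have -> : f x - (bern n (fun k => f (k%:R / n%:R))).[x] =
    - (bern n (fun k => f (k%:R / n%:R) + - f x)).[x].
  by rewrite bernD bern_cst opprD opprK addrC.
rewrite normrN.
have h2 : (bern n (fun k => e / 2 + c / n%:R ^+ 2 * (k%:R - n%:R * x) ^+ 2)).[x] <= e.
  rewrite bernD bern_cst bernZ bern_variance subrr expr0n/= addr0.
  have -> : c / n%:R ^+ 2 * (n%:R * (x * (1 - x))) = c * (x * (1 - x)) / n%:R.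
    by field; rewrite gt_eqF.
  rewrite [leRHS](splitr e) lerD2l ler_pdivrMr//.
  rewrite -ler_pdivrMl// mulrC; near: n; exact: nbhs_infty_ger.
apply: le_trans h2; rewrite ler_norml; apply/andP; split.
  rewrite -mulN1r -bernZ; apply: bern_le => // k kn; rewrite mulN1r.
  have := bnd (k%:R / n%:R); rewrite ler_norml => /andP[+ _].
  apply: le_trans; rewrite lerN2 lerD2l le_eqVlt; apply/orP; left; apply/eqP.
  by field; rewrite gt_eqF.
apply: bern_le => // k kn.
apply: (le_trans (ler_norm _)); apply: (le_trans (bnd _)).
rewrite lerD2l le_eqVlt; apply/orP; left; apply/eqP.
by field; rewrite gt_eqF.
Unshelve. all: by end_near. Qed.

End bernstein.

Section density.
Variable R : realType.
Local Notation mu := (@lebesgue_measure R).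
Variable w : R -> R.
Hypothesis mw : measurable_fun (@unitIo R) w.
Hypothesis w01 : forall x, 0 < x < 1 -> 0 <= w x <= 1.

Local Notation I := (@unitIo R).
Let mI : (@measurable _ (measurableTypeR R) I).
Proof. exact: measurable_itv. Qed.

Definition sqdist (f g : R -> R) : \bar R :=
  (\int[mu]_(x in @unitIo R) ((f x - g x) ^+ 2 * w x)%:E)%E.

Lemma lebesgue_unitIo : mu I = 1%E.
Proof. by rewrite /I /unitIo lebesgue_measure_itv/= lte_fin ltr01 oppr0 adde0. Qed.

Lemma measurable_sq (f g : R -> R) : measurable_fun I f -> measurable_fun I g ->
  measurable_fun I (fun x => ((f x - g x) ^+ 2 * w x)%:E).
Proof.
move=> mf mg; apply/measurable_EFinP; apply: measurable_funM => //.
by apply: measurable_funX; exact: measurable_funB.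
Qed.

Lemma sqdist_triangle (f g h k : R -> R) :
  measurable_fun I f -> measurable_fun I g -> measurable_fun I h ->
  measurable_fun I k ->
  (sqdist f k <= 3%:E * (sqdist f g + sqdist g h + sqdist h k))%E.
Proof.
move=> mf mg mh mk.
have sq0 (u v : R -> R) x : I x -> (0 <= ((u x - v x) ^+ 2 * w x)%:E)%E.
  by move=> /unitIoP/w01/andP[w0 _]; rewrite lee_fin mulr_ge0// sqr_ge0.
have mfg := measurable_sq mf mg; have mgh := measurable_sq mg mh.
have mhk := measurable_sq mh mk.
rewrite /sqdist -ge0_integralD//; [|exact: sq0..].
rewrite -ge0_integralD//; last 3 first.
- by move=> x Ix; rewrite adde_ge0// sq0.
- exact: emeasurable_funD.
- exact: sq0.
rewrite -ge0_integralZl//; last 2 first.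
- by apply: emeasurable_funD => //; exact: emeasurable_funD.
- by move=> x Ix; rewrite !adde_ge0// sq0.
apply: ge0_le_integral => //.
- exact: sq0.
- exact: measurable_sq.
- apply: measurable_funeM; apply: emeasurable_funD => //; exact: emeasurable_funD.
- move=> x Ix; rewrite -!EFinD -EFinM lee_fin -!mulrDl mulrA.
  move/unitIoP: Ix => /w01/andP[w0 _]; apply: ler_wpM2r => //.
  have := sqr_ge0 ((f x - g x) - (g x - h x)).
  have := sqr_ge0 ((g x - h x) - (h x - k x)).
  have := sqr_ge0 ((f x - g x) - (h x - k x)); lra.
Qed.

(* The truncation of t to [-K, K], in a form whose continuity is immediate. *)
Definition clip (K t : R) : R := (`|t + K| - `|t - K|) / 2.

Lemma clip_norm (K t : R) : 0 <= K -> `|clip K t| <= K.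
Proof.
move=> K0; rewrite /clip normrM (ger0_norm (_ : 0 <= 2^-1))// ler_pdivrMr//.
apply: (le_trans (ler_dist_dist _ _)).
by rewrite (_ : t + K - (t - K) = K * 2) ?ger0_norm ?mulr_ge0//; ring.
Qed.

Lemma clip_id (K t : R) : `|t| <= K -> clip K t = t.
Proof.
rewrite ler_norml => /andP[h1 h2]; rewrite /clip ger0_norm; last by lra.
by rewrite ler0_norm; [field|lra].
Qed.

Lemma clip_dist (K t s : R) : `|s| <= K -> `|s - clip K t| <= `|s - t|.
Proof.
rewrite ler_norml => /andP[s1 s2]; rewrite /clip.
have := ler_norm (s - t); have := ler_norm (- (s - t)); rewrite normrN ler_norml.
by have [?|?] := ler0P (t + K); have [?|?] := ler0P (t - K) => ? ?; apply/andP; split; lra.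
Qed.

Lemma clip_dist_id (K t : R) : 0 <= K -> `|t - clip K t| <= `|t|.
Proof.
move=> K0; rewrite /clip.
have := ler_norm t; have := ler_norm (- t); rewrite normrN ler_norml.
by have [?|?] := ler0P (t + K); have [?|?] := ler0P (t - K) => ? ?; apply/andP; split; lra.
Qed.

Lemma continuous_clip K : continuous (clip K).
Proof.
move=> t; apply: cvgM; last exact: cvg_cst.
by apply: cvgB; apply: cvg_norm; [apply: cvgD|apply: cvgB] => //; exact: cvg_cst.
Qed.

Lemma measurable_clip K (f : R -> R) : measurable_fun I f ->
  measurable_fun I (fun x => clip K (f x)).
Proof.
move=> mf; apply: measurableT_comp => //.
by apply: continuous_measurable_fun; exact: continuous_clip.
Qed.

Lemma truncation_dense (g : R -> R) (e : R) : 0 < e -> measurable_fun I g ->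
  (sqdist g (fun=> 0%R) < +oo)%E ->
  exists2 K : R, 0 <= K & (sqdist g (fun x => clip K (g x)) < e%:E)%E.
Proof.
move=> e0 mg gfin.
have igg : mu.-integrable I (fun x => ((g x - 0) ^+ 2 * w x)%:E).
  apply/integrableP; split; first by apply: measurable_sq => //; exact: measurable_cst.
  apply: le_lt_trans gfin; apply: ge0_le_integral => //.
  - by apply: measurableT_comp => //; apply: measurable_sq => //; exact: measurable_cst.
  - by apply: measurable_sq => //; exact: measurable_cst.
  - move=> x /unitIoP/w01/andP[w0 _].
    by rewrite gee0_abs// lee_fin mulr_ge0// sqr_ge0.
have [] := @dominated_convergence _ _ R mu I mI
  (fun n x => ((g x - clip n%:R (g x)) ^+ 2 * w x)%:E) (fun=> 0%E) _ _ _ _ igg _.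
- by move=> n; apply: measurable_sq => //; exact: measurable_clip.
- exact: measurable_cst.
- apply: aeW => x Ix; apply: cvg_near_cst; near=> n.
  rewrite clip_id ?subrr ?expr0n ?mul0r//.
  by near: n; exact: nbhs_infty_ger.
- apply: aeW => x n /unitIoP/w01/andP[w0 _].
  rewrite /= lee_fin ger0_norm ?(mulr_ge0 (sqr_ge0 _) w0)//; apply: ler_wpM2r => //.
  by rewrite subr0; apply: ler_sqr_norm; exact: clip_dist_id.
move=> _ _; rewrite integral0 => /fine_cvgP[hfin] /cvgrPdist_lt/(_ _ e0) h.
have [n [/= nfin ne]] := filter_ex (filterI hfin h).
exists n%:R => //; rewrite /sqdist -(fineK nfin) lte_fin.
by move: ne; rewrite sub0r normrN; exact: le_lt_trans (ler_norm _).
Unshelve. all: by end_near. Qed.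

Lemma bounded_integrable (f : R -> R) (K : R) : measurable_fun I f ->
  (forall x, 0 < x < 1 -> `|f x| <= K) -> mu.-integrable I (EFin \o f).
Proof.
move=> mf fK; apply: measurable_bounded_integrable => //.
  by rewrite [X in (X < _)%E]lebesgue_unitIo ltry.
exists K; split; first exact: num_real.
by move=> z Kz x /= /unitIoP x01; rewrite (le_trans (fK _ x01))// ltW.
Qed.

(** Reduces weighted L2 to L1: between functions bounded by [K] the square is at most a constant
    times the distance. The L1 approximant may be unbounded; clipping it does not move it away from
    [f]. *)
Lemma continuous_dense (f : R -> R) (K e : R) : 0 < e -> 0 <= K ->
  measurable_fun I f -> (forall x, 0 < x < 1 -> `|f x| <= K) ->
  exists h : R -> R, [/\ continuous h, forall x, `|h x| <= K &
    (sqdist f h < e%:E)%E].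
Proof.
move=> e0 K0 mf fK.
have Ifin : (mu I < +oo)%E by rewrite [X in (X < _)%E]lebesgue_unitIo ltry.
have [g_ [cg ig]] := approximation_continuous_integrable mI Ifin (bounded_integrable mf fK).
(* 2 K bounds the difference; the added 1 keeps [c] positive when K = 0. *)
pose c := 2 * K + 1.
have c0 : 0 < c by rewrite /c; lra.
have ec : 0 < e / c by rewrite divr_gt0.
move=> /fine_cvgP[hfin] /cvgrPdist_lt/(_ _ ec) hn.
have [n [nfin ne]] := filter_ex (filterI hfin hn).
have mg : measurable_fun I (g_ n) by have /integrableP[/measurable_EFinP] := ig n.
exists (fun x => clip K (g_ n x)); split.
- move=> x; apply: (@continuous_comp _ _ _ (g_ n) (clip K)); first exact: cg.
  exact: continuous_clip.
- by move=> x; exact: clip_norm.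
apply: (@le_lt_trans _ _ (\int[mu]_(x in I) (c%:E * `|(f x - g_ n x)%:E|))%E).
  apply: ge0_le_integral => //.
  - by move=> x /unitIoP/w01/andP[w0 _]; rewrite lee_fin mulr_ge0// sqr_ge0.
  - by apply: measurable_sq => //; exact: measurable_clip.
  - apply: measurable_funeM; apply: measurableT_comp => //.
    by apply/measurable_EFinP; exact: measurable_funB.
  - move=> x /unitIoP x01; have /andP[w0 w1] := w01 x01.
    rewrite -EFinM lee_fin.
    have d1 := clip_dist (g_ n x) (fK x x01).
    have d2 := clip_norm (g_ n x) K0; have d3 := fK x x01.
    set d := f x - clip K _ in d1 *.
    have d4 : `|d| <= c.
      by rewrite /d (le_trans (ler_normB _ _))// /c; lra.
    rewrite -(real_normK (num_real d)) expr2.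
    apply: (@le_trans _ _ (`|d| * `|d|)); first by rewrite ler_piMr// mulr_ge0.
    exact: ler_pM.
rewrite ge0_integralZl//; last 2 first.
- by apply: measurableT_comp => //; apply/measurable_EFinP; exact: measurable_funB.
- by rewrite lee_fin ltW.
rewrite -(fineK nfin) -EFinM lte_fin -ltr_pdivlMl// mulrC.
by move: ne; rewrite sub0r normrN; exact: le_lt_trans (ler_norm _).
Qed.

Lemma measurable_unitIo_continuous (h : R -> R) : continuous h -> measurable_fun I h.
Proof. by move=> ch; apply: continuous_measurable_oo => x _; exact: ch. Qed.

(** Pointwise convergence of the Bernstein polynomials suffices, by dominated convergence. *)
Lemma bern_dense (h : R -> R) (K e : R) : 0 < e ->
  continuous h -> (forall x, `|h x| <= K) ->
  exists q : {poly R}, (sqdist h (horner q) < e%:E)%E.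
Proof.
move=> e0 ch hK.
have mh := measurable_unitIo_continuous ch.
have mp (q : {poly R}) : measurable_fun I (horner q).
  by apply: measurable_unitIo_continuous => x; exact: continuous_horner_at.
have icst : mu.-integrable I (EFin \o cst ((2 * K) ^+ 2)).
  by apply: (@bounded_integrable _ `|(2 * K) ^+ 2|); first exact: measurable_cst.
pose q n : {poly R} := bern n (fun k => h (k%:R / n%:R)).
have [] := @dominated_convergence _ _ R mu I mI
  (fun n x => ((h x - (q n).[x]) ^+ 2 * w x)%:E) (fun=> 0%E) _ _ _ _ icst _.
- by move=> n; apply: measurable_sq.
- exact: measurable_cst.
- apply: aeW => x /unitIoP x01; apply: cvg_EFin; first exact: nearW.
  have -> : (0 : R) = (h x - h x) ^+ 2 * w x by rewrite subrr expr0n mul0r.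
  apply: cvgM; last exact: cvg_cst.
  have hb : h x - (q n).[x] @[n --> \oo] --> h x - h x.
    by apply: cvgB; [exact: cvg_cst|exact: (bern_cvg x01 (ch x) hK)].
  by rewrite expr2; apply: cvgM.
- apply: aeW => x n /unitIoP x01; have /andP[w0 w1] := w01 x01.
  rewrite /= lee_fin ger0_norm ?(mulr_ge0 (sqr_ge0 _) w0)//.
  apply: (@le_trans _ _ ((h x - (q n).[x]) ^+ 2)); first by rewrite ler_piMr ?sqr_ge0.
  apply: ler_sqr_norm; rewrite (le_trans (ler_normB _ _))//.
  apply: le_trans (ler_norm _); rewrite mulr_natl mulr2n; apply: lerD => //.
  by apply: bern_bounded => //; move/andP: x01 => [? ?]; rewrite !ltW.
move=> _ _; rewrite integral0 => /fine_cvgP[hfin] /cvgrPdist_lt/(_ _ e0) hh.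
have [n [/= nfin ne]] := filter_ex (filterI hfin hh).
exists (q n); rewrite /sqdist -(fineK nfin) lte_fin.
by move: ne; rewrite sub0r normrN; exact: le_lt_trans (ler_norm _).
Qed.

Lemma poly_dense (g : R -> R) (e : R) : 0 < e -> measurable_fun I g ->
  (sqdist g (fun=> 0%R) < +oo)%E ->
  exists q : {poly R}, (sqdist g (horner q) < e%:E)%E.
Proof.
(* Three approximations, times the constant 3 of [sqdist_triangle]. *)
move=> e0 mg gfin; have e9 : 0 < e / 9 by rewrite divr_gt0.
have [K K0 h1] := truncation_dense e9 mg gfin.
have mc := measurable_clip K mg.
have [|h [ch hK h2]] := continuous_dense e9 K0 mc.
  by move=> x _; exact: clip_norm.
have [q h3] := bern_dense e9 ch hK.
exists q; apply: (le_lt_trans (sqdist_triangle mg mc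
  (measurable_unitIo_continuous ch) _)).
  by apply: measurable_unitIo_continuous => x; exact: continuous_horner_at.
have -> : e%:E = (3%:E * ((e / 9)%:E + (e / 9)%:E + (e / 9)%:E))%E.
  by rewrite -!EFinD -EFinM; congr (_%:E); field.
by rewrite lte_pmul2l ?lte_fin// lteD// lteD.
Qed.

End density.

(** * Test functions *)

Section smooth.
Variable R : realType.
Implicit Types (f g : R -> R) (P : {poly R}) (a b c d t x y : R).

(** The polynomial factor makes the family stable under differentiation: [P] becomes X^2 (P -
    P'). *)
Definition flat P t : R := if 0 < t then P.[t^-1] * expR (- t^-1) else 0.

(** With s = 1 / t and n = [size P], exp s >= s^(n+2) / (n+2)! beats the growth s^n of [P] by s^2. A
    quadratic bound is what gives the zero derivative at 0. *)
Lemma flat_le P : exists2 C : R, 0 <= C & forall t, `|t| <= 1 -> `|flat P t| <= C * t ^+ 2.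
Proof.
pose n := size P; pose S : R := \sum_(i < n) `|P`_i|.
have S0 : 0 <= S by apply: sumr_ge0.
exists (S * n.+2`!%:R); first by rewrite mulr_ge0.
move=> t t1; rewrite /flat; have [t0|_] := ltP 0 t; last first.
  by rewrite normr0; nonneg.
rewrite (gtr0_norm t0) in t1.
pose s := t^-1; have s1 : 1 <= s by rewrite /s invf_ge1.
have s0 : 0 < s by rewrite invr_gt0.
have PS : `|P.[s]| <= S * s ^+ n.
  rewrite horner_coef (le_trans (ler_norm_sum _ _ _))// /S mulr_suml.
  apply: ler_sum => i _; rewrite normrM ler_wpM2l// normrX (ger0_norm (ltW s0)).
  by rewrite ler_weXn2l// ltnW.
have F0 : 0 < n.+2`!%:R :> R by rewrite ltr0n fact_gt0.
have es : expR (- s) <= n.+2`!%:R / s ^+ n.+2.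
  rewrite expRN -[leRHS]invrK lef_pV2 ?posrE ?expR_gt0 ?invr_gt0 ?divr_gt0 ?exprn_gt0//.
  rewrite invf_div (le_trans _ (expR_ge1Dxn n.+1 (ltW s0)))//.
  by rewrite lerDr.
rewrite normrM (ger0_norm (expR_ge0 _)).
apply: (@le_trans _ _ (S * s ^+ n * (n.+2`!%:R / s ^+ n.+2))).
  by apply: ler_pM => //; exact: expR_ge0.
have -> : t = s^-1 by rewrite invrK.
rewrite le_eqVlt; apply/orP; left; apply/eqP; rewrite !exprS.
by field; rewrite gt_eqF//= gt_eqF// exprn_gt0.
Qed.

Lemma is_derive0_quadratic f C : 0 <= C -> f 0 = 0 ->
  (forall t, `|t| <= 1 -> `|f t| <= C * t ^+ 2) -> is_derive (0 : R) 1 f 0.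
Proof.
move=> C0 f0 fC.
have h : h^-1 *: (f (h *: (1 : R) + 0) - f 0) @[h --> 0^'] --> (0 : R).
  apply/cvgrPdist_le => e e0.
  have d0 : 0 < Num.min 1 (e / (C + 1)).
    by rewrite lt_min ltr01 divr_gt0// ltr_wpDl.
  exists (Num.min 1 (e / (C + 1))) => //= h.
  rewrite /ball_/= sub0r normrN lt_min => /andP[h1 h2] hn0.
  rewrite sub0r normrN f0 subr0 addr0 /GRing.scale/= mulr1 normrM normfV.
  have nh : 0 < `|h| by rewrite normr_gt0.
  rewrite mulrC ler_pdivrMr//.
  apply: (le_trans (fC h (ltW h1))).
  rewrite -(real_normK (num_real h)) expr2 mulrA ler_wpM2r//.
  apply: (@le_trans _ _ ((C + 1) * `|h|)); first by rewrite ler_wpM2r// lerDl.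
  by rewrite mulrC -ler_pdivlMr ?ltW// ltr_wpDl.
split; first by apply/cvg_ex; exists 0.
exact: cvg_lim h.
Qed.

Lemma is_derive_flat P t : is_derive t 1 (flat P) (flat ('X ^+ 2 * (P - P^`())) t).
Proof.
have [t0|t0|->] := ltgtP t 0.
- have -> : flat ('X ^+ 2 * (P - P^`())) t = 0 by rewrite /flat ltNge (ltW t0).
  apply: (@near_eq_is_derive _ _ _ (cst (0 : R)) _ t 1 0 _ (is_derive_cst (0 : R) t 1)).
  near=> u; rewrite /flat/= ltNge.
  have -> // : u <= 0.
  by apply: ltW; near: u; exact: lt_nbhsl.
- have h1 : is_derive t 1 (fun u : R => u^-1) (- t ^- 2 *: 1).
    by apply: is_deriveV; rewrite gt_eqF.
  have h2 := @is_derive1_comp _ (horner P) (fun u : R => u^-1) _ _ _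
    (is_derive_horner P t^-1) h1.
  have h3 : is_derive t 1 (fun u : R => - u^-1) (- (- t ^- 2 *: 1)) by exact: is_deriveN.
  have h4 := @is_derive1_comp _ (@expR R) (fun u : R => - u^-1) _ _ _
    (is_derive_expR (- t^-1)) h3.
  have h5 := is_deriveM h2 h4.
  apply: (@near_eq_is_derive _ _ _ ((horner P \o (fun u : R => u^-1)) *
     (@expR R \o (fun u : R => - u^-1)))).
    near=> u; rewrite /flat/=.
    have -> // : 0 < u by near: u; exact: lt_nbhsr.
  apply: (is_derive_eq h5); rewrite /flat t0 /GRing.scale/= hornerM horner_exp.
  rewrite hornerD hornerN hornerX exprVn; ring.
- have -> : flat ('X ^+ 2 * (P - P^`())) 0 = 0 by rewrite /flat ltxx.
  have [C C0 hC] := flat_le P.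
  by apply: is_derive0_quadratic C0 _ hC; rewrite /flat ltxx.
Unshelve. all: by end_near. Qed.

(* A class of functions closed under differentiation that contains the cut-offs
   needed to test distributional derivatives. *)
Inductive smooth_class : (R -> R) -> Prop :=
| smooth_flat P : smooth_class (flat P)
| smooth_affine c d f : smooth_class f -> smooth_class (fun t => f (c * t + d))
| smooth_cst c : smooth_class (fun=> c)
| smooth_mul f g : smooth_class f -> smooth_class g -> smooth_class (fun t => f t * g t)
| smooth_add f g : smooth_class f -> smooth_class g -> smooth_class (fun t => f t + g t)
| smooth_inv f : smooth_class f -> (forall t, f t != 0) ->
    smooth_class (fun t => (f t)^-1).

Lemma smooth_class_derive f : smooth_class f ->
  exists2 g, smooth_class g & forall t, is_derive t 1 f (g t).
Proof.
elim=> {f} [P|c d f _ [g sg dg]|c|f f' sf [g sg dg] sf' [g' sg' dg']|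
  f f' sf [g sg dg] sf' [g' sg' dg']|f sf [g sg dg] f0].
- by exists (flat ('X ^+ 2 * (P - P^`()))); [exact: smooth_flat|exact: is_derive_flat].
- exists (fun t => c * g (c * t + d)).
    by apply: smooth_mul; [exact: smooth_cst|exact: smooth_affine].
  move=> t; have h : is_derive t 1 (fun u : R => c * u + d) c.
    apply: (is_derive_eq (is_deriveD (is_deriveZ c (is_derive_id t (1 : R)))
      (is_derive_cst (d : R^o) t 1))).
    by rewrite addr0 /GRing.scale/= mulr1.
  have := @is_derive1_comp _ f (fun u : R => c * u + d) _ _ _ (dg (c * t + d)) h.
  by move=> h'; apply: (is_derive_eq h'); rewrite mulrC.
- by exists (fun=> 0); [exact: smooth_cst|move=> t; exact: is_derive_cst].
- exists (fun t => f t * g' t + f' t * g t).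
    by apply: smooth_add; exact: smooth_mul.
  by move=> t; exact: (is_deriveM (dg t) (dg' t)).
- exists (fun t => g t + g' t); first exact: smooth_add.
  by move=> t; exact: is_deriveD.
- exists (fun t => (-1 * ((f t)^-1 * (f t)^-1)) * g t).
    apply: smooth_mul => //; apply: smooth_mul; first exact: smooth_cst.
    by apply: smooth_mul; exact: smooth_inv.
  move=> t; apply: (is_derive_eq (is_deriveV (f0 t) (dg t))).
  by rewrite /GRing.scale/= expr2 invfM mulN1r.
Qed.

Lemma is_derive_derive1 f g : (forall t, is_derive t 1 f (g t)) -> derive1 f = g.
Proof. by move=> dfg; apply/funext => t; rewrite derive1E; case: (dfg t). Qed.

Lemma smooth_class_derivable f : smooth_class f ->
  forall n x, derivable (derive1n n f) x 1.
Proof.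
move=> sf n x.
suff [g sg ->] : exists2 g, smooth_class g & derive1n n f = g.
  by have [g' _ dg'] := smooth_class_derive sg; case: (dg' x).
elim: n => [|n [g sg e]]; first by exists f.
have [g' sg' dg'] := smooth_class_derive sg.
by exists g' => //; rewrite derive1nS e; exact: is_derive_derive1.
Qed.

(** The usual smooth transition from 0 to 1; 1 - t is spelled [-1 * t + 1] to match
    [smooth_affine]. *)
Definition step t : R := flat 1 t * (flat 1 t + flat 1 (-1 * t + 1))^-1.

Lemma flat1_ge0 t : 0 <= flat 1 t.
Proof. by rewrite /flat; case: ifP => // _; rewrite hornerC mul1r expR_ge0. Qed.

Lemma flat1_gt0 t : 0 < t -> 0 < flat 1 t.
Proof. by move=> t0; rewrite /flat t0 hornerC mul1r expR_gt0. Qed.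

Lemma step_den_gt0 t : 0 < flat 1 t + flat 1 (-1 * t + 1).
Proof.
have [t0|t0] := ltP 0 t; first by rewrite ltr_pwDl ?flat1_gt0// flat1_ge0.
by rewrite ltr_wpDl ?flat1_ge0// flat1_gt0// mulN1r; lra.
Qed.

Lemma smooth_step : smooth_class step.
Proof.
apply: smooth_mul; first exact: smooth_flat.
apply: smooth_inv; last by move=> t; rewrite gt_eqF// step_den_gt0.
by apply: smooth_add; [exact: smooth_flat|exact: smooth_affine (smooth_flat _)].
Qed.

Lemma step_le0 t : t <= 0 -> step t = 0.
Proof. by move=> t0; rewrite /step {1}/flat ltNge t0 mul0r. Qed.

Lemma step_ge1 t : 1 <= t -> step t = 1.
Proof.
move=> t1; rewrite /step {3}/flat ltNge (_ : -1 * t + 1 <= 0) ?addr0; last by lra.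
by rewrite mulfV// gt_eqF// flat1_gt0// (lt_le_trans _ t1).
Qed.

Lemma step01 t : 0 <= step t <= 1.
Proof.
have d0 := step_den_gt0 t; rewrite /step.
rewrite mulr_ge0 ?flat1_ge0 ?invr_ge0 ?(ltW d0)//=.
by rewrite ler_pdivrMr// mul1r lerDl flat1_ge0.
Qed.

Definition dstep := sval (cid2 (smooth_class_derive smooth_step)).

Lemma smooth_dstep : smooth_class dstep.
Proof. by rewrite /dstep; case: cid2. Qed.

Lemma is_derive_step t : is_derive t 1 step (dstep t).
Proof. by rewrite /dstep; case: cid2. Qed.

Lemma smooth_continuous f : smooth_class f -> continuous f.
Proof.
move=> sf x; have [g _ dg] := smooth_class_derive sf.
exact: is_derive_continuous (dg x).
Qed.

Lemma dstep_out t : t <= 0 \/ 1 <= t -> dstep t = 0.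
Proof.
have h c (u : R) : (\forall v \near u, step v = c) -> dstep u = 0.
  move=> hu; have := is_derive_step u => -[_ <-].
  by rewrite (near_eq_derive _ hu) derive_cst.
have lt0 (u : R) : u < 0 -> dstep u = 0.
  by move=> u0; apply: (h 0); near=> v; apply: step_le0; apply: ltW; near: v; exact: lt_nbhsl.
have gt1 (u : R) : 1 < u -> dstep u = 0.
  move=> u1; apply: (h 1); near=> v; apply: step_ge1; apply: ltW; near: v.
  exact: lt_nbhsr.
(* At 0 and 1 themselves [step] is not locally constant; there the value follows by continuity from
   the outer side. *)
have cd := smooth_continuous smooth_dstep.
case.
  rewrite le_eqVlt => /predU1P[->|/lt0//].
  have h0 : dstep u @[u --> 0^'-] --> dstep 0 by apply: cvg_at_left_continuous; exact: cd.
  have h1 : dstep u @[u --> 0^'-] --> (0 : R).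
    apply: cvg_near_cst; near=> u; apply: lt0; near: u; exact: nbhs_left_lt.
  exact: (cvg_unique _ h0 h1).
rewrite le_eqVlt => /predU1P[<-|/gt1//].
have h0 : dstep u @[u --> 1^'+] --> dstep 1 by apply: cvg_at_right_continuous; exact: cd.
have h1 : dstep u @[u --> 1^'+] --> (0 : R).
  apply: cvg_near_cst; near=> u; apply: gt1; near: u; exact: nbhs_right_gt.
exact: (cvg_unique _ h0 h1).
Unshelve. all: by end_near. Qed.

Lemma dstep_bounded : exists2 C, 0 < C & forall t, `|dstep t| <= C.
Proof.
have cd : {within `[0, 1], continuous (fun t => `|dstep t|)}.
  apply: continuous_subspaceT => t; apply: cvg_norm.
  exact: smooth_continuous smooth_dstep t.
have [c _ hc] := EVT_max ler01 cd.
exists (`|dstep c| + 1); first by rewrite ltr_wpDl.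
move=> t; apply: (@le_trans _ _ (`|dstep c|)); last by rewrite lerDl.
have [t0|t0] := leP 0 t; last by rewrite dstep_out ?normr0//; left; exact: ltW.
have [t1|t1] := leP t 1; last by rewrite dstep_out ?normr0//; right; exact: ltW.
by apply: hc; rewrite in_itv/= t0.
Qed.

(* Tends to the indicator function of ]a, b] as r decreases to 0. *)
Definition plateau a b r t : R := step (r^-1 * t - r^-1 * a) - step (r^-1 * t - r^-1 * b).

(** An approximate Dirac mass at [a], supported in [a, a + r]. *)
Definition dplateau a r t : R := r^-1 * dstep (r^-1 * t - r^-1 * a).

Lemma is_derive_step_scaled a r t :
  is_derive t 1 (fun u => step (r^-1 * u - r^-1 * a)) (dplateau a r t).
Proof.
have h : is_derive t 1 (fun u : R => r^-1 * u - r^-1 * a) r^-1.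
  apply: (is_derive_eq (is_deriveB (is_deriveZ r^-1 (is_derive_id t (1 : R)))
    (is_derive_cst (r^-1 * a : R^o) t 1))).
  by rewrite subr0 /GRing.scale/= mulr1.
have h' := @is_derive1_comp _ step (fun u : R => r^-1 * u - r^-1 * a) _ _ _
  (is_derive_step _) h.
by apply: (is_derive_eq h'); rewrite mulrC.
Qed.

Lemma derive1_plateau a b r :
  derive1 (plateau a b r) = (fun t => dplateau a r t - dplateau b r t).
Proof.
apply: is_derive_derive1 => t.
exact: (is_deriveB (is_derive_step_scaled a r t) (is_derive_step_scaled b r t)).
Qed.

Lemma plateau_out a b r t : 0 < r -> a <= b -> ~ (a <= t <= b + r) -> plateau a b r t = 0.
Proof.
move=> r0 ab /negP; rewrite negb_and -!ltNge /plateau -!mulrBr => /orP[ta|tb].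
  have h c : a <= c -> r^-1 * (t - c) <= 0.
    by move=> ac; rewrite pmulr_rle0 ?invr_gt0//; lra.
  by rewrite !step_le0 ?subrr// h.
have h c : c <= b -> 1 <= r^-1 * (t - c).
  by move=> cb; rewrite ler_pdivlMl// mulr1; lra.
by rewrite !step_ge1 ?subrr// h.
Qed.

Lemma test_plateau a b r : 0 < r -> 0 < a -> a <= b -> b + r < 1 ->
  test_function (plateau a b r).
Proof.
move=> r0 a0 ab br; split.
  apply: smooth_class_derivable.
  have e : plateau a b r = (fun t => step (r^-1 * t + - (r^-1 * a)) +
      (-1) * step (r^-1 * t + - (r^-1 * b))).
    by apply/funext => t; rewrite mulN1r.
  rewrite e; apply: smooth_add.
    exact: (smooth_affine _ _ smooth_step).
  apply: smooth_mul; first exact: smooth_cst.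
  exact: (smooth_affine _ _ smooth_step).
by exists a, (b + r); split => // t; exact: plateau_out.
Qed.

Lemma plateau_le1 a b r t : `|plateau a b r t| <= 1.
Proof.
rewrite /plateau ler_norml.
have /andP[h1 h2] := step01 (r^-1 * t - r^-1 * a).
by have /andP[h3 h4] := step01 (r^-1 * t - r^-1 * b); apply/andP; split; lra.
Qed.

Lemma step_scaled_near a t : \forall r \near 0^'+,
  step (r^-1 * t - r^-1 * a) = if a < t then 1 else 0.
Proof.
have [at_|ta] := ltP a t; near=> r; have r0 : 0 < r by near: r; exact: nbhs_right_gt.
  all: rewrite -mulrBr.
  apply: step_ge1; rewrite ler_pdivlMl// mulr1; near: r.
  by apply: nbhs_right_le; rewrite subr_gt0.
by apply: step_le0; rewrite pmulr_rle0 ?invr_gt0// subr_le0.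
Unshelve. all: by end_near. Qed.

End smooth.

(** * Weak derivatives *)

Section weak.
Variable R : realType.
Local Notation mu := (@lebesgue_measure R).
Local Notation I := (@unitIo R).
Implicit Types (f g h phi : R -> R) (a b c d k x y t r : R).

Lemma loc_int_cc h a b : locally_integrable I h -> 0 < a -> b < 1 ->
  mu.-integrable `[a, b] (EFin \o h).
Proof.
move=> [mh _ hfin] a0 b1.
have sub : (`[a, b] : set R) `<=` I.
  by move=> x /=; rewrite in_itv/= => /andP[h1 h2]; apply/unitIoP/andP; split; lra.
apply/integrableP; split.
  by apply/measurable_EFinP; apply: measurable_funS mh => //; exact: measurable_itv.
by apply: hfin => //; exact: segment_compact.
Qed.

Lemma loc_int_oc h a b : locally_integrable I h -> 0 < a -> b < 1 ->
  mu.-integrable `]a, b] (EFin \o h).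
Proof.
move=> lh a0 b1; apply: integrableS (loc_int_cc lh a0 b1) => //.
by apply: subset_itvr; rewrite bnd_simp.
Qed.

Lemma Rintegral_oc_split h a b c : locally_integrable I h ->
  0 < a -> a <= b -> b <= c -> c < 1 ->
  (\int[mu]_(x in `]a, c]) h x =
  \int[mu]_(x in `]a, b]) h x + \int[mu]_(x in `]b, c]) h x)%R.
Proof.
move=> lh a0 ab bc c1.
have := @Rintegral_itvB R h (BRight a) (BRight c) b (loc_int_oc lh a0 c1).
by rewrite !bnd_simp => /(_ ab bc) <-; rewrite addrC subrK.
Qed.

(** Based at the interior point 1/2, since a locally integrable [h] need not be integrable near
    0. *)
Definition prim h x : R :=
  if 2^-1 <= x then (\int[mu]_(t in `]2^-1, x]) h t)%R
  else (- \int[mu]_(t in `]x, 2^-1]) h t)%R.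

Lemma primB h a b : locally_integrable I h -> 0 < a -> a <= b -> b < 1 ->
  prim h b - prim h a = (\int[mu]_(x in `]a, b]) h x)%R.
Proof.
move=> lh a0 ab b1; rewrite /prim.
have [a2|a2] := leP 2^-1 a; have [b2|b2] := leP 2^-1 b.
- rewrite (@Rintegral_oc_split h 2^-1 a b)//; first by rewrite addrAC subrr add0r.
- by exfalso; lra.
- by rewrite opprK addrC -Rintegral_oc_split// ltW.
- rewrite opprK (@Rintegral_oc_split h a b 2^-1)//; [|exact: ltW|lra].
  by rewrite addrC addrK.
Qed.

Lemma cvg_at_right0_seq (r : nat -> R) : (forall n, 0 < r n) ->
  r n @[n --> \oo] --> 0 -> r n @[n --> \oo] --> (0 : R)^'+.
Proof.
move=> r0 rcvg A [e /= e0 eA].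
move/cvgrPdist_lt/(_ _ e0) : rcvg; apply: filterS => n rn.
exact: eA.
Qed.

Lemma cvg_scaled_harmonic c : c / n.+2%:R @[n --> \oo] --> (0 : R).
Proof.
rewrite -[X in _ --> X](mulr0 c); apply: cvgM; first exact: cvg_cst.
have := @cvg_harmonic R; rewrite -(cvg_shiftn 1) /=.
by under eq_fun do rewrite addn1.
Qed.

Lemma integrable_norm_restrict h (a b : R) : locally_integrable I h -> 0 < a -> b < 1 ->
  mu.-integrable I (EFin \o ((Num.norm \o h) \_ `[a, b])).
Proof.
move=> lh a0 b1; rewrite -restrict_EFin; apply/integrable_restrict.
- exact: measurable_itv.
- exact: measurable_itv.
- apply: integrableS (integrable_norm (loc_int_cc lh a0 b1)).
  + exact: measurable_itv.
  + by apply: measurableI; exact: measurable_itv.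
  + exact: subIsetr.
Qed.

Lemma integrable_bounded_mul h phi (a b K : R) : locally_integrable I h ->
  0 < a -> b < 1 -> continuous phi -> (forall t, `|phi t| <= K) ->
  (forall t, ~ (a <= t <= b) -> phi t = 0) ->
  mu.-integrable I (EFin \o (fun t => h t * phi t)).
Proof.
move=> lh a0 b1 cphi phiK phi0.
have [mh _ _] := lh.
have K0 : 0 <= K by apply: le_trans (phiK 0).
have ig : mu.-integrable I (fun t => (K%:E * (EFin \o ((Num.norm \o h) \_ `[a, b])) t)%E).
  apply: integrableZl; first exact: measurable_itv.
  exact: integrable_norm_restrict.
apply: le_integrable ig => //.
- exact: measurable_itv.
- apply/measurable_EFinP; apply: measurable_funM => //.
  by apply: continuous_measurable_oo => x _; exact: cphi.
- move=> t It; rewrite lee_fin.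
  apply: le_trans (ler_norm _); rewrite patchE.
  have [tab|tab] := boolP (a <= t <= b); last first.
    rewrite phi0; last exact/negP.
    by rewrite mulr0 normr0; apply: mulr_ge0 => //; case: ifP => //= _.
  by rewrite mem_set/= ?in_itv//= normrM mulrC ler_wpM2r.
Qed.

(** For fixed t the integrand is eventually h t times the indicator of ]a, b]. The supports all lie
    in [a, b'] with b' < 1, so |h| on that segment dominates. *)
Lemma plateau_integral_cvg h a b (r : nat -> R) : locally_integrable I h ->
  0 < a -> a <= b -> (forall n, 0 < r n) -> (exists2 b', b' < 1 & forall n, b + r n <= b') ->
  r n @[n --> \oo] --> 0 ->
  (\int[mu]_(t in I) (h t * plateau a b (r n) t))%R @[n --> \oo] -->
  (\int[mu]_(t in `]a, b]) h t)%R.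
Proof.
move=> lh a0 ab r0 [b' b'1 hb'] rcvg; have [mh _ _] := lh.
have rr := cvg_at_right0_seq r0 rcvg.
have bb' : b < b' by apply: lt_le_trans (hb' 0%N); rewrite ltrDl.
have b1 : b < 1 by exact: lt_trans b'1.
have ig : mu.-integrable I (EFin \o ((Num.norm \o h) \_ `[a, b'])).
  exact: integrable_norm_restrict.
have cpl n : continuous (plateau a b (r n)).
  have cs c : continuous (fun t => step ((r n)^-1 * t - (r n)^-1 * c)).
    by move=> t; exact: (is_derive_continuous (is_derive_step_scaled c (r n) t)).
  by move=> t; apply: cvgB; exact: cs.
have mf n : measurable_fun I (fun t => h t * plateau a b (r n) t).
  apply: measurable_funM => //.
  by apply: continuous_measurable_oo => x _; exact: cpl.
have Iab : `]a, b] `<=` I.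
  by move=> t /=; rewrite in_itv/= => /andP[h1 h2]; apply/unitIoP/andP; split; lra.
have [] := @dominated_convergence _ _ R mu I (measurable_itv _)
  (fun n t => (h t * plateau a b (r n) t)%:E) (EFin \o (h \_ `]a, b]))
  (EFin \o ((Num.norm \o h) \_ `[a, b'])) _ _ _ ig _.
- by move=> n; apply/measurable_EFinP; exact: mf.
- apply/measurable_EFinP; apply/measurable_restrict; [exact: measurable_itv|exact: measurable_itv|].
  by apply: measurable_funS mh; [exact: measurable_itv|exact: subIsetl].
- apply: aeW => t It; apply: cvg_near_cst.
  have h1 := rr _ (step_scaled_near a t); have h2 := rr _ (step_scaled_near b t).
  near=> n; congr (_%:E); rewrite /plateau patchE.
  have -> : step ((r n)^-1 * t - (r n)^-1 * a) = if a < t then 1 else 0 by near: n.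
  have -> : step ((r n)^-1 * t - (r n)^-1 * b) = if b < t then 1 else 0 by near: n.
  have -> : (t \in (`]a, b]%classic : set R)) = (a < t <= b).
    by apply/idP/idP; rewrite inE/= in_itv.
  case: (ltP b t) => bt; case: (ltP a t) => at_ /=; rewrite ?subrr ?subr0 ?mulr1 ?mulr0//.
  by exfalso; lra.
- apply: aeW => t n It; rewrite /= lee_fin patchE.
  have [tab|tab] := boolP (a <= t <= b'); last first.
    have -> : plateau a b (r n) t = 0.
      apply: plateau_out => // /andP[h1 h2]; move/negP: tab; apply; rewrite h1/=.
      by rewrite (le_trans h2).
    by rewrite mulr0 normr0; case: ifP => //= _.
  by rewrite mem_set/= ?in_itv//= normrM ler_piMr// plateau_le1.
move=> _ _.
have -> : (\int[mu]_(t in I) (EFin \o h \_ `]a, b]) t)%E = (\int[mu]_(t in `]a, b]) (h t)%:E)%E.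
  transitivity (\int[mu]_(t in I `&` `]a, b]) (h t)%:E)%E; last by rewrite setIidr.
  by rewrite integral_mkcondr; apply: eq_integral => t _; rewrite /= !patchE; case: ifP.
rewrite -[X in (_ --> X)%E -> _]fineK; last first.
  by apply: integrable_fin_num (loc_int_oc lh a0 b1).
by move/fine_cvg.
Unshelve. all: by end_near. Qed.

(** A Lebesgue point, expressed through a truncation to a segment inside the interval because [g] is
    only locally integrable there. *)
Definition good_pt g x := exists2 k, 0 < k < x /\ x < 1 - k &
  lebesgue_pt (g \_ `[k, 1 - k]) x.

Lemma good_pt_ae g : locally_integrable I g ->
  {ae mu, forall x, I x -> good_pt g x}.
Proof.
move=> lg.
pose k (n : nat) : R := n.+2%:R^-1.
have k0 n : 0 < k n by rewrite invr_gt0.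
have H n : {ae mu, forall x, lebesgue_pt (g \_ `[k n, 1 - k n]) x}.
  apply: lebesgue_differentiation; apply: integrable_locally_restrict => //.
  by apply: loc_int_cc => //; rewrite ltrBlDr ltrDl.
have := ae_foralln H; apply: filterS => x hx /unitIoP/andP[x0 x1].
have m0 : 0 < Num.min x (1 - x) by rewrite lt_min x0 subr_gt0.
have := @cvg_scaled_harmonic 1; move=> /cvgrPdist_lt/(_ _ m0)[n _ /(_ n (leqnn n))].
rewrite /= sub0r normrN mul1r ger0_norm ?(ltW (k0 n))// lt_min => /andP[h1 h2].
exists (k n); last exact: hx.
by rewrite k0 h1; split => //; rewrite ltrBrDr addrC -ltrBrDr.
Qed.

Lemma good_pt_in g x : good_pt g x -> 0 < x < 1.
Proof. by move=> [k [/andP[k0 kx] xk] _]; apply/andP; split; lra. Qed.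

Lemma continuous_dplateau a r : continuous (dplateau a r).
Proof.
move=> t; apply: cvgM; first exact: cvg_cst.
apply: (@continuous_comp _ _ _ (fun t : R => r^-1 * t - r^-1 * a) (@dstep R)).
  by apply: cvgB; [apply: cvgM; [exact: cvg_cst|exact: cvg_id]|exact: cvg_cst].
exact: (smooth_continuous (smooth_dstep R)).
Qed.

Lemma dplateau_out a r t : 0 < r -> ~ (a <= t <= a + r) -> dplateau a r t = 0.
Proof.
move=> r0 /negP; rewrite negb_and -!ltNge /dplateau -mulrBr => /orP[ta|ta].
  by rewrite dstep_out ?mulr0//; left; rewrite pmulr_rle0 ?invr_gt0//; lra.
by rewrite dstep_out ?mulr0//; right; rewrite ler_pdivlMl// mulr1; lra.
Qed.

Lemma dplateau_bounded : exists2 C : R, 0 < C &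
  forall a r t, 0 < r -> `|dplateau a r t| <= C / r.
Proof.
have [C C0 hC] := dstep_bounded R; exists C => // a r t r0.
have rV : 0 <= r^-1 by rewrite invr_ge0 ltW.
by rewrite /dplateau normrM (ger0_norm rV) mulrC; apply: ler_wpM2r.
Qed.

Lemma integrable_mul_dplateau g a r : locally_integrable I g ->
  0 < a -> 0 < r -> a + r < 1 ->
  mu.-integrable I (EFin \o (fun t => g t * dplateau a r t)).
Proof.
move=> lg a0 r0 ar1; have [C C0 hC] := dplateau_bounded.
apply: (@integrable_bounded_mul g _ a (a + r) (C / r)) => //.
- exact: continuous_dplateau.
- by move=> t; exact: hC.
- by move=> t; exact: dplateau_out.
Qed.

Lemma integral_dplateau a r : 0 < a -> 0 < r -> a + r <= 1 ->
  mu.-integrable I (EFin \o dplateau a r) /\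
  (\int[mu]_(t in I) dplateau a r t = 1)%R.
Proof.
move=> a0 r0 ar1.
have cd : forall t, 0 <= t <= 1 -> {for t, continuous (dplateau a r)}.
  by move=> t _; exact: continuous_dplateau.
have ii : mu.-integrable I (EFin \o dplateau a r).
  apply: integrableS (continuous_integrable_cc cd); [exact: measurable_itv|exact: measurable_itv|].
  exact: subset_itv_oo_cc.
split => //; have [mI _] : measurable_fun I (dplateau a r) /\ True.
  by split => //; have /integrableP[/measurable_EFinP] := ii.
have := FTC2_cc ltr01 (fun t _ => is_derive_step_scaled a r t) cd.
rewrite (integral_itv_bndoo true false)//; last exact/measurable_EFinP.
rewrite /Rintegral => ->.
rewrite -!mulrBr step_ge1 ?step_le0 ?subr0//.
  by rewrite sub0r pmulr_rle0 ?invr_gt0// oppr_le0 ltW.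
by rewrite ler_pdivlMl// mulr1; lra.
Qed.

(** [dplateau a r] has mass 1, is at most C / r and lives in the ball of radius 2 r, of length 4 r.
    The error is thus at most 4 C times the mean of |g - g a| over that ball, which tends to 0 at a
    Lebesgue point. *)
Lemma dplateau_integral_cvg g a (r : nat -> R) : locally_integrable I g ->
  good_pt g a -> (forall n, 0 < r n) ->
  (exists2 b', b' < 1 & forall n, a + r n <= b') ->
  r n @[n --> \oo] --> 0 ->
  (\int[mu]_(t in I) (g t * dplateau a (r n) t))%R @[n --> \oo] --> g a.
Proof.
move=> lg ga r0 [b' b'1 hb'] rcvg.
have /andP[a0 a1] := good_pt_in ga.
have [k [/andP[k0 ka] ak] leb] := ga.
have rr := cvg_at_right0_seq r0 rcvg.
set f := g \_ `[k, 1 - k] in leb.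
have [C C0 hC] := dplateau_bounded.
have fE t : k <= t <= 1 - k -> f t = g t.
  by move=> tk; rewrite /f patchE mem_set//= in_itv.
have fa : f a = g a by apply: fE; apply/andP; split; lra.
have mf : measurable_fun setT f.
  apply/(measurable_restrictT _ _).1; first exact: measurable_itv.
  have : mu.-integrable `[k, 1 - k] (EFin \o g) by apply: loc_int_cc => //; lra.
  by move=> /integrableP[/measurable_EFinP].
have dpC n t : `|dplateau a (r n) t| <= C / r n by exact: hC.
have dp0 n t : ~ (a <= t <= a + r n) -> dplateau a (r n) t = 0 by exact: dplateau_out.
have ig n : mu.-integrable I (EFin \o (fun t => g t * dplateau a (r n) t)).
  by apply: integrable_mul_dplateau => //; exact: le_lt_trans (hb' n) b'1.
have [mg _ _] := lg.
have key n : 2 * r n < a - k -> 2 * r n < 1 - k - a ->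
    (`|(\int[mu]_(t in I) (g t * dplateau a (r n) t))%R - g a|%:E <=
     (4 * C)%:E * davg f a (2 * r n))%E.
  move=> rk1 rk2; set s := r n in rk1 rk2 *.
  have s0 : 0 < s by exact: r0.
  have as1 : a + s <= 1 by apply: ltW; exact: le_lt_trans (hb' n) b'1.
  have [id1 id2] := integral_dplateau a0 s0 as1.
  have icst : mu.-integrable I (EFin \o (fun t => g a * dplateau a s t)).
    have : mu.-integrable I (fun t => ((g a)%:E * (EFin \o dplateau a s) t)%E).
      by apply: integrableZl => //; exact: measurable_itv.
    by [].
  have -> : (\int[mu]_(t in I) (g t * dplateau a s t))%R - g a =
      (\int[mu]_(t in I) ((g t - g a) * dplateau a s t))%R.
    have -> : (\int[mu]_(t in I) ((g t - g a) * dplateau a s t) =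
       \int[mu]_(t in I) (g t * dplateau a s t - g a * dplateau a s t))%R.
      by apply: eq_Rintegral => t _; rewrite mulrBl.
    rewrite RintegralB//; [|exact: measurable_itv|exact: ig].
    by rewrite RintegralZl//; [rewrite id2 mulr1|exact: measurable_itv].
  have i3 : mu.-integrable I (EFin \o (fun t => (g t - g a) * dplateau a s t)).
    have := @integrableB _ _ R mu I (measurable_itv _) _ _ (ig n) icst.
    apply: eq_integrable; first exact: measurable_itv.
    by move=> t _ /=; rewrite -EFinB mulrBl.
  rewrite EFin_normr_Rintegral//; last exact: measurable_itv.
  apply: (le_trans (le_abse_integral _ _ _)) => //.
  - exact: measurable_itv.
  - by have /integrableP[] := i3.
  pose G t : R := (C / s) * `|f t - f a|.
  have G0 t : 0 <= G t by rewrite mulr_ge0// divr_ge0// ltW.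
  have mG : measurable_fun setT (EFin \o G).
    apply/measurable_EFinP; apply: measurable_funM; first exact: measurable_cst.
    apply: measurableT_comp => //; apply: measurable_funB => //; exact: measurable_cst.
  apply: (@le_trans _ _ (\int[mu]_(t in ball a (2 * s)) (G t)%:E)%E).
    rewrite [leRHS]integral_mkcond.
    apply: (@le_trans _ _ (\int[mu]_(t in I) ((EFin \o G) \_ (ball a (2 * s))) t)%E).
      have mGb : measurable_fun setT ((EFin \o G) \_ (ball a (2 * s))).
        apply/(measurable_restrictT _ _).1; first exact: measurable_ball.
        exact: measurable_funS mG.
      apply: ge0_le_integral => //.
      - exact: measurable_itv.
      - by apply: measurableT_comp => //; have /integrableP[] := i3.
      - exact: measurable_funS mGb.
      - move=> t It; rewrite patchE /=.
        have [tas|tas] := boolP (a <= t <= a + s); last first.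
          rewrite dp0 ?mulr0 ?normr0; last exact/negP.
          by case: ifP => // _; rewrite lee_fin.
        have tb : ball a (2 * s) t.
          move/andP: tas => [t1 t2]; rewrite /ball/= distrC ger0_norm; lra.
        rewrite mem_set// lee_fin normrM mulrC /G fa fE.
          by rewrite ler_wpM2r// dpC.
        by move/andP: tas => [t1 t2]; apply/andP; split; lra.
    apply: ge0_subset_integral => //.
    - exact: measurable_itv.
    - apply/(measurable_restrictT _ _).1; first exact: measurable_ball.
      exact: measurable_funS mG.
    - by move=> t _; rewrite patchE; case: ifP => // _; rewrite lee_fin.
  have s20 : 0 <= 2 * s by rewrite mulr_ge0// ltW.
  rewrite /davg /iavg lebesgue_measure_ball// inver.
  have s40 : (2 * s *+ 2 == 0) = false by apply/eqP; rewrite mulr2n; lra.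
  rewrite s40 muleA -EFinM.
  have -> : 4 * C * (2 * s *+ 2)^-1 = C / s.
    by rewrite mulr2n; field; rewrite gt_eqF//= gt_eqF//; lra.
  rewrite -ge0_integralZl//; last 3 first.
  - exact: measurable_ball.
  - apply: measurableT_comp => //; apply/measurable_EFinP => /=.
    apply: (@measurable_funS _ _ _ _ setT) => //.
    by apply: measurable_funB => //; exact: measurable_cst.
  - by rewrite lee_fin divr_ge0// ltW.
apply/cvgrPdist_le => e e0.
have r2 : 2 * r n @[n --> \oo] --> (0 : R)^'+.
  apply: cvg_at_right0_seq; first by move=> n; rewrite mulr_gt0.
  by rewrite -[X in _ --> X](mulr0 2); apply: cvgM => //; exact: cvg_cst.
have dcvg : davg f a (2 * r n) @[n --> \oo] --> 0%E.
  exact: (cvg_comp _ _ r2 leb).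
have ec : 0 < e / (4 * C) by rewrite divr_gt0// mulr_gt0.
move/fine_cvgP : dcvg => [dfin] /cvgrPdist_lt/(_ _ ec) hd.
have ak0 : 0 < a - k by lra.
have ak1 : 0 < 1 - k - a by lra.
have h1 := r2 _ (nbhs_right_lt ak0).
have h2 := r2 _ (nbhs_right_lt ak1).
near=> n.
have n1 : 2 * r n < a - k by near: n; exact: h1.
have n2 : 2 * r n < 1 - k - a by near: n; exact: h2.
have n3 : davg f a (2 * r n) \is a fin_num by near: n.
have n4 : `|0 - fine (davg f a (2 * r n))| < e / (4 * C) by near: n.
rewrite distrC -lee_fin (le_trans (key n n1 n2))// -(fineK n3) -EFinM lee_fin.
rewrite mulrC -ler_pdivlMr ?mulr_gt0//.
move: n4; rewrite sub0r normrN => /ltW; apply: le_trans; exact: ler_norm.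
Unshelve. all: by end_near. Qed.

End weak.

(** * The lemma of du Bois-Reymond *)

Section dubois_reymond.
Variable R : realType.
Local Notation mu := (@lebesgue_measure R).
Local Notation I := (@unitIo R).
Implicit Types (f g h phi : R -> R) (a b c d k x y t r : R).

(** Test with [plateau a b r]: its derivative is an approximate Dirac mass at a minus one at b, and
    the function itself tends to the indicator of ]a, b]. *)
Lemma good_pt_increment g h a b : weak_derivative 1 g h ->
  good_pt g a -> good_pt g b -> a <= b ->
  g b - g a = (\int[mu]_(t in `]a, b]) h t)%R.
Proof.
move=> [lg lh gh] ga gb ab.
have /andP[a0 a1] := good_pt_in ga; have /andP[b0 b1] := good_pt_in gb.
(* At most (1 - b) / 2, so all the supports stay below (1 + b) / 2 < 1. *)
pose r (n : nat) : R := ((1 - b) / 2) / n.+2%:R.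
have r0 n : 0 < r n by rewrite divr_gt0// divr_gt0// subr_gt0.
have rcvg : r n @[n --> \oo] --> 0 by exact: cvg_scaled_harmonic.
have rle n : r n <= (1 - b) / 2.
  by rewrite /r ler_pdivrMr// ler_peMr ?ler1n// divr_ge0// subr_ge0 ltW.
have b'1 : (1 + b) / 2 < 1 by lra.
have ba : exists2 b', b' < 1 & forall n, a + r n <= b'.
  by exists ((1 + b) / 2) => // n; have := rle n; lra.
have bb : exists2 b', b' < 1 & forall n, b + r n <= b'.
  by exists ((1 + b) / 2) => // n; have := rle n; lra.
have cL := cvgB (dplateau_integral_cvg lg ga r0 ba rcvg) (dplateau_integral_cvg lg gb r0 bb rcvg).
have cR := cvgN (plateau_integral_cvg lh a0 ab r0 bb rcvg).
have e n : (\int[mu]_(t in I) (g t * dplateau a (r n) t))%R -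
    (\int[mu]_(t in I) (g t * dplateau b (r n) t))%R =
    - (\int[mu]_(t in I) (h t * plateau a b (r n) t))%R.
  have rn := rle n.
  have tp : test_function (plateau a b (r n)) by apply: test_plateau => //; lra.
  have := gh _ tp; rewrite expr1 mulN1r => <-.
  rewrite -RintegralB//; last 3 first.
  - exact: measurable_itv.
  - by apply: integrable_mul_dplateau => //; lra.
  - by apply: integrable_mul_dplateau => //; lra.
  by apply: eq_Rintegral => t _; rewrite [derive1n _ _](derive1_plateau a b (r n)) mulrBr.
have E : (fun n => (\int[mu]_(t in I) (g t * dplateau a (r n) t))%R) -
    (fun n => (\int[mu]_(t in I) (g t * dplateau b (r n) t))%R) =
    - (fun n => (\int[mu]_(t in I) (h t * plateau a b (r n) t))%R).
  by apply/funext => n; exact: e.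
rewrite E in cL.
have : g a - g b = - (\int[mu]_(t in `]a, b]) h t)%R.
  exact: (cvg_unique (@Rhausdorff R) (cL _) (cR _)).
by move=> /eqP; rewrite eq_sym eqr_oppLR opprB => /eqP.
Qed.

(** Lebesgue points are almost all points, so one exists to serve as base, and the increment formula
    from it gives the identity at all the others. *)
Lemma weak_derivative_prim g h : weak_derivative 1 g h ->
  exists c, ae_eq mu I g (fun x => c + prim h x).
Proof.
move=> gh; have [lg lh _] := gh.
have ga := good_pt_ae lg.
have [a aP] : exists a, good_pt g a.
  apply: contrapT => nex.
  have nI : mu.-negligible I.
    by apply: negligibleS ga => x Ix /= /(_ Ix) gx; apply: nex; exists x.
  have : mu I = 0%E by apply: measure_negligible => //; exact: measurable_unitIo.
  by rewrite lebesgue_unitIo => /eqP; rewrite onee_eq0.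
exists (g a - prim h a); move: ga; apply: (@filterS _ _ (ae_filter_ringOfSetsType mu)) => x /= gx Ix.
have {}gx := gx Ix.
have /andP[a0 a1] := good_pt_in aP; have /andP[x0 x1] := good_pt_in gx.
rewrite addrAC -addrA; have [ax|xa] := leP a x.
  rewrite primB// -(good_pt_increment gh aP gx ax).
  by rewrite addrC subrK.
have := primB lh x0 (ltW xa) a1.
rewrite -(good_pt_increment gh gx aP (ltW xa)) => e.
by rewrite -[X in _ + X]opprB e opprB addrC subrK.
Qed.

Lemma derive1_out phi a b : (forall x, ~ (a <= x <= b) -> phi x = 0) ->
  forall x, ~ (a <= x <= b) -> derive1 phi x = 0.
Proof.
move=> phi0 x /negP xab; rewrite derive1E.
rewrite -[RHS](@derive_cst R R^o R^o (0 : R) 1 x).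
apply: near_eq_derive.
move: xab; rewrite negb_and -!ltNge => /orP[xa|bx].
  near=> y; apply: phi0; apply/negP; rewrite negb_and -!ltNge; apply/orP; left.
  by near: y; exact: lt_nbhsl.
near=> y; apply: phi0; apply/negP; rewrite negb_and -!ltNge; apply/orP; right.
by near: y; exact: lt_nbhsr.
Unshelve. all: by end_near. Qed.

Lemma test_function_derive1 phi : test_function phi -> test_function (derive1 phi).
Proof.
move=> [dphi [a [b [a0 b1 phi0]]]]; split.
  by move=> n x; rewrite -derive1Sn; exact: dphi.
by exists a, b; split => //; exact: derive1_out.
Qed.

(** Testing the j-th derivative against phi' is testing [f] against the derivative of phi of order j
    + 1; the two signs differ by -1. *)
Lemma weak_derivative_succ j f g h : weak_derivative j f g ->
  weak_derivative j.+1 f h -> weak_derivative 1 g h.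
Proof.
move=> [lf lg fg] [_ lh fh]; split => // phi tphi.
have := fg _ (test_function_derive1 tphi).
rewrite -derive1Sn (fh _ tphi) exprS -mulrA => /esym e.
apply: (@mulfI _ ((-1) ^+ j)); first by rewrite signr_eq0.
by rewrite derive1n1 e expr1 mulrCA.
Qed.

Lemma good_pt_is_derive g x : locally_integrable I g -> good_pt g x ->
  is_derive x 1 (prim g) (g x).
Proof.
move=> lg gx; have [k [/andP[k0 kx] xk] leb] := gx.
have xu : x < 1 - k by [].
have k1 : 1 - k < 1 by lra.
set f := g \_ `[k, 1 - k] in leb.
have fE t : k <= t <= 1 - k -> f t = g t.
  by move=> tk; rewrite /f patchE mem_set//= in_itv.
have intf : mu.-integrable [set` Interval (BRight k) (BRight (1 - k))] (EFin \o f).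
  apply: (@eq_integrable _ _ _ mu _ _ (EFin \o g)); first exact: measurable_itv.
    move=> t; rewrite inE/= in_itv/= => /andP[h1 h2].
    by rewrite /= fE// (ltW h1).
  exact: loc_int_oc.
have kx' : (BRight k < BRight x)%O by rewrite bnd_simp.
have [F1 F2] := FTC1_lebesgue_pt xu intf kx' leb.
rewrite derive1E in F2.
have fx : f x = g x by apply: fE; apply/andP; split; exact: ltW.
have dF : is_derive x 1 (fun y => prim g k + (\int[mu]_(t in `]k, y]) f t)%R) (g x).
  rewrite -fx -[f x]add0r; apply: is_deriveD.
  exact: DeriveDef.
apply: near_eq_is_derive dF.
near=> y.
have ky : k < y by near: y; exact: lt_nbhsr.
have yk : y < 1 - k by near: y; exact: lt_nbhsl.
have -> : (\int[mu]_(t in `]k, y]) f t = \int[mu]_(t in `]k, y]) g t)%R.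
  apply: eq_Rintegral => t; rewrite inE/= in_itv/= => /andP[h1 h2].
  by apply: fE; apply/andP; split; lra.
rewrite -primB//; last 2 first.
- exact: ltW.
- by lra.
by rewrite addrC subrK.
Unshelve. all: by end_near. Qed.

(** Plateaus give equal integrals over every ]a, b], hence equal primitives, which are
    differentiated at the common Lebesgue points. *)
Lemma weak_derivative_unique g h : locally_integrable I g -> locally_integrable I h ->
  (forall phi, test_function phi ->
    \int[mu]_(t in I) (g t * phi t) = \int[mu]_(t in I) (h t * phi t)) ->
  ae_eq mu I g h.
Proof.
move=> lg lh gh.
have e a b : 0 < a -> a <= b -> b < 1 ->
    (\int[mu]_(t in `]a, b]) g t = \int[mu]_(t in `]a, b]) h t)%R.
  move=> a0 ab b1.
  pose r (n : nat) : R := ((1 - b) / 2) / n.+2%:R.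
  have r0 n : 0 < r n by rewrite divr_gt0// divr_gt0// subr_gt0.
  have rcvg : r n @[n --> \oo] --> 0 by exact: cvg_scaled_harmonic.
  have rle n : r n <= (1 - b) / 2.
    by rewrite /r ler_pdivrMr// ler_peMr ?ler1n// divr_ge0// subr_ge0 ltW.
  have bb : exists2 b', b' < 1 & forall n, b + r n <= b'.
    by exists ((1 + b) / 2); [lra|move=> n; have := rle n; lra].
  have c1 := plateau_integral_cvg lg a0 ab r0 bb rcvg.
  have c2 := plateau_integral_cvg lh a0 ab r0 bb rcvg.
  apply: (cvg_unique (@Rhausdorff R) c1).
  rewrite (_ : (fun n => _) = (fun n => (\int[mu]_(t in I) (h t * plateau a b (r n) t))%R))//.
  apply/funext => n; apply: gh; apply: test_plateau => //; have := rle n; lra.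
have ep x : 0 < x < 1 -> prim g x = prim h x.
  by move=> /andP[x0 x1]; rewrite /prim; case: (leP 2^-1 x) => ?; rewrite e//; lra.
have := good_pt_ae lh; have := good_pt_ae lg.
apply: (@filterS2 _ _ (ae_filter_ringOfSetsType mu)) => x /= gx hx Ix.
have dg := good_pt_is_derive lg (gx Ix); have dh := good_pt_is_derive lh (hx Ix).
have dg' : is_derive x 1 (prim h) (g x).
  have /unitIoP/andP[x0 x1] := Ix.
  apply: near_eq_is_derive dg; near=> y; apply: ep.
  by apply/andP; split; near: y; [exact: lt_nbhsr|exact: lt_nbhsl].
by have [_ <-] := dg'; have [_ <-] := dh.
Unshelve. all: by end_near. Qed.

End dubois_reymond.

(** * Passage to the limit *)

Section approximation.
Variable R : realType.
Local Notation mu := (@lebesgue_measure R).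
Local Notation I := (@unitIo R).
Implicit Types (f g h : R -> R) (p q P Q : {poly R}) (a b c d k x y t A : R).

Lemma poly_antiderivative q : exists P, P^`() = q.
Proof.
exists (\poly_(i < (size q).+1) (q`_i.-1 / i%:R)).
apply/polyP => i; rewrite coef_deriv coef_poly ltnS /=.
case: ltnP => [_|iq]; last by rewrite mul0rn nth_default.
by rewrite -[LHS]mulr_natr mulfVK// pnatr_eq0.
Qed.

Lemma measurable_horner q : measurable_fun I (horner q).
Proof. by apply: measurable_unitIo_continuous => x; exact: continuous_horner_at. Qed.

Lemma locally_integrable_horner q : locally_integrable I (horner q).
Proof.
apply: open_integrable_locally; first exact: interval_open.
have [K _ hK] := poly_unit_bound q.
apply: (@bounded_integrable _ _ K); first exact: measurable_horner.
by move=> x /andP[x0 x1]; apply: hK; rewrite !ltW.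
Qed.

Lemma integral_deriv_horner P a b : a <= b ->
  (\int[mu]_(t in `]a, b]) (P^`()).[t])%R = P.[b] - P.[a].
Proof.
rewrite le_eqVlt => /predU1P[<-|ab].
  by rewrite subrr set_itvoc0 Rintegral_set0.
have cP x : a <= x <= b -> {for x, continuous (horner P^`())}.
  by move=> _; exact: continuous_horner_at.
rewrite Rintegral_itv_obnd_cbnd; last first.
  apply: integrableS (continuous_integrable_cc cP); [exact: measurable_itv|exact: measurable_itv|].
  by apply: subset_itvr; rewrite bnd_simp.
by rewrite /Rintegral (FTC2_cc ab _ cP)// => x _; exact: is_derive_horner.
Qed.

(** The constant added to [P] makes both functions equal to [c] at the base point 1/2, so their
    distance is an integral of the difference of derivatives. *)
Lemma prim_horner_dist h P d A : locally_integrable I h -> 0 < d ->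
  (\int[mu]_(t in `[d, (1 - d)%R]) (`|h t - (P^`()).[t]|)%R%:E <= A%:E)%E ->
  forall c x, d <= x <= 1 - d ->
  `|c + prim h x - (P + (c - P.[2^-1])%:P).[x]| <= A.
Proof.
move=> lh d0 hA c x /andP[dx xd].
have key a b : d <= a -> a <= b -> b <= 1 - d ->
    `|(\int[mu]_(t in `]a, b]) h t)%R - (P.[b] - P.[a])| <= A.
  move=> da ab bd; have a0 : 0 < a by exact: lt_le_trans da.
  have b1 : b < 1 by lra.
  have lP := locally_integrable_horner P^`().
  have ih := loc_int_oc lh a0 b1; have iP := loc_int_oc lP a0 b1.
  have mB : measurable_fun I (fun t => h t - (P^`()).[t]).
    by case: (lh) => mh _ _; apply: measurable_funB => //; exact: measurable_horner.
  have sub : (`]a, b] : set R) `<=` `[d, 1 - d].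
    by move=> t /=; rewrite !in_itv/= => /andP[h1 h2]; apply/andP; split; lra.
  have subI : (`[d, 1 - d] : set R) `<=` I.
    by move=> t /=; rewrite in_itv/= => /andP[h1 h2]; apply/unitIoP/andP; split; lra.
  have mK : measurable_fun `[d, 1 - d] (fun t => h t - (P^`()).[t]).
    by apply: measurable_funS mB => //; exact: measurable_itv.
  rewrite -integral_deriv_horner// -RintegralB//.
  rewrite -lee_fin (le_trans _ hA)// EFin_normr_Rintegral//; last first.
    have := @integrableB _ _ R mu _ (measurable_itv _) _ _ ih iP.
    by apply: eq_integrable => //; exact: measurable_itv.
  apply: (le_trans (le_abse_integral _ _ _)).
  - exact: measurable_itv.
  - apply/measurable_EFinP; apply: measurable_funS mK => //; exact: measurable_itv.
  apply: ge0_subset_integral => //; try exact: measurable_itv.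
  by apply/measurable_EFinP; apply: measurableT_comp.
have eQ : (P + (c - P.[2^-1])%:P).[x] = c + (P.[x] - P.[2^-1]).
  by rewrite hornerD hornerC; ring.
have d2 : d <= 2^-1 by lra.
have d2' : 2^-1 <= 1 - d by lra.
rewrite eQ opprD addrACA subrr add0r /prim; case: (leP 2^-1 x) => hx.
  exact: key.
rewrite -normrN (_ : - (_ - _) = (\int[mu]_(t in `]x, 2^-1]) h t)%R - (P.[2^-1] - P.[x])); last by ring.
by apply: key => //; exact: ltW.
Qed.

(** The bound [A] does not grow: an integration turns an L1 bound into a uniform one, and on a
    segment of length at most 1 this is an L1 bound again. The primitive relation holds only almost
    everywhere, which suffices in L1. *)
Lemma approx_chain n : forall (g : nat -> R -> R) q d A, 0 < d ->
  (forall k : nat, (k < n)%N -> weak_derivative 1 (g k) (g k.+1)) ->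
  measurable_fun I (g 0%N) -> 0 <= A ->
  (\int[mu]_(t in `[d, (1 - d)%R]) (`|g n t - q.[t]|)%R%:E <= A%:E)%E ->
  exists2 Q, Q^`(n) = q &
    (\int[mu]_(t in `[d, (1 - d)%R]) (`|g 0%N t - Q.[t]|)%R%:E <= A%:E)%E.
Proof.
elim: n => [|n IHn] g q d A d0 gw mg0 A0 gA; first by exists q.
have [lg0 lg1 _] := gw 0%N isT; have [mg1 _ _] := lg1.
have [|Q1 Q1q Q1A] := IHn (fun k : nat => g k.+1) q d A d0 _ mg1 A0 gA.
  by move=> k kn; exact: gw.
have [P PQ] := poly_antiderivative Q1.
have [c hc] := weak_derivative_prim (gw 0%N isT).
exists (P + (c - P.[2^-1])%:P); first by rewrite derivSn derivD derivC addr0 PQ.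
have K1 : (mu `[d, (1 - d)%R] <= 1)%E.
  rewrite -(lebesgue_unitIo R) le_measure ?inE//; try exact: measurable_itv.
  by move=> t /=; rewrite in_itv/= => /andP[h1 h2]; apply/unitIoP/andP; split; lra.
have subI : (`[d, 1 - d] : set R) `<=` I.
  by move=> t /=; rewrite in_itv/= => /andP[h1 h2]; apply/unitIoP/andP; split; lra.
apply: (@le_trans _ _ (\int[mu]_(t in `[d, (1 - d)%R]) (cst A%:E) t)%E); last first.
  rewrite integral_cst; last exact: measurable_itv.
  by rewrite -[leRHS]mule1 lee_wpmul2l.
apply: ae_ge0_le_integral => //; try exact: measurable_itv.
- apply/measurable_EFinP; apply: measurableT_comp => //.
  apply: (@measurable_funS _ _ _ _ I) => //; first exact: measurable_itv.
  by apply: measurable_funB => //; exact: measurable_horner.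
move: hc; apply: (@filterS _ _ (ae_filter_ringOfSetsType mu)) => x /= hx xK.
rewrite hx; last exact: subI.
by rewrite lee_fin; apply: (prim_horner_dist lg1 d0); rewrite ?PQ.
Qed.

(** Young's inequality |s| <= eta + s^2 / eta in place of Cauchy-Schwarz, with the weight bounded
    below by [kap] on the segment. *)
Lemma sqdist_L1 (w : R -> R) h q d kap eta : 0 < d -> 0 < kap -> 0 < eta ->
  measurable_fun I h -> measurable_fun I w -> (forall x, 0 <= w x) ->
  (forall x, d <= x <= 1 - d -> kap <= w x) ->
  (sqdist w h (horner q) <= (eta ^+ 2 * kap)%:E)%E ->
  (\int[mu]_(t in `[d, (1 - d)%R]) (`|h t - q.[t]|)%R%:E <= (2 * eta)%:E)%E.
Proof.
move=> d0 kap0 eta0 mh mw w0 wk hs.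
have subI : (`[d, 1 - d] : set R) `<=` I.
  by move=> t /=; rewrite in_itv/= => /andP[h1 h2]; apply/unitIoP/andP; split; lra.
have ek0 : 0 < eta * kap by exact: mulr_gt0.
have msq := measurable_sq mw mh (measurable_horner q).
pose F t : \bar R := (eta%:E + ((eta * kap)^-1)%:E * ((h t - q.[t]) ^+ 2 * w t)%:E)%E.
have F0 t : (0 <= F t)%E.
  rewrite /F -EFinM -EFinD lee_fin addr_ge0//; first exact: ltW.
  by rewrite mulr_ge0 ?invr_ge0 ?(ltW ek0)// mulr_ge0 ?sqr_ge0.
have mF : measurable_fun I F.
  apply: emeasurable_funD; first exact: measurable_cst.
  by apply: measurable_funeM.
apply: (@le_trans _ _ (\int[mu]_(t in I) F t)%E).
  apply: (@le_trans _ _ (\int[mu]_(t in `[d, (1 - d)%R]) F t)%E); last first.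
    apply: ge0_subset_integral => //; exact: measurable_itv.
  apply: ge0_le_integral => //; try exact: measurable_itv.
  - apply/measurable_EFinP; apply: measurableT_comp => //.
    apply: (@measurable_funS _ _ _ _ I) => //; first exact: measurable_itv.
    by apply: measurable_funB => //; exact: measurable_horner.
  - by apply: measurable_funS mF => //; exact: measurable_itv.
  - move=> t; rewrite /= in_itv/= => tK; rewrite /F -EFinM -EFinD lee_fin.
    set s := h t - q.[t].
    have h1 : eta^-1 * `|s| ^+ 2 <= (eta * kap)^-1 * (s ^+ 2 * w t).
      rewrite invfM -mulrA; apply: ler_wpM2l; first by rewrite invr_ge0 ltW.
      rewrite real_normK ?num_real// mulrCA ler_peMr ?sqr_ge0//.
      by rewrite ler_pdivlMl// mulr1 wk.
    apply: le_trans (lerD (lexx eta) h1).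
    have : 0 <= eta^-1 * (`|s| - eta / 2) ^+ 2 by rewrite mulr_ge0 ?sqr_ge0// invr_ge0 ltW.
    have -> : eta^-1 * (`|s| - eta / 2) ^+ 2 = eta^-1 * `|s| ^+ 2 - `|s| + eta / 4.
      by field; rewrite gt_eqF.
    by lra.
rewrite /F ge0_integralD//; last 4 first.
- exact: measurable_itv.
- by move=> t _; rewrite lee_fin ltW.
- move=> t _; rewrite -EFinM lee_fin mulr_ge0 ?invr_ge0 ?(ltW ek0)//.
  by rewrite mulr_ge0 ?sqr_ge0.
- by apply: measurable_funeM.
rewrite ge0_integralZl_EFin//; last 3 first.
- exact: measurable_itv.
- by move=> t _; rewrite lee_fin mulr_ge0 ?sqr_ge0.
- by rewrite invr_ge0 ltW.
have -> : (\int[mu]_(_ in I) eta%:E = eta%:E)%E.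
  transitivity (eta%:E * mu I)%E; first by apply: integral_cst; exact: measurable_itv.
  by rewrite lebesgue_unitIo mule1.
have -> : (2 * eta)%:E = (eta%:E + ((eta * kap)^-1)%:E * (eta ^+ 2 * kap)%:E)%E.
  by rewrite -EFinM -EFinD; congr (_%:E); field; rewrite !gt_eqF.
by apply: leeD2l; apply: lee_wpmul2l => //; rewrite lee_fin invr_ge0 ltW.
Qed.

(** Pointwise, q^2 <= (1 + eta) g^2 + (1 + 1 / eta) (g - q)^2; this replaces Minkowski's
    inequality. *)
Lemma Lw_sqr_close a b g q e eta : -1 < a -> -1 < b -> 0 < eta -> 0 <= e ->
  in_L2w a b g -> (sqdist (weight a b) g (horner q) <= e%:E)%E ->
  Lw a b (q ^+ 2) <=
    (1 + eta) * (\int[mu]_(x in I) (g x ^+ 2 * weight a b x))%R + (1 + eta^-1) * e.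
Proof.
move=> a1 b1 eta0 e0 [mg gfin] hs.
have mw : measurable_fun I (weight a b).
  by apply: continuous_measurable_oo => x x01; exact: continuous_weight_at.
have mgw : measurable_fun I (fun x => (g x ^+ 2 * weight a b x)%:E).
  by apply/measurable_EFinP; apply: measurable_funM => //; exact: measurable_funX.
have g0 x : (0 <= (g x ^+ 2 * weight a b x)%:E)%E.
  by rewrite lee_fin mulr_ge0 ?sqr_ge0 ?weight_ge0.
have s0 x : (0 <= ((g x - q.[x]) ^+ 2 * weight a b x)%:E)%E.
  by rewrite lee_fin mulr_ge0 ?sqr_ge0 ?weight_ge0.
have ms := measurable_sq mw mg (measurable_horner q).
have eV0 : 0 <= 1 + eta^-1 by rewrite addr_ge0// invr_ge0 ltW.
have e10 : 0 <= 1 + eta by rewrite addr_ge0// ltW.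
have Gfin : (\int[mu]_(x in I) (g x ^+ 2 * weight a b x)%:E)%E \is a fin_num.
  by rewrite ge0_fin_numE// integral_ge0.
rewrite -lee_fin EFinD !EFinM /Rintegral (fineK Gfin).
have iq := integrable_poly_weight (q ^+ 2) a1 b1.
rewrite /Lw /Rintegral fineK; last first.
  by apply: (integrable_fin_num _ iq); exact: measurable_itv.
apply: (@le_trans _ _ (\int[mu]_(x in I) ((1 + eta)%:E * (g x ^+ 2 * weight a b x)%:E +
   (1 + eta^-1)%:E * ((g x - q.[x]) ^+ 2 * weight a b x)%:E))%E).
  apply: ge0_le_integral => //.
  - exact: measurable_itv.
  - by move=> x _; rewrite lee_fin horner_exp mulr_ge0 ?sqr_ge0 ?weight_ge0.
  - by have /integrableP[] := iq.
  - by apply: emeasurable_funD; apply: measurable_funeM.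
  - move=> x _; rewrite -!EFinM -EFinD lee_fin horner_exp.
    move: (q.[x]) (g x) (weight a b x) (weight_ge0 a b x) => s u W W0.
    have -> : (1 + eta) * (u ^+ 2 * W) + (1 + eta^-1) * ((u - s) ^+ 2 * W) =
      ((1 + eta) * u ^+ 2 + (1 + eta^-1) * (u - s) ^+ 2) * W by ring.
    apply: ler_wpM2r => //.
    have : 0 <= eta^-1 * (eta * u + (u - s)) ^+ 2 by rewrite mulr_ge0 ?sqr_ge0// invr_ge0 ltW.
    have -> : eta^-1 * (eta * u + (u - s)) ^+ 2 =
      eta * u ^+ 2 + 2 * u * (u - s) + eta^-1 * (u - s) ^+ 2 by field; rewrite gt_eqF.
    by nra.
rewrite ge0_integralD//; last 5 first.
- exact: measurable_itv.
- by move=> x _; apply: mule_ge0 => //; rewrite lee_fin.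
- by apply: measurable_funeM.
- by move=> x _; apply: mule_ge0 => //; rewrite lee_fin.
- by apply: measurable_funeM.
rewrite !ge0_integralZl_EFin//; try exact: measurable_itv.
by apply: leeD2l; apply: lee_wpmul2l => //; rewrite lee_fin.
Qed.

End approximation.

(** * The error estimate at interior points *)

Section open_interval.
Variable R : realType.
Local Notation mu := (@lebesgue_measure R).
Local Notation I := (@unitIo R).
Implicit Types (f h : R -> R) (q P Q : {poly R}) (a b c d p x y t A : R).

Lemma powR_le_one x p : 0 <= x <= 1 -> 0 <= p -> x `^ p <= 1.
Proof.
have e1 : (1 : R) `^ p = 1 by rewrite powR1.
by move=> /andP[x0 x1] p0; rewrite -[leRHS]e1; apply: ge0_ler_powR; rewrite ?nnegrE.
Qed.

Lemma weight_le_one a b x : 0 <= a -> 0 <= b -> 0 <= x <= 1 -> weight a b x <= 1.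
Proof.
move=> a0 b0 x01; rewrite /weight -[leRHS]mulr1.
apply: ler_pM; rewrite ?powR_ge0 ?powR_le_one//.
by move/andP: x01 => [? ?]; apply/andP; split; lra.
Qed.

Lemma le_sqrt_limit (X K1 K2 D G : R) :
  (forall eta, 0 < eta <= 1 -> X <= K1 * eta + D * Num.sqrt (G + eta * K2)) ->
  X <= D * Num.sqrt G.
Proof.
move=> H.
have c : K1 * eta + D * Num.sqrt (G + eta * K2) @[eta --> 0^'+] --> D * Num.sqrt G.
  have id0 : (eta : R) @[eta --> (0 : R)^'+] --> (0 : R) by apply: cvg_at_right_filter; exact: cvg_id.
  rewrite -[X in _ --> X]add0r -[X in _ --> X + _](mulr0 K1).
  apply: cvgD; first by apply: cvgM => //; exact: cvg_cst.
  apply: cvgM; first exact: cvg_cst.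
  have hc : G + eta * K2 @[eta --> (0 : R)^'+] --> G.
    rewrite -[X in _ --> X]addr0 -[X in _ --> _ + X](mul0r K2).
    by apply: cvgD; [exact: cvg_cst|apply: cvgM => //; exact: cvg_cst].
  exact: (cvg_comp _ _ hc (@sqrt_continuous R G)).
apply: (cvgr_to_ge c); near=> eta; apply: H; apply/andP; split.
  by near: eta; exact: nbhs_right_gt.
by near: eta; apply: nbhs_right_le.
Unshelve. all: by end_near. Qed.

Lemma lagi_diff (N : nat) (z : 'I_N.+1 -> R) (F G : 'I_N.+1 -> R) (x K : R) :
  (forall j, `|F j - G j| <= K) ->
  `|(lagi z F).[x] - (lagi z G).[x]| <= K * \sum_j `|(lag z j).[x]|.
Proof.
move=> FG; rewrite /lagi !horner_sum -sumrB mulr_sumr.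
apply: (le_trans (ler_norm_sum _ _ _)); apply: ler_sum => j _.
by rewrite !hornerZ -mulrBl normrM ler_wpM2r.
Qed.

(* The estimate for polynomials passes to the limit along polynomials whose
   m-th derivatives approach [g m] in the weighted L2 norm. *)
Lemma interp_error_open (alpha beta : R) n N (z : 'I_N.+1 -> R) D (g : nat -> R -> R) c d x :
  -1 < alpha -> -1 < beta -> 0 <= D ->
  (forall (u : {poly R}) y, 0 <= y <= 1 ->
    `|u.[y] - (lagi z (fun j => u.[z j])).[y]| <=
    D * Num.sqrt (Lw (alpha + n.+1%:R) (beta + n.+1%:R) (u^`(n.+1) ^+ 2))) ->
  (forall k : nat, (k < n.+1)%N -> weak_derivative 1 (g k) (g k.+1)) ->
  in_L2w (alpha + n.+1%:R) (beta + n.+1%:R) (g n.+1) ->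
  0 < d -> d <= x <= 1 - d -> (forall j, d <= z j <= 1 - d) ->
  `|c + prim (g 1%N) x - (lagi z (fun j => c + prim (g 1%N) (z j))).[x]| <=
  D * norm_L2w (alpha + n.+1%:R) (beta + n.+1%:R) (g n.+1).
Proof.
move=> al1 be1 D0 hpoly gw gL2 d0 xd zd.
set a := alpha + n.+1%:R in hpoly gL2 *; set b := beta + n.+1%:R in hpoly gL2 *.
have n1 : (1 : R) <= n.+1%:R by rewrite ler1n.
have a0 : 0 <= a by rewrite /a; lra.
have b0 : 0 <= b by rewrite /b; lra.
have a1 : -1 < a by lra.
have b1 : -1 < b by lra.
have [mg gfin] := gL2.
have lg1 : locally_integrable I (g 1%N) by have [_ ] := gw 0%N isT.
have [mg1 _ _] := lg1.
have mw : measurable_fun I (weight a b).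
  by apply: continuous_measurable_oo => y y01; exact: continuous_weight_at.
have w01 y : 0 < y < 1 -> 0 <= weight a b y <= 1.
  move=> /andP[y0 y1]; rewrite weight_ge0/= weight_le_one//.
  by rewrite !ltW.
have d1 : d <= 1 - d by move/andP: xd => [h1 h2]; exact: le_trans h2.
pose kap := d `^ a * d `^ b.
have kap0 : 0 < kap by rewrite mulr_gt0// powR_gt0.
have kap1 : kap <= 1.
  have h : 0 <= d <= 1 by apply/andP; split; lra.
  by rewrite /kap -[leRHS]mulr1; apply: ler_pM; rewrite ?powR_ge0 ?powR_le_one.
have wk y : d <= y <= 1 - d -> kap <= weight a b y.
  move=> /andP[y0 y1]; rewrite /kap /weight; apply: ler_pM; rewrite ?powR_ge0//.
    by apply: ge0_ler_powR => //; rewrite ?nnegrE; lra.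
  by apply: ge0_ler_powR => //; rewrite ?nnegrE; lra.
set G := (\int[mu]_(y in I) (g n.+1 y ^+ 2 * weight a b y))%R.
have G0 : 0 <= G by apply: Rintegral_ge0 => y _; rewrite mulr_ge0 ?sqr_ge0 ?weight_ge0.
rewrite /norm_L2w -/G.
pose L := \sum_j `|(lag z j).[x]|.
pose U y := c + prim (g 1%N) y.
apply: (@le_sqrt_limit _ (2 * (1 + L)) (G + 2)) => eta /andP[eta0 eta1].
(* The tolerance that [sqdist_L1] turns into 2 [eta]; multiplied by 1 + 1 / eta it is still of order
   [eta]. *)
have e0 : 0 < eta ^+ 2 * kap by rewrite mulr_gt0// exprn_gt0.
have gs : (sqdist (weight a b) (g n.+1) (fun=> 0%R) < +oo)%E.
  move: gfin; rewrite /sqdist.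
  by under [X in _ -> (X < _)%E]eq_integral do rewrite subr0.
have [q /ltW hq] := poly_dense mw w01 e0 mg gs.
have hq1 := sqdist_L1 d0 kap0 eta0 mg mw (@weight_ge0 R a b) wk hq.
(* The chain stops at [g 1], so that the last integration can be kept as a uniform bound, valid at
   the nodes and at x. *)
have [|//|Q1 Q1q Q1A] := @approx_chain R n (fun k : nat => g k.+1) q d (2 * eta) d0 _ mg1 _ hq1.
- by move=> k kn; exact: gw.
- by rewrite mulr_ge0// ltW.
have [P PQ] := poly_antiderivative Q1.
set Q := P + (c - P.[2^-1])%:P.
have QU y : d <= y <= 1 - d -> `|U y - Q.[y]| <= 2 * eta.
  by move=> yd; apply: (prim_horner_dist lg1 d0) => //; rewrite PQ.
have Qq : Q^`(n.+1) = q by rewrite derivSn derivD derivC addr0 PQ.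
have x01 : 0 <= x <= 1 by move/andP: xd => [h1 h2]; apply/andP; split; lra.
have h2 := hpoly Q x x01; rewrite Qq in h2.
have h3 : Lw a b (q ^+ 2) <= G + eta * (G + 2).
  apply: (le_trans (Lw_sqr_close a1 b1 eta0 (ltW e0) gL2 hq)); rewrite -/G.
  have : (1 + eta^-1) * (eta ^+ 2 * kap) <= 2 * eta.
    have -> : (1 + eta^-1) * (eta ^+ 2 * kap) = eta * ((eta + 1) * kap).
      by field; rewrite gt_eqF.
    rewrite [leRHS]mulrC; apply: ler_wpM2l; first exact: ltW.
    by rewrite -[leRHS]mulr1; apply: ler_pM => //; [lra|exact: ltW|lra].
  by lra.
have h4 : D * Num.sqrt (Lw a b (q ^+ 2)) <= D * Num.sqrt (G + eta * (G + 2)).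
  by apply: ler_wpM2l => //; apply: ler_wsqrtr.
have h5 := QU x xd.
(* [L] is the Lebesgue function of the nodes at x; it is fixed while [eta] tends to 0. *)
have h6 : `|(lagi z (fun j => U (z j))).[x] - (lagi z (fun j => Q.[z j])).[x]| <= 2 * eta * L.
  by apply: lagi_diff => j; apply: QU.
have -> : U x - (lagi z (fun j => U (z j))).[x] =
  (U x - Q.[x]) + (Q.[x] - (lagi z (fun j => Q.[z j])).[x]) -
  ((lagi z (fun j => U (z j))).[x] - (lagi z (fun j => Q.[z j])).[x]) by ring.
apply: (le_trans (ler_normB _ _)).
apply: (le_trans (lerD (ler_normD _ _) (lexx _))).
by lra.
Qed.

End open_interval.

(** * Continuity up to the endpoints and the power substitution *)

Section continuity.
Variable R : realType.
Local Notation mu := (@lebesgue_measure R).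
Local Notation I := (@unitIo R).
Local Notation pre p A := (I `&` (fun t : R => (t `^ p)%R) @^-1` A).
Implicit Types (f g h v : R -> R) (a b c d p x y t : R).

Lemma weightN a b x : 0 < x < 1 -> weight a b x * weight (- a) (- b) x = 1.
Proof.
move=> /andP[x0 x1]; rewrite /weight !powRN mulrACA !mulfV ?mul1r//.
  by rewrite gt_eqF// powR_gt0.
by rewrite gt_eqF// powR_gt0 // subr_gt0.
Qed.

(** |g| is at most the sum of g^2 times the weight and of the inverse weight, and the latter is
    integrable because its exponents exceed -1. *)
Lemma integrable_L2w a b g : a < 1 -> b < 1 -> in_L2w a b g ->
  mu.-integrable I (EFin \o g).
Proof.
move=> a1 b1 [mg gfin].
have na : -1 < - a by rewrite ltrN2.
have nb : -1 < - b by rewrite ltrN2.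
have i1 : mu.-integrable I (fun x => (g x ^+ 2 * weight a b x)%:E).
  apply/integrableP; split.
    apply/measurable_EFinP; apply: measurable_funM; first exact: measurable_funX.
    by apply: continuous_measurable_oo => x x01; exact: continuous_weight_at.
  apply: le_lt_trans gfin; rewrite le_eqVlt; apply/orP; left; apply/eqP.
  apply: eq_integral => x _.
  by rewrite gee0_abs// lee_fin mulr_ge0 ?sqr_ge0 ?weight_ge0.
have i2 := integrable_poly_weight (1 : {poly R}) na nb.
have i3 := @integrableD _ _ R mu I (measurable_itv _) _ _ i1 i2.
apply: (le_integrable _ _ _ i3).
- exact: measurable_itv.
- exact/measurable_EFinP.
move=> x /unitIoP x01.
change ((`|g x|)%:E <= (`|g x ^+ 2 * weight a b x + (1 : {poly R}).[x] * weight (- a) (- b) x|)%:E)%E.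
rewrite lee_fin hornerC mul1r.
apply: le_trans (ler_norm _).
have := weightN a b x01; move: (weight_ge0 a b x) (weight_ge0 (- a) (- b) x).
move: (weight a b x) (weight (- a) (- b) x) (g x) => W V u W0 V0 WV.
have : 0 <= V * (W * `|u| - 1 / 2) ^+ 2 by rewrite mulr_ge0 ?sqr_ge0.
have -> : V * (W * `|u| - 1 / 2) ^+ 2 = (W * V) * (W * `|u| ^+ 2) - (W * V) * `|u| + V / 4.
  by field.
by rewrite WV !mul1r real_normK ?num_real//; nra.
Qed.

(** Integrability up to the ends allows the base point 0, where the indefinite integral is
    continuous; the constant accounts for the base point 1/2 of [prim]. *)
Lemma prim_continuous_extension g c : mu.-integrable I (EFin \o g) ->
  exists2 uc : R -> R, {within `[0, 1], continuous uc} &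
    forall y, 0 < y < 1 -> uc y = c + prim g y.
Proof.
move=> ig; pose G := g \_ I.
have iG : mu.-integrable `[0, 1] (EFin \o G).
  rewrite -restrict_EFin; apply/integrable_restrict; [exact: measurable_itv|exact: measurable_itv|].
  by apply: integrableS ig; [exact: measurable_itv|apply: measurableI; exact: measurable_itv|
    exact: subIsetr].
have cG := parameterized_integral_continuous ler01 iG.
exists (fun y => (c - (\int[mu]_(t in `[0%R, 2^-1]) G t)%R) + (\int[mu]_(t in `[0%R, y]) G t)%R).
  by move=> y; apply: cvgD; [exact: cvg_cst|exact: cG].
move=> y /andP[y0 y1].
have key a b : 0 < a -> a <= b -> b < 1 -> (\int[mu]_(t in `[0%R, b]) G t)%R -
    (\int[mu]_(t in `[0%R, a]) G t)%R = (\int[mu]_(t in `]a, b]) g t)%R.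
  move=> a0 ab b1.
  rewrite (@Rintegral_itvB R G (BLeft 0) (BRight b) a).
  - apply: eq_Rintegral => t; rewrite inE/= in_itv/= => /andP[h1 h2].
    by rewrite /G patchE mem_set//; apply/unitIoP/andP; split; lra.
  - by apply: integrableS iG; [exact: measurable_itv|exact: measurable_itv|
      apply: subset_itvl; rewrite bnd_simp ltW].
  - by rewrite bnd_simp ltW.
  - by rewrite bnd_simp.
rewrite -addrA; congr (_ + _); rewrite addrC /prim; case: (leP 2^-1 y) => hy.
  by rewrite key.
by rewrite -key ?opprB// ?ltW//; lra.
Qed.

(** For p <= 1 the derivative p t^(p-1) is at least p on ]0, 1[, so the inverse map is Lipschitz
    with constant 1 / p. *)
Lemma powR_increment p x y : 0 < p <= 1 -> 0 < x -> x <= y -> y < 1 ->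
  p * (y - x) <= y `^ p - x `^ p.
Proof.
move=> /andP[p0 p1] x0; rewrite le_eqVlt => /predU1P[->|xy] y1; first by rewrite !subrr mulr0.
have dp t : t \in `]x, y[ -> is_derive t 1 (fun u : R => u `^ p) (p * t `^ (p - 1)).
  by rewrite in_itv/= => /andP[t0 _]; apply: is_derive_powR; exact: lt_trans t0.
have [|t] := MVT xy dp.
  apply: continuous_in_subspaceT => t; rewrite inE/= in_itv/= => /andP[xt _].
  exact: is_derive_continuous (is_derive_powR p (lt_le_trans x0 xt)).
rewrite in_itv/= => /andP[xt ty] ->; rewrite -mulrA; apply: ler_wpM2l; first exact: ltW.
rewrite ler_peMl ?subr_ge0 ?(ltW xy)//.
have t0 : 0 < t by exact: lt_trans xt.
have -> : p - 1 = - (1 - p) by rewrite opprB.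
rewrite powRN -[leLHS]invr1 lef_pV2 ?posrE ?powR_gt0//.
by apply: powR_le_one; [apply/andP; split; lra|rewrite subr_ge0].
Qed.

Lemma measurable_powR_preimage p (A : set R) : measurable A ->
  measurable (pre p A).
Proof.
move=> mA; have := @measurable_powR R p; move=> /(measurable_funS measurableT (@subsetT _ I)) h.
by apply: h => //; exact: measurable_itv.
Qed.

(** The preimage lies within (b - a) / p of any one of its points. *)
Lemma powR_preimage_itv p a b : 0 < p <= 1 -> a < b ->
  (mu (pre p `]a, b]) <= (2 / p * (b - a))%:E)%E.
Proof.
move=> p01 ab; have /andP[p0 _] := p01.
have ab0 : 0 <= (b - a) / p by apply: divr_ge0; [rewrite subr_ge0; exact: ltW|exact: ltW].
set S := (X in mu X).
have [[s [Is Ss]]|S0] := pselect (S !=set0); last first.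
  have -> : S = set0 by apply/eqP; apply: contra_notT S0 => /set0P.
  by rewrite measure0 lee_fin mulrAC -mulrA mulr_ge0// mulrC.
have sub : S `<=` `[s - (b - a) / p, s + (b - a) / p].
  move=> t [It]; move: Ss It Is; rewrite /= !in_itv/=.
  move=> /andP[s1 s2] /andP[t0 t1] /andP[s0 s3] /andP[t2 t3].
  have [st|ts] := leP s t.
    have := powR_increment p01 s0 st t1; rewrite -ler_pdivlMl// mulrC => h.
    have : (t `^ p - s `^ p) / p <= (b - a) / p by rewrite ler_pM2r ?invr_gt0//; lra.
    by move=> h'; apply/andP; split; lra.
  have := powR_increment p01 t0 (ltW ts) s3; rewrite -ler_pdivlMl// mulrC => h.
  have : (s `^ p - t `^ p) / p <= (b - a) / p by rewrite ler_pM2r ?invr_gt0//; lra.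
  by move=> h'; apply/andP; split; lra.
apply: (@le_trans _ _ (mu `[s - (b - a) / p, s + (b - a) / p]%classic)).
  apply: le_measure => //; rewrite inE; last exact: measurable_itv.
  by apply: measurable_powR_preimage; exact: measurable_itv.
rewrite lebesgue_measure_itv/= lte_fin; case: ifP => _; last first.
  by rewrite lee_fin mulrAC -mulrA mulr_ge0// mulrC.
by rewrite -EFinD lee_fin le_eqVlt; apply/orP; left; apply/eqP; field; rewrite gt_eqF.
Qed.

Lemma powR_preimage_null p (Z : set R) : 0 < p <= 1 -> measurable Z -> mu Z = 0%E ->
  mu (pre p Z) = 0%E.
Proof.
move=> p01 mZ Z0; have /andP[p0 _] := p01.
apply/eqP; rewrite eq_le measure_ge0 andbT; apply/lee_addgt0Pr => e e0; rewrite add0e.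
have d0 : 0 < e * (p / 2) by rewrite mulr_gt0// divr_gt0.
(* [mu Z] is an infimum over covers by half-open intervals; taking preimages multiplies the total
   length by at most 2 / p. *)
have /ereal_inf_lt[z [/= M covM sMz zDe]] : (mu Z < (e * (p / 2))%:E)%E.
  by rewrite Z0 lte_fin.
have [mM subM] := covM.
have bM n : (mu (pre p (M n)) <= (2 / p)%:E * mu (M n))%E.
  have /ocitvP[-> |[[a b] /= ab ->]] : ocitv (M n) by exact: mM.
    by rewrite preimage_set0 setI0 !measure0 mule0.
  rewrite lebesgue_measure_itv/= lte_fin ab -EFinD -EFinM.
  exact: powR_preimage_itv.
have mM' n : measurable (M n : set R) by move: (mM n); exact: sub_sigma_algebra.
have p20 : (0 <= (2 / p)%:E)%E by rewrite lee_fin divr_ge0// ltW.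
apply: (@le_trans _ _ (\sum_(n <oo) mu (pre p (M n)))%E).
  apply: measure_sigma_subadditive.
  - by move=> n; exact: measurable_powR_preimage.
  - exact: measurable_powR_preimage.
  - by move=> t [It /subM[n _ Mt]]; exists n.
apply: (@le_trans _ _ (\sum_(n <oo) (2 / p)%:E * mu (M n))%E).
  by apply: lee_nneseries => n _.
rewrite nneseriesZl//.
have -> : e%:E = ((2 / p)%:E * (e * (p / 2))%:E)%E.
  by rewrite -EFinM; congr (_%:E); field; rewrite gt_eqF.
apply: lee_wpmul2l => //; apply: le_trans (ltW zDe).
rewrite -sMz lee_nneseries// => i _.
rewrite /= -wlength_Rhull wlength_itv !er_map_idfun.
rewrite -lebesgue_measure_itv le_measure//= ?inE//.
- exact: mM'.
- exact: sub_Rhull.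
Qed.

End continuity.

(** * Return to the original variable *)

Section conclusion.
Variable R : realType.
Local Notation mu := (@lebesgue_measure R).
Local Notation I := (@unitIo R).

(** Only the term [s = 0] survives at 1, as only [s = n] does at -1; neither end can therefore be a
    node. *)
Lemma jacobi_horner1_gt0 (a b : R) n : -1 < a -> -1 < b -> 0 < (jacobi a b n).[1].
Proof.
move=> a1 b1; rewrite /jacobi horner_sum big_ord_recl big1 ?addr0 => [|i _].
  rewrite hornerZ hornerM !horner_exp !hornerZ !hornerD hornerN hornerX hornerC /= subn0 expr0 mul1r.
  rewrite (_ : 2^-1 * (1 + 1) = 1 :> R); last by field.
  by rewrite expr1n mulr1 mulr_gt0// gen_binomial_gt0.
by rewrite hornerZ hornerM !horner_exp !hornerZ !hornerD hornerN hornerX hornerC subrr mulr0 expr0n /= mul0r mulr0.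
Qed.

Lemma jacobi_hornerN1_neq0 (a b : R) n : -1 < a -> -1 < b -> (jacobi a b n).[-1] != 0.
Proof.
move=> a1 b1; rewrite /jacobi horner_sum big_ord_recr big1 ?add0r => [|i _].
  rewrite hornerZ hornerM !horner_exp !hornerZ !hornerD hornerN hornerX hornerC /= subnn expr0 mulr1 -opprD.
  rewrite (_ : 2^-1 * - (1 + 1) = -1 :> R); last by field.
  rewrite add0r; apply: mulf_neq0; last by rewrite signr_eq0.
  by apply: mulf_neq0; rewrite gt_eqF// gen_binomial_gt0.
rewrite hornerZ hornerM !horner_exp !hornerZ !hornerD hornerN hornerX hornerC /= addNr mulr0 expr0n subn_eq0 leqNgt ltn_ord /=.
by rewrite !mulr0.
Qed.

Lemma zeros_unitIo (a b lambda : R) N (x : 'I_N.+1 -> R) : -1 < a -> -1 < b -> 0 < lambda ->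
  are_zeros a b lambda x -> forall i, 0 < x i `^ lambda < 1.
Proof.
move=> a1 b1 l0 xz i; have [_ h] := xz.
have : range x (x i) by exists i.
rewrite h => -[]; rewrite /unitI/= in_itv/= => /andP[x0 x1]; rewrite /muntz_jacobi => J0.
have xn0 : x i != 0.
  apply/eqP => xi0; move: J0; rewrite xi0 powR0 ?gt_eqF// mulr0 sub0r.
  by apply/eqP; exact: jacobi_hornerN1_neq0.
have xn1 : x i != 1.
  apply/eqP => xi1; move: J0; rewrite xi1 powR1 mulr1 (_ : 2 - 1 = 1 :> R); last by ring.
  by apply/eqP; rewrite gt_eqF// jacobi_horner1_gt0.
have x0' : 0 < x i by rewrite lt_def xn0.
have x1' : x i < 1 by rewrite lt_def eq_sym xn1.
rewrite powR_gt0//= -[ltRHS](_ : 1 `^ lambda = 1); last by rewrite powR1.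
by apply: gt0_ltr_powR; rewrite ?nnegrE.
Qed.

Lemma unitIo_margin N (z : 'I_N.+1 -> R) (x : R) : 0 < x < 1 -> (forall j, 0 < z j < 1) ->
  exists d : R, [/\ 0 < d, d <= x <= 1 - d & forall j, d <= z j <= 1 - d].
Proof.
have near_margin y : 0 < y < 1 -> \forall d \near (0 : R)^'+, d <= y <= 1 - d.
  move=> /andP[y0 y1]; near=> d; apply/andP; split.
    by near: d; exact: nbhs_right_le.
  rewrite lerBrDr addrC -lerBrDr; near: d; apply: nbhs_right_le.
  by rewrite subr_gt0.
move=> /near_margin hx hz.
have hz' : \forall d \near (0 : R)^'+, forall j, d <= z j <= 1 - d.
  by apply: filter_forall => j; exact: near_margin.
have [d [[d1 d2] d3]] := filter_ex (filterI (filterI hx hz') (nbhs_right_gt (0 : R))).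
by exists d.
Unshelve. all: by end_near. Qed.

Lemma closed_bound (u : R -> R) (p : {poly R}) (B : R) : {within `[0, 1], continuous u} ->
  (forall x, 0 < x < 1 -> `|u x - p.[x]| <= B) ->
  forall x, 0 <= x <= 1 -> `|u x - p.[x]| <= B.
Proof.
move=> /(continuous_within_itvP _ ltr01)[_ u0 u1] h x /andP[].
rewrite le_eqVlt => /predU1P[<- _|x0].
  have c : `|u t - p.[t]| @[t --> (0 : R)^'+] --> `|u 0 - p.[0]|.
    apply: cvg_norm; apply: cvgB => //.
    by apply: cvg_at_right_continuous; exact: continuous_horner_at.
  apply: (cvgr_to_le c); near=> t; apply: h; apply/andP; split; near: t.
    exact: nbhs_right_gt.
  exact: nbhs_right_lt.
rewrite le_eqVlt => /predU1P[->|x1]; last by apply: h; rewrite x0.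
have c : `|u t - p.[t]| @[t --> (1 : R)^'-] --> `|u 1 - p.[1]|.
  apply: cvg_norm; apply: cvgB => //.
  by apply: cvg_at_left_continuous; exact: continuous_horner_at.
apply: (cvgr_to_le c); near=> t; apply: h; apply/andP; split; near: t.
  exact: nbhs_left_gt.
exact: nbhs_left_lt.
Unshelve. all: by end_near. Qed.

Lemma continuous_comp_powR (u : R -> R) (lambda : R) : 0 < lambda ->
  {within `[0, 1], continuous u} -> {within `[0, 1], continuous (fun t => u (t `^ lambda))}.
Proof.
move=> l0 /(continuous_within_itvP _ ltr01)[uc u0 u1].
have pow01 t : 0 < t < 1 -> 0 < t `^ lambda < 1.
  move=> /andP[t0 t1]; rewrite powR_gt0//= -[ltRHS](_ : 1 `^ lambda = 1); last by rewrite powR1.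
  by apply: gt0_ltr_powR; rewrite ?nnegrE// ltW.
apply/(continuous_within_itvP _ ltr01); split.
- move=> t; rewrite in_itv/= => t01; have /andP[t0 t1] := t01.
  apply: (@continuous_comp _ _ _ (fun t : R => t `^ lambda) u).
    exact: is_derive_continuous (is_derive_powR lambda t0).
  by apply: uc; rewrite in_itv/= pow01.
- have c : (t : R) `^ lambda @[t --> 0^'+] --> (0 : R)^'+.
    have h := powR_cvg_right0 l0; rewrite powR0 ?gt_eqF// in h.
    move=> A [e /= e0 eA].
    move/cvgrPdist_lt : h => /(_ _ e0) h.
    have h2 := nbhs_right_gt (0 : R).
    apply: filterS2 h h2 => t ht t0; apply: eA => //; exact: powR_gt0.
  by rewrite powR0 ?gt_eqF//; exact: (cvg_comp _ _ c u0).
have c : (t : R) `^ lambda @[t --> 1^'-] --> (1 : R)^'-.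
  have h : (t : R) `^ lambda @[t --> 1^'-] --> (1 : R).
    rewrite -[X in _ --> X](_ : 1 `^ lambda = 1); last by rewrite powR1.
    apply: cvg_at_left_continuous.
    exact: is_derive_continuous (is_derive_powR lambda ltr01).
  move=> A [e /= e0 eA].
  move/cvgrPdist_lt : h => /(_ _ e0) h.
  have h2 := nbhs_left_gt (ltr01 : (0 : R) < 1).
  have h3 := nbhs_left_lt (1 : R).
  apply: filterS3 h h2 h3 => t ht t0 t1; apply: eA => //.
  by have /andP[] := pow01 t (introT andP (conj t0 t1)).
have -> : (1 : R) `^ lambda = 1 by rewrite powR1.
exact: (cvg_comp _ _ c u1).
Qed.

Lemma interp_lagi (lambda : R) N (x : 'I_N.+1 -> R) (u : R -> R) t :
  interp lambda x (fun s => u (s `^ lambda)) t =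
  (lagi (fun j => x j `^ lambda) (fun j => u (x j `^ lambda))).[t `^ lambda].
Proof.
rewrite /interp /lagi horner_sum; apply: eq_bigr => j _; rewrite hornerZ; congr (_ * _).
rewrite /cardinal_fun /lag horner_prod; apply: eq_bigr => i _.
by rewrite hornerZ !hornerE mulrC.
Qed.

(** The exceptional set is pulled back by t -> t^lambda, which keeps it null, and the two endpoints
    are added to it. *)
Lemma ae_eq_comp_powR (lambda : R) (v u : R -> R) : 0 < lambda <= 1 ->
  ae_eq mu I (fun x => v (x `^ lambda^-1)) u ->
  ae_eq mu (@unitI R) (fun t => u (t `^ lambda)) v.
Proof.
move=> l01; have /andP[l0 _] := l01.
move=> [Z [mZ Z0 hZ]].
have nZ : mu.-negligible (I `&` (fun t : R => (t `^ lambda)%R) @^-1` Z).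
  exists (I `&` (fun t : R => (t `^ lambda)%R) @^-1` Z); split => //.
    exact: measurable_powR_preimage.
  exact: powR_preimage_null.
have n0 : mu.-negligible [set (0 : R)].
  by exists [set 0]; split => //; rewrite lebesgue_measure_set1.
have n1 : mu.-negligible [set (1 : R)].
  by exists [set 1]; split => //; rewrite lebesgue_measure_set1.
apply: (negligibleS _ (negligibleU (negligibleU n0 n1) nZ)) => t /= ht.
have [t0|t0] := eqVneq t 0; first by left; left.
have [t1|t1] := eqVneq t 1; first by left; right.
right; split.
  apply: contrapT => It; apply: ht; rewrite /unitI/= in_itv/= => /andP[h1 h2].
  by exfalso; apply: It; apply/unitIoP; rewrite !lt_def t0 h1 eq_sym t1 h2.
apply: hZ => /= hZ; apply: ht; rewrite /unitI/= in_itv/= => /andP[h1 h2].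
have {}t0 : 0 < t by rewrite lt_def t0.
have {}t1 : t < 1 by rewrite lt_def eq_sym t1.
rewrite -hZ; first by rewrite -powRrM mulfV ?gt_eqF// powRr1// ltW.
apply/unitIoP; rewrite powR_gt0//= -[ltRHS](_ : 1 `^ lambda = 1); last by rewrite powR1.
by apply: gt0_ltr_powR; rewrite ?nnegrE// ltW.
Qed.

Lemma norm_L2w_ae_eq (a b : R) (f g : R -> R) : measurable_fun I f -> measurable_fun I g ->
  ae_eq mu I f g -> norm_L2w a b f = norm_L2w a b g.
Proof.
move=> mf mg fg; rewrite /norm_L2w; congr Num.sqrt; rewrite /Rintegral; congr fine.
have mw : measurable_fun I (weight a b).
  by apply: continuous_measurable_oo => y y01; exact: continuous_weight_at.
apply: ae_eq_integral.
- exact: measurable_itv.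
- by apply/measurable_EFinP; apply: measurable_funM => //; exact: measurable_funX.
- by apply/measurable_EFinP; apply: measurable_funM => //; exact: measurable_funX.
- by move: fg; apply: (@filterS _ _ (ae_filter_ringOfSetsType mu)) => x /= h Ix; rewrite h.
Qed.

End conclusion.

Unset Implicit Arguments.

(** Both restrictions on N matter. For N = 0 the power of N is 0 by convention; and when N + 1 < m,
    a polynomial of degree N + 1 in x^lambda has a zero right-hand side but a nonzero interpolation
    error. The representative is the continuous extension of a primitive, composed with t ->
    t^lambda. *)
Theorem proposition2p5 (R : realType) (lambda alpha beta : R)
    (hlambda : 0 < lambda <= 1)
    (halpha : -1 < alpha <= - (2^-1)) (hbeta : -1 < beta <= - (2^-1))
    (m : nat) (hm : (1 <= m)%N) :
  exists2 c : R, 0 < c &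
    forall v : R -> R,
      in_B m alpha beta (fun x => v (x `^ lambda^-1)) ->
      exists2 vc : R -> R, continuous_representative v vc &
        forall (w : R -> R),
          weak_derivative m (fun x => v (x `^ lambda^-1)) w ->
          forall (N : nat) (x : 'I_N.+1 -> R),
            (1 <= N)%N -> (m <= N.+1)%N -> are_zeros alpha beta lambda x ->
            (sup_norm (fun t => vc t - interp lambda x vc t)%R <=
             (c * N%:R `^ (2^-1 - m%:R) *
              norm_L2w (alpha + m%:R) (beta + m%:R) w)%R%:E)%E.
Proof.
have /andP[al1 al2] := halpha; have /andP[be1 be2] := hbeta; have /andP[l0 l1] := hlambda.
have [C C0 HC] := poly_interp_error al1 al2 be1 be2 hm.
exists C => // v hB; set f := (fun x => v (x `^ lambda^-1)) in hB *.
case: m hm HC hB => // n _ HC hB.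
have /boolp.choice[g gP] : forall k, exists g, (k <= n.+1)%N ->
    weak_derivative k f g /\ in_L2w (alpha + k%:R) (beta + k%:R) g.
  move=> k; have [kn|_] := boolP (k <= n.+1)%N; last by exists (fun=> 0).
  by have [g gP] := hB k kn; exists g.
have gw k : (k < n.+1)%N -> weak_derivative 1 (g k) (g k.+1).
  by move=> kn; exact: weak_derivative_succ (gP k (ltnW kn)).1 (gP k.+1 kn).1.
have [[lf lg0 g0E] _] := gP 0%N isT.
(* The condition of order 0 only says that [g 0] has the same pairings as [f]. *)
have fg0 : ae_eq (@lebesgue_measure R) (@unitIo R) f (g 0%N).
  apply: weak_derivative_unique => // phi tphi.
  by have := g0E _ tphi; rewrite expr0 mul1r.
have [c hc] := weak_derivative_prim (gw 0%N isT).
(* The exponents alpha + 1 and beta + 1 are at most 1/2. *)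
have ig1 : (@lebesgue_measure R).-integrable (@unitIo R) (EFin \o g 1%N).
  by apply: (integrable_L2w _ _ (gP 1%N isT).2); lra.
have [uc ucc ucE] := prim_continuous_extension c ig1.
exists (fun t => uc (t `^ lambda)).
  split; first exact: continuous_comp_powR.
  apply: ae_eq_comp_powR => //.
  have := hc; have := fg0; apply: (@filterS2 _ _ (ae_filter_ringOfSetsType _)) => y /= h1 h2 Iy.
  by rewrite -[LHS]/(f y) (h1 Iy) (h2 Iy) ucE//; apply/unitIoP.
move=> w hw N x N1 mN xz.
pose z j := x j `^ lambda.
have z01 := zeros_unitIo al1 be1 l0 xz.
have z01' i : 0 <= z i <= 1 by have /andP[h1 h2] := z01 i; rewrite /z !ltW.
have D0 : 0 <= C * N%:R `^ (2^-1 - n.+1%:R) by rewrite mulr_ge0 ?powR_ge0// ltW.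
have hpoly := HC N z (zeros_inj l0 xz) z01' (@zeros_nodal_orth _ _ _ _ _ _ al1 be1 l0 xz) N1 mN.
(* Both are m-th weak derivatives of the same function, hence equal almost everywhere. *)
have -> : norm_L2w (alpha + n.+1%:R) (beta + n.+1%:R) w =
    norm_L2w (alpha + n.+1%:R) (beta + n.+1%:R) (g n.+1).
  have [[_ lg gE] _] := gP n.+1 (leqnn _); have [_ lw wE] := hw.
  have [mg _ _] := lg; have [mw _ _] := lw.
  apply: norm_L2w_ae_eq => //; apply: weak_derivative_unique => // phi tphi.
  apply: (@mulfI _ ((-1) ^+ n.+1)); first by rewrite signr_eq0.
  by rewrite -(wE _ tphi) (gE _ tphi).
apply: ub_ereal_sup => _ [t tI <-]; rewrite lee_fin interp_lagi.
have t01 : 0 <= t `^ lambda <= 1.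
  by move: tI; rewrite /unitI/= in_itv/= => ht; rewrite powR_ge0 powR_le_one// ltW.
(* The margin [d] depends on y and on the nodes, but the bound does not, so continuity extends it to
   the endpoints. *)
apply: (closed_bound ucc) => // y y01.
have [d [d0 yd zd]] := @unitIo_margin _ N z y y01 z01.
rewrite (ucE _ y01).
rewrite (_ : (fun j => uc (x j `^ lambda)) = (fun j => c + prim (g 1%N) (z j))); last first.
  by apply/funext => j; rewrite ucE.
have gL := (gP n.+1 (leqnn _)).2.
have hfin := interp_error_open c al1 be1 D0 hpoly gw gL d0 yd zd.
exact: hfin.
Qed.
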